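(* Let $\beta<-2$ and $\kappa_g>0$. There exist constants $U_0=U_0(\beta,\kappa_g)>0$ and $c_0=c_0(\beta,\kappa_g)>0$ such that the following holds. Let the random source $g$ (with amplitude function $\gamma$ vanishing on $[\kappa_g,\infty)$) and the random time-independent velocity $u$ (with parameters $\beta$ and $U$) be as in the context, with $0<U\le U_0$ (''$U$ sufficiently small for convergence of the iteration'' $\theta^{(n)}$ described in the context). Let $\theta$ be the mean-zero solution of $-\Delta\theta+u\cdot\nabla\theta=g$ on $D$, obtained as the limit of that iteration. Then one can write $$\theta=-\Delta^{-1}g+\vartheta+\delta\theta,$$ where, with expectation and variance taken over the random phases $\phi$ of $u$ and $\xi$ of $g$, $$\mathsf{E}\bigl(|\mathsf{P}_{\kappa,2\kappa}\vartheta|_{L^2}^2\bigr)\simeq \pi\,\mathcal{G}_0(g)\,\frac{4^{\beta}-1}{2\beta}\,U^2\kappa^{2\beta},$$ $$\mathsf{var}\bigl(|\mathsf{P}_{\kappa,2\kappa}\vartheta|_{L^2}^2\bigr)\lesssim \frac{\pi\,\mathcal{G}_1(g)}{2}\,\frac{4^{2\beta-1}-1}{4\beta-2}\,U^4\kappa^{4\beta-2}$$ as $\kappa\to\infty$, and the remainder is bounded, for all $\kappa>0$, by $$|\mathsf{P}_{\kappa,2\kappa}\delta\theta|_{L^2}^2\le c_0(\beta,\kappa_g)\,|\nabla^{-1}g|_{L^\infty}^2\,U^3\kappa^{2\beta}.$$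
   Context: Domain and Fourier conventions. $D=[0,2\pi]^2$ with periodic boundary conditions; all functions have zero mean over $D$. Write $f(x)=\sum_{k\in\mathbb{Z}^2}f_k e^{i k\cdot x}$. The $L^2$ norm is normalized so that $|f|_{L^2}^2=\sum_k|f_k|^2$. $\Delta^{-1}$ is the inverse Laplacian on mean-zero functions, and $\nabla^{-1}g$ denotes $\nabla\Delta^{-1}g$ (so its $k$-th Fourier coefficient has modulus $|g_k|/|k|$). The spectral projection is $\mathsf{P}_{\kappa,\kappa'}f=\sum_{\kappa\le|k|<\kappa'}f_ke^{ik\cdot x}$. Half-plane. $\mathbb{Z}_+^2=\{(m,n):m\in\mathbb{Z},\,n\in\{1,2,\dots\}\}\cup\{(m,0):m\in\{1,2,\dots\}\}$. Velocity. $u=\nabla^\perp\psi=(-\partial_y\psi,\partial_x\psi)$ with $\psi(x)=U\sum_{k\in\mathbb{Z}^2\setminus\{0\}}|k|^\beta e^{i(\phi_k+k\cdot x)}$, where $U>0$ is a constant, the phases $\phi_k$ (time-independent), $k\in\mathbb{Z}_+^2$, are independent random variables uniformly distributed in $[0,2\pi)$, and $\phi_{-k}=-\phi_k$ (mod $2\pi$). Source. $g(x)=-\sum_k\gamma(|k|)\,|k|^2e^{i(\xi_k+k\cdot x)}$, where $\gamma$ is a real-valued function with $\gamma(0)=0$ and $\gamma(\kappa)=0$ for $\kappa\ge\kappa_g$; write $\gamma_k=\gamma(|k|)$. The phases $\xi_k$, $k\in\mathbb{Z}_+^2$, are independent, uniformly distributed in $[0,2\pi)$, and independent of the $\phi$'s,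 with $\xi_{-k}=-\xi_k$ (mod $2\pi$). Iteration. $\theta^{(0)}=-\Delta^{-1}g$ and $\theta^{(n+1)}=-\Delta^{-1}\bigl[g-u\cdot\nabla\theta^{(n)}\bigr]$ for $n\ge0$. Constants. $$\mathcal{G}_0(g)=\sum_{j\in\mathbb{Z}^2}|j|^2\gamma_j^2=|\nabla^{-1}g|_{L^2}^2,$$ $$\mathcal{G}_1(g)=\sum_{i,j\in\mathbb{Z}^2}\bigl(3i_x^2j_x^2+i_x^2j_y^2+i_y^2j_x^2+3i_y^2j_y^2+4i_xi_yj_xj_y\bigr)\gamma_i^2\gamma_j^2,$$ where $j=(j_x,j_y)$, etc. Asymptotic notation. $F(\kappa)\simeq G(\kappa)$ means $F(\kappa)=(1+\varepsilon(\kappa))G(\kappa)$ with $\varepsilon(\kappa)\to0$ as $\kappa\to\infty$ (i.e. $\lim_{\kappa\to\infty}F/G=1$ when $G\neq0$); $F(\kappa)\lesssim G(\kappa)$ means $F(\kappa)\le(1+\varepsilon(\kappa))G(\kappa)$ with $\varepsilon(\kappa)\to0$ as $\kappa\to\infty$. *)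

(* Defs.v *)
From mathcomp Require Import all_boot all_order all_algebra.
From mathcomp Require Import complex.
From mathcomp Require Import all_classical all_reals all_analysis.

Set Implicit Arguments.
Unset Strict Implicit.
Unset Printing Implicit Defensive.

Import Order.TTheory GRing.Theory Num.Theory.
Import numFieldNormedType.Exports.

Local Open Scope classical_set_scope.
Local Open Scope ring_scope.
Local Open Scope complex_scope.

Notation Z2 := (int * int)%type.

Definition Z2plus : set Z2 := [set k | 0 < k.2 \/ (k.2 = 0 /\ 0 < k.1)].

(* A 2pi-periodic function (or distribution) f on the torus is represented by
   the family of its Fourier coefficients, f(x) = \sum_k f_k exp(i k.x). *)
Definition field (R : realType) : Type := Z2 -> R[i].

Section fourier.
Context {R : realType}.
Implicit Types (k j : Z2) (f g theta psi : field R) (kappa : R).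

Definition knorm k : R := Num.sqrt (k.1%:~R ^+ 2 + k.2%:~R ^+ 2).

Definition cmod2 (z : R[i]) : R := complex.Re z ^+ 2 + complex.Im z ^+ 2.

Definition expi (x : R) : R[i] := cos x +i* sin x.

(* Unordered sums of the positive and negative parts; meaningful for absolutely
   summable families only. *)
Definition rsum (T : choiceType) (a : T -> R) : R :=
  fine (\esum_(t in [set: T]) (Num.max (a t) 0)%:E)
  - fine (\esum_(t in [set: T]) (Num.max (- a t) 0)%:E).

Definition csum (T : choiceType) (a : T -> R[i]) : R[i] :=
  rsum (fun t => complex.Re (a t)) +i* rsum (fun t => complex.Im (a t)).

Definition eval f (x : R * R) : R[i] :=
  csum (fun k => f k * expi (k.1%:~R * x.1 + k.2%:~R * x.2)).

Definition L2sq f : \bar R := \esum_(k in [set: Z2]) (cmod2 (f k))%:E.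

Definition dx f : field R := fun k => 'i * (k.1%:~R)%:C * f k.

Definition dy f : field R := fun k => 'i * (k.2%:~R)%:C * f k.

Definition lap f : field R := fun k => - (knorm k ^+ 2)%:C * f k.

Definition lap_inv f : field R :=
  fun k => if k == 0 then 0 else - ((knorm k ^+ 2)^-1)%:C * f k.

Definition H1sq f : \bar R := (L2sq (dx f) + L2sq (dy f))%E.

(* Product of functions: the convolution of the Fourier coefficients, which
   converges absolutely when f and g are in L^2. *)
Definition fmul f g : field R := fun k => csum (fun j => f (k - j) * g j).

Definition proj kappa kappa' f : field R :=
  fun k => if kappa <= knorm k < kappa' then f k else 0.

(* Squared L^2 norm of the projection of f on kappa <= |k| < 2 kappa; [fine] is
   harmless, since only finitely many wavenumbers contribute. *)
Definition band_energy kappa f : R := fine (L2sq (proj kappa (2 * kappa) f)).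

Definition perp_grad psi : field R * field R := (\- dy psi, dx psi).

Definition advect (u : field R * field R) theta : field R :=
  fmul u.1 (dx theta) \+ fmul u.2 (dy theta).

Definition mean_zero f : Prop := f 0 = 0.

Definition real_valued f : Prop := forall k, f (- k) = (f k)^*.

Definition torus : set (measurableTypeR R * measurableTypeR R) :=
  `[0, 2 * pi]%classic `*` `[0, 2 * pi]%classic.

Lemma measurable_torus : measurable torus.
Proof. by apply: measurableX; exact: measurable_itv. Qed.

(* Essential supremum over the torus of the Euclidean length of the vector
   field v. *)
Definition Linfty (v : field R * field R) : \bar R :=
  Lnorm (mrestr (lebesgue_measure \x lebesgue_measure)%E measurable_torus) +oo%E
    (fun x => (Num.sqrt (cmod2 (eval v.1 x) + cmod2 (eval v.2 x)))%:E).

Definition grad_inv g : field R * field R := (dx (lap_inv g), dy (lap_inv g)).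

Definition stream (beta U : R) (phi : Z2 -> R) : field R :=
  fun k => if k == 0 then 0 else (U * knorm k `^ beta)%:C * expi (phi k).

Definition velocity (beta U : R) (phi : Z2 -> R) : field R * field R :=
  perp_grad (stream beta U phi).

Definition source (gamma : R -> R) (xi : Z2 -> R) : field R :=
  fun k => - (gamma (knorm k) * knorm k ^+ 2)%:C * expi (xi k).

Fixpoint iterate (u : field R * field R) g (n : nat) : field R :=
  if n is m.+1 then \- lap_inv (g \- advect u (iterate u g m))
  else \- lap_inv g.

(* -Delta theta + u . grad theta = g, coefficient by coefficient, that is, in
   the sense of periodic distributions. *)
Definition solves (u : field R * field R) g theta : Prop :=
  (\- lap theta) \+ advect u theta = g.

Definition G0 (gamma : R -> R) : R :=
  rsum (fun j : Z2 => knorm j ^+ 2 * gamma (knorm j) ^+ 2).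

Definition G1 (gamma : R -> R) : R :=
  rsum (fun p : Z2 * Z2 =>
    let ix : R := p.1.1%:~R in let iy : R := p.1.2%:~R in
    let jx : R := p.2.1%:~R in let jy : R := p.2.2%:~R in
    (3 * ix ^+ 2 * jx ^+ 2 + ix ^+ 2 * jy ^+ 2 + iy ^+ 2 * jx ^+ 2
     + 3 * iy ^+ 2 * jy ^+ 2 + 4 * ix * iy * jx * jy)
    * gamma (knorm p.1) ^+ 2 * gamma (knorm p.2) ^+ 2).

Definition asymp_eq (F : R -> \bar R) (G : R -> R) : Prop :=
  exists2 eps : R -> R, eps x @[x --> +oo] --> (0 : R)
    & forall kappa, 0 < kappa -> F kappa = ((1 + eps kappa) * G kappa)%:E.

Definition asymp_le (F : R -> \bar R) (G : R -> R) : Prop :=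
  exists2 eps : R -> R, eps x @[x --> +oo] --> (0 : R)
    & forall kappa, 0 < kappa -> (F kappa <= ((1 + eps kappa) * G kappa)%:E)%E.

Lemma two_pi_gt0 : 0 < 2 * pi :> R.
Proof. by rewrite mulr_gt0// pi_gt0. Qed.

End fourier.

Section randomness.
Context {d : measure_display} {Omega : measurableType d} {R : realType}.
Variable P : probability Omega R.

(* A random mean-zero real function in L^2. *)
Definition random_field (f : Omega -> field R) : Prop :=
  (forall k, measurable_fun [set: Omega] (fun w => complex.Re (f w k)) /\
             measurable_fun [set: Omega] (fun w => complex.Im (f w k))) /\
  (forall w, [/\ mean_zero (f w), real_valued (f w) & (L2sq (f w) < +oo)%E]).

Definition mutually_independent (I : choiceType) (D : set I)
    (X : I -> {RV P >-> R}) : Prop :=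
  forall (s : seq I) (A : I -> set R), uniq s ->
    (forall i, i \in s -> D i) -> (forall i, measurable (A i)) ->
    P (\bigcap_(i in [set` s]) X i @^-1` A i) =
    (\prod_(i <- s) P (X i @^-1` A i))%E.

(* The library's uniform law lives on the closed interval [0, 2pi], whose
   endpoint is negligible. *)
Definition uniform_phase (X : {RV P >-> R}) : Prop :=
  forall A : set R, measurable A ->
    distribution P X A = uniform_prob two_pi_gt0 A.

Definition odd_mod_2pi (phi : Z2 -> {RV P >-> R}) : Prop :=
  forall k, Z2plus k -> forall w, exists n : int,
    phi (- k) w = - phi k w + n%:~R * (2 * pi).

(* All phases phi_k, xi_k, k in the half-plane, are jointly independent: each
   family is independent, and the two are independent of each other. *)
Definition random_phases (phi xi : Z2 -> {RV P >-> R}) : Prop :=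
  [/\ (forall k, Z2plus k -> uniform_phase (phi k) /\ uniform_phase (xi k)),
      mutually_independent [set i : bool * Z2 | Z2plus i.2]
        (fun i => if i.1 then phi i.2 else xi i.2),
      odd_mod_2pi phi & odd_mod_2pi xi].

End randomness.

(* Main.v *)
(* Let X = lap_inv (u . grad theta0), theta0 = - lap_inv g, be the first correction of the iteration.
   Its k-th coefficient is a sum over the finitely many modes j of g of e^(i (phi_(k-j) + xi_j)) times
   a factor of size |k|^(beta-1).  Hence E|X_k|^2 is explicit, and its sum over a band is evaluated
   with Gauss's estimate for the number of lattice points in a disc.  The later corrections have
   size U^2.

   The energy of X in a band fluctuates at the order kappa^(4 beta - 2), in general with a larger
   constant than the one claimed.  Therefore vartheta is not X itself: in each shell
   m^2 <= |k| < (m+1)^2 the coefficients of X are multiplied by a common random gain that makes the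
   energy of the shell equal to its mean, provided that this gain is within O(sqrt U) of 1.  The
   difference has size U^(3/2) and is moved to delta theta.  What is left of the fluctuations comes
   from the shells where the gain is refused and from the two shells cut by the ends of the band.
   In the fourth moment of the energy of a shell only those quadruples of wavenumbers contribute
   that split into two pairs of wavenumbers close to each other up to sign; it is thus of the order
   of the square of the number of points, which bounds the variance by O(kappa^(4 beta - 5/2)). *)
Require Import Defs.
From mathcomp Require Import all_boot all_order all_algebra.
From mathcomp Require Import complex.
From mathcomp Require Import all_classical all_reals all_analysis.
From mathcomp Require Import measurable_realfun ess_sup_inf ring lra zify.

Set Implicit Arguments.
Unset Strict Implicit.
Unset Printing Implicit Defensive.

Import Order.TTheory GRing.Theory Num.Theory.
Import numFieldNormedType.Exports.

Local Open Scope classical_set_scope.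
Local Open Scope ring_scope.
Local Open Scope complex_scope.

(** All bounds are pointwise in Fourier space: |f_k| <= A |k|^(beta-1) is preserved by f -> lap_inv
    (u . grad f) with a factor O(U). This gives the convergence of the iteration and, since a band
    holds O(kappa^2) wavenumbers, energies O(kappa^(2 beta)). The thickness of the shells comes from
    a count. Put kappa = x^2 and y = kappa^(2 beta - 2), the size of |X_k|^2. A shell has about x^3
    points, mean energy of order x^3 y and variance O(x^3 y^2). It must be thin, so that the two cut
    shells are negligible against x^4 y^2 = kappa^(4 beta - 2), and thick, so that its relative
    fluctuation is small: a refused gain means an excess above rho times the mean, and
    Cauchy-Schwarz over the O(x) inner shells then leaves only O(x^2 y^2). Since the variance is of
    lower order than the asserted bound, G1 enters through its positivity; when gamma vanishes at
    all wavenumbers, both sides are 0. The same second moment, taken about the explicit sum of the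
    spectrum, also yields the mean. *)

Local Notation nc := Normc.normc.

(** * Unordered sums *)

Section unordered_sums.
Context {R : realType} {T : choiceType}.
Implicit Types (a b : T -> R) (s : seq T) (K l : R).

(** Summability is expressed through duplicate-free lists, so that every estimate below is one on
    finite sums. *)
Definition abs_bounded a K := forall s, uniq s -> \sum_(t <- s) `|a t| <= K.

Lemma perm_filter_mem (S : eqType) (s0 s : seq S) : uniq s0 -> uniq s -> {subset s0 <= s} ->
  perm_eq s0 [seq t <- s | t \in s0].
Proof.
move=> u0 us s0s; apply: uniq_perm => //; first exact: filter_uniq.
by move=> t; rewrite mem_filter; case: (boolP (t \in s0)) => // /s0s ->.
Qed.

Lemma ler_sum_subset (S : eqType) (f : S -> R) (s0 s : seq S) : (forall t, 0 <= f t) ->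
  uniq s0 -> uniq s -> {subset s0 <= s} -> \sum_(t <- s0) f t <= \sum_(t <- s) f t.
Proof.
move=> f0 u0 us s0s; rewrite (perm_big _ (perm_filter_mem u0 us s0s)) big_filter.
by rewrite [leRHS](bigID (mem s0))/= lerDl sumr_ge0.
Qed.

Lemma esum_bounded a K : (forall t, 0 <= a t) -> abs_bounded a K ->
  (\esum_(t in [set: T]) (a t)%:E <= K%:E)%E.
Proof.
move=> a0 aK; apply: ge_ereal_sup => _ [F [finF _] <-].
rewrite fsbig_finite// sumEFin lee_fin.
apply: le_trans (aK _ (finmap.fset_uniq _)).
by apply: ler_sum => t _; rewrite ler_norm.
Qed.

Lemma esum_ge_seq a s : (forall t, 0 <= a t) -> uniq s ->
  ((\sum_(t <- s) a t)%:E <= \esum_(t in [set: T]) (a t)%:E)%E.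
Proof.
move=> a0 us; apply: esum_ge; exists [set` s]; first by split.
by rewrite -fsbig_seq//= sumEFin.
Qed.

Lemma esum_fin_bounded a K : (forall t, 0 <= a t) -> abs_bounded a K ->
  \esum_(t in [set: T]) (a t)%:E \is a fin_num.
Proof.
move=> a0 aK; rewrite ge0_fin_numE; last by apply: esum_ge0 => t _; rewrite lee_fin.
exact: le_lt_trans (esum_bounded a0 aK) (ltry _).
Qed.

Lemma has_sum_ge0 a K : (forall t, 0 <= a t) -> abs_bounded a K ->
  forall e : R, 0 < e -> exists2 s0, uniq s0 & forall s, uniq s -> {subset s0 <= s} ->
    `|\sum_(t <- s) a t - fine (\esum_(t in [set: T]) (a t)%:E)| < e.
Proof.
move=> a0 aK e e0; have lfin := esum_fin_bounded a0 aK.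
have [_ [F [finF _] <-] lx] := ub_ereal_sup_adherent e0 lfin.
exists (finmap.enum_fset (fset_set F)); first exact: finmap.fset_uniq.
move=> s us s0s.
have := esum_ge_seq a0 us.
rewrite -(fineK lfin) lee_fin; set l := fine _ => sl.
have: l - e < \sum_(t <- s) a t.
  rewrite -lte_fin; apply: lt_le_trans (_ : \sum_(x \in F) (a x)%:E <= _)%E.
    by rewrite EFinD EFinN fineK.
  rewrite fsbig_finite// sumEFin lee_fin.
  by apply: ler_sum_subset => //; exact: finmap.fset_uniq.
by move=> al; rewrite /= ltr_norml; lra.
Qed.

Lemma abs_bounded_pos a K : abs_bounded a K -> abs_bounded (fun t => Num.max (a t) 0) K.
Proof.
move=> aK s us; apply: le_trans (aK s us); apply: ler_sum => t _.
by rewrite /Num.max; case: ifP => // _; rewrite normr0.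
Qed.

Lemma abs_boundedN a K : abs_bounded a K -> abs_bounded (\- a) K.
Proof. by move=> aK s us; under eq_bigr do rewrite normrN; exact: aK. Qed.

(** Converts the positive and negative parts of the definition into convergence along finite sets,
    the form in which infinite sums are handled from here on. *)
Lemma has_rsum a K : abs_bounded a K ->
  forall e : R, 0 < e -> exists2 s0, uniq s0 & forall s, uniq s -> {subset s0 <= s} ->
    `|\sum_(t <- s) a t - rsum a| < e.
Proof.
move=> aK e e0; have e20 : 0 < e / 2 by lra.
have p0 t : 0 <= Num.max (a t) 0 by rewrite le_max lexx orbT.
have n0 t : 0 <= Num.max (- a t) 0 by rewrite le_max lexx orbT.
have [s1 u1 h1] := has_sum_ge0 p0 (abs_bounded_pos aK) e20.
have [s2 u2 h2] := has_sum_ge0 n0 (abs_bounded_pos (abs_boundedN aK)) e20.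
exists (undup (s1 ++ s2)); first exact: undup_uniq.
move=> s us ss.
have {}h1 := h1 s us (fun t h => ss t ltac:(by rewrite mem_undup mem_cat h)).
have {}h2 := h2 s us (fun t h => ss t ltac:(by rewrite mem_undup mem_cat h orbT)).
have -> : \sum_(t <- s) a t =
    \sum_(t <- s) Num.max (a t) 0 - \sum_(t <- s) Num.max (- a t) 0.
  rewrite -sumrB; apply: eq_bigr => t _.
  by case: (ltP (a t) 0); case: (ltP (- a t) 0); lra.
rewrite /rsum; move: h1 h2; rewrite !ltr_norml; lra.
Qed.

End unordered_sums.

(** * Real and imaginary parts, conjugation and modulus *)

Section complex_modulus.
Context {R : realType}.
Implicit Types (z w : R[i]).

Lemma ReD z w : complex.Re (z + w) = complex.Re z + complex.Re w.
Proof. by case: z; case: w. Qed.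

Lemma ImD z w : complex.Im (z + w) = complex.Im z + complex.Im w.
Proof. by case: z; case: w. Qed.

Lemma ReN z : complex.Re (- z) = - complex.Re z. Proof. by case: z. Qed.

Lemma ImN z : complex.Im (- z) = - complex.Im z. Proof. by case: z. Qed.

Lemma ReM z w : complex.Re (z * w) = complex.Re z * complex.Re w - complex.Im z * complex.Im w.
Proof. by case: z; case: w. Qed.

Lemma ImM z w : complex.Im (z * w) = complex.Re z * complex.Im w + complex.Im z * complex.Re w.
Proof. by case: z => a b; case: w => c d /=; rewrite [b * c]mulrC. Qed.

Lemma Re_sum (I : Type) (s : seq I) (P : pred I) (F : I -> R[i]) :
  complex.Re (\sum_(i <- s | P i) F i) = \sum_(i <- s | P i) complex.Re (F i).
Proof. by apply: (big_morph _ ReD). Qed.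

Lemma Im_sum (I : Type) (s : seq I) (P : pred I) (F : I -> R[i]) :
  complex.Im (\sum_(i <- s | P i) F i) = \sum_(i <- s | P i) complex.Im (F i).
Proof. by apply: (big_morph _ ImD). Qed.

Lemma nc_sqr z : nc z ^+ 2 = cmod2 z.
Proof. by case: z => a b; rewrite /= sqr_sqrtr// addr_ge0// sqr_ge0. Qed.

Lemma nc_ge0 z : 0 <= nc z. Proof. by case: z => a b; exact: sqrtr_ge0. Qed.

Lemma Re_le_nc z : `|complex.Re z| <= nc z.
Proof. by case: z => a b /=; rewrite -sqrtr_sqr ler_sqrt ?lerDl ?sqr_ge0 ?addr_ge0 ?sqr_ge0. Qed.

Lemma Im_le_nc z : `|complex.Im z| <= nc z.
Proof. by case: z => a b /=; rewrite -sqrtr_sqr ler_sqrt ?lerDr ?sqr_ge0 ?addr_ge0 ?sqr_ge0. Qed.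

Lemma ncD z w : nc (z + w) <= nc z + nc w. Proof. exact: le_normcD. Qed.

Lemma ncN z : nc (- z) = nc z. Proof. exact: normcN. Qed.

Lemma ncM z w : nc (z * w) = nc z * nc w. Proof. exact: Normc.normcM. Qed.

Lemma nc0 : nc (0 : R[i]) = 0. Proof. exact: Normc.normc0. Qed.

Lemma nc_real (x : R) : nc x%:C = `|x|.
Proof. by rewrite /= expr0n/= addr0 sqrtr_sqr. Qed.

Lemma nc_i : nc ('i : R[i]) = 1.
Proof. by rewrite /= expr0n/= add0r expr1n sqrtr1. Qed.

Lemma nc_conj z : nc (conjc z) = nc z.
Proof. by case: z => a b /=; rewrite sqrrN. Qed.

Lemma nc_expi (x : R) : nc (expi x) = 1.
Proof. by rewrite /= cos2Dsin2 sqrtr1. Qed.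

Lemma nc_le z : nc z <= `|complex.Re z| + `|complex.Im z|.
Proof.
case: z => a b; rewrite [X in nc X](_ : _ = a%:C + 'i * b%:C); last first.
  by rewrite /real_complex_def; simpc.
by apply: le_trans (ncD _ _) _; rewrite ncM nc_i !nc_real mul1r.
Qed.

Lemma nc_sum (I : Type) (s : seq I) (P : pred I) (F : I -> R[i]) :
  nc (\sum_(i <- s | P i) F i) <= \sum_(i <- s | P i) nc (F i).
Proof.
elim/big_rec2: _ => [|i y x _ h]; first by rewrite nc0.
by apply: le_trans (ncD _ _) _; rewrite lerD2l.
Qed.

Lemma nc_eq0 z : nc z <= 0 -> z = 0.
Proof. by move=> h; apply: Normc.eq0_normc; apply/eqP; rewrite eq_le h nc_ge0. Qed.

Lemma conjD z w : conjc (z + w) = conjc z + conjc w.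
Proof. by case: z => a b; case: w => c d; rewrite /conjc /= opprD. Qed.

Lemma conjN z : conjc (- z) = - conjc z.
Proof. by case: z => a b; rewrite /conjc. Qed.

Lemma conjM z w : conjc (z * w) = conjc z * conjc w.
Proof. exact: rmorphM. Qed.

Lemma conj_sum (I : Type) (s : seq I) (P : pred I) (F : I -> R[i]) :
  conjc (\sum_(i <- s | P i) F i) = \sum_(i <- s | P i) conjc (F i).
Proof. exact: raddf_sum. Qed.

End complex_modulus.

(** * Absolutely convergent complex sums *)

Section complex_sums.
Context {R : realType} {T : choiceType}.
Implicit Types (c : T -> R[i]) (s : seq T) (K : R) (z : R[i]).

Definition nc_bounded c K := forall s, uniq s -> \sum_(t <- s) nc (c t) <= K.

Lemma has_csum c K : nc_bounded c K ->
  forall e : R, 0 < e -> exists2 s0, uniq s0 & forall s, uniq s -> {subset s0 <= s} ->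
    nc (\sum_(t <- s) c t - csum c) < e.
Proof.
move=> cK e e0; have e20 : 0 < e / 2 by lra.
have rK : abs_bounded (fun t => complex.Re (c t)) K.
  by move=> s us; apply: le_trans (cK s us); apply: ler_sum => t _; exact: Re_le_nc.
have iK : abs_bounded (fun t => complex.Im (c t)) K.
  by move=> s us; apply: le_trans (cK s us); apply: ler_sum => t _; exact: Im_le_nc.
have [s1 u1 h1] := has_rsum rK e20; have [s2 u2 h2] := has_rsum iK e20.
exists (undup (s1 ++ s2)); first exact: undup_uniq.
move=> s us ss.
have {}h1 := h1 s us (fun t h => ss t ltac:(by rewrite mem_undup mem_cat h)).
have {}h2 := h2 s us (fun t h => ss t ltac:(by rewrite mem_undup mem_cat h orbT)).
apply: le_lt_trans (nc_le _) _.
by rewrite ReD ImD ReN ImN Re_sum Im_sum /=; lra.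
Qed.

(** Two limits along finite sets agree, by comparison on the union of two lists. Linearity,
    conjugation and reindexing of [csum] all follow by exhibiting the limit. *)
Lemma csum_unique c K z : nc_bounded c K ->
  (forall e : R, 0 < e -> exists2 s0, uniq s0 & forall s, uniq s -> {subset s0 <= s} ->
    nc (\sum_(t <- s) c t - z) <= e) -> csum c = z.
Proof.
move=> cK h; apply/eqP; rewrite -subr_eq0; apply/eqP/nc_eq0/ler_addgt0Pl => e e0.
rewrite addr0; have e20 : 0 < e / 2 by lra.
have [s1 u1 h1] := has_csum cK e20; have [s2 u2 h2] := h _ e20.
set s := undup (s1 ++ s2).
have us : uniq s by exact: undup_uniq.
have {}h1 := h1 s us (fun t h => ltac:(by rewrite mem_undup mem_cat h)).
have {}h2 := h2 s us (fun t h => ltac:(by rewrite mem_undup mem_cat h orbT)).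
have -> : csum c - z = - (\sum_(t <- s) c t - csum c) + (\sum_(t <- s) c t - z) by ring.
by apply: le_trans (ncD _ _) _; rewrite ncN; lra.
Qed.

Lemma nc_csum_le c K : nc_bounded c K -> nc (csum c) <= K.
Proof.
move=> cK; apply/ler_addgt0Pl => e e0; have [s us h] := has_csum cK e0.
have {}h := h s us (fun t => id).
rewrite -[csum c](subrK (\sum_(t <- s) c t)); apply: le_trans (ncD _ _) _.
have := le_trans (nc_sum s xpredT c) (cK s us).
by rewrite -ncN opprB in h; lra.
Qed.

Lemma nc_boundedD c c' K K' : nc_bounded c K -> nc_bounded c' K' ->
  nc_bounded (c \+ c') (K + K').
Proof.
move=> cK cK' s us; apply: le_trans (lerD (cK s us) (cK' s us)).
by rewrite -big_split; apply: ler_sum => t _; exact: ncD.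
Qed.

Lemma csumD c c' K K' : nc_bounded c K -> nc_bounded c' K' ->
  csum (c \+ c') = csum c + csum c'.
Proof.
move=> cK cK'; apply: (csum_unique (nc_boundedD cK cK')) => e e0.
have e20 : 0 < e / 2 by lra.
have [s1 u1 h1] := has_csum cK e20; have [s2 u2 h2] := has_csum cK' e20.
exists (undup (s1 ++ s2)); first exact: undup_uniq.
move=> s us ss.
have {}h1 := h1 s us (fun t h => ss t ltac:(by rewrite mem_undup mem_cat h)).
have {}h2 := h2 s us (fun t h => ss t ltac:(by rewrite mem_undup mem_cat h orbT)).
rewrite big_split /= opprD addrACA; apply: le_trans (ncD _ _) _; lra.
Qed.

Lemma nc_boundedM z c K : nc_bounded c K -> nc_bounded (fun t => z * c t) (nc z * K).
Proof.
move=> cK s us; under eq_bigr do rewrite ncM.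
by rewrite -mulr_sumr ler_wpM2l ?nc_ge0 ?cK.
Qed.

Lemma csumM z c K : nc_bounded c K -> csum (fun t => z * c t) = z * csum c.
Proof.
move=> cK; apply: (csum_unique (nc_boundedM z cK)) => e e0.
have z1 : 0 < nc z + 1 by rewrite ltr_wpDl ?nc_ge0.
have [s0 u0 h] := has_csum cK (divr_gt0 e0 z1); exists s0 => // s us ss.
have {h} := h s us ss.
rewrite -mulr_sumr -mulrBr ncM ltr_pdivlMr// => h; apply: ltW; apply: le_lt_trans h.
by rewrite mulrC ler_wpM2l ?nc_ge0// lerDl.
Qed.

Lemma csum_conj c K : nc_bounded c K -> csum (fun t => conjc (c t)) = conjc (csum c).
Proof.
move=> cK; apply: (@csum_unique _ K); first by move=> s us; under eq_bigr do rewrite nc_conj; exact: cK.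
move=> e e0; have [s0 u0 h] := has_csum cK e0; exists s0 => // s us ss.
apply/ltW; apply: le_lt_trans (h s us ss).
by rewrite -conj_sum -conjN -conjD nc_conj.
Qed.

Lemma csum_finite c s0 : uniq s0 -> (forall t, t \notin s0 -> c t = 0) ->
  csum c = \sum_(t <- s0) c t.
Proof.
move=> u0 c0.
have sumE s : uniq s -> {subset s0 <= s} -> \sum_(t <- s) c t = \sum_(t <- s0) c t.
  move=> us ss; rewrite (perm_big _ (perm_filter_mem u0 us ss)) big_filter.
  by rewrite (bigID (mem s0))/= [X in _ + X]big1 ?addr0// => t /c0.
apply: (@csum_unique _ (\sum_(t <- s0) nc (c t))).
  move=> s us; rewrite (bigID (mem s0))/= [X in _ + X]big1 ?addr0; last first.
    by move=> t /c0 ->; rewrite nc0.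
  rewrite -big_filter; apply: ler_sum_subset => //.
  - by move=> t; exact: nc_ge0.
  - exact: filter_uniq.
  - by move=> t; rewrite mem_filter => /andP[].
by move=> e /ltW e0; exists s0 => // s us ss; rewrite sumE// subrr nc0.
Qed.

Lemma csum_reindex c K (f g : T -> T) : cancel f g -> cancel g f -> nc_bounded c K ->
  csum (c \o f) = csum c.
Proof.
move=> fg gf cK; apply: (@csum_unique _ K).
  move=> s us; rewrite -(big_map f xpredT (fun t => nc (c t))); apply: cK.
  by rewrite map_inj_uniq//; exact: can_inj fg.
move=> e e0; have [s0 u0 h] := has_csum cK e0.
exists (map g s0); first by rewrite map_inj_uniq//; exact: can_inj gf.
move=> s us ss; rewrite -(big_map f xpredT c); apply/ltW/h.
  by rewrite map_inj_uniq//; exact: can_inj fg.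
move=> t ts; rewrite -[t]gf; apply: map_f; apply: ss; exact: map_f.
Qed.

End complex_sums.

(** * Powers and the lattice *)

Section powers.
Context {R : realType}.
Implicit Types (x y a r : R).

Lemma powR_antitone x y r : r <= 0 -> 0 < x -> x <= y -> y `^ r <= x `^ r.
Proof.
move=> r0 x0 xy.
have e z : z `^ r = (z `^ (- r))^-1 by rewrite -powRN opprK.
rewrite !e lef_pV2 ?posrE ?powR_gt0 ?(lt_le_trans x0 xy)//.
by apply: ge0_ler_powR; rewrite ?oppr_ge0// nnegrE ltW// (lt_le_trans x0 xy).
Qed.

(** Takes the place of integrals of powers in all comparisons between sums and primitives. *)
Lemma powR_MVT x y a : 0 < x -> x <= y ->
  exists2 c, x <= c <= y & y `^ a - x `^ a = a * c `^ (a - 1) * (y - x).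
Proof.
move=> x0 xy.
have [//|||c cxy ->] := @MVT_segment R (fun z : R => z `^ a) (fun c => a * c `^ (a - 1)) x y.
- by move=> z; rewrite in_itv/= => /andP[xz _]; apply: is_derive1_powR; exact: lt_trans xz.
- apply: derivable_within_continuous => z; rewrite in_itv/= => /andP[xz _].
  by apply: derivable_powR; rewrite in_itv/= andbT (lt_le_trans x0 xz).
by exists c => //; rewrite in_itv in cxy.
Qed.

Lemma powRXn x a n : 0 <= x -> (x `^ a) ^+ n = x `^ (a * n%:R).
Proof. by move=> x0; rewrite -powR_mulrn ?powR_ge0// powRrM. Qed.

Lemma sum_powR_bounded (p : R) : 1 < p ->
  exists K : R, forall N, \sum_(n < N) (1 + n%:R : R) `^ (- p) <= K.
Proof.
move=> p1; exists (1 + (p - 1)^-1) => N.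
have q0 : 0 < p - 1 by lra.
(* The bound keeps the missing tail of the integral, so that the induction closes: each new term is
   at most the corresponding increment of the primitive. *)
suff h : \sum_(n < N.+1) (1 + n%:R) `^ (- p) <= 1 + (p - 1)^-1 * (1 - (1 + N%:R) `^ (1 - p)).
  apply: (@le_trans _ _ (\sum_(n < N.+1) (1 + n%:R) `^ (- p))).
    by rewrite big_ord_recr/= lerDl powR_ge0.
  apply: le_trans h _; rewrite lerD2l ger_pMr ?invr_gt0// gerBl powR_ge0//.
elim: N => [|N IH]; first by rewrite big_ord1 addr0 !powR1 subrr mulr0 addr0.
rewrite big_ord_recr/=; apply: le_trans (lerD IH (lexx _)) _.
have n0 : 0 < 1 + N%:R :> R by rewrite ltr_pwDl.
have [c /andP[c1 c2] e] := @powR_MVT (1 + N%:R) (1 + N.+1%:R) (1 - p) n0 ltac:(by rewrite lerD2l ler_nat).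
have d1 : 1 + N.+1%:R - (1 + N%:R) = 1 :> R by rewrite -natr1; ring.
rewrite d1 mulr1 in e.
have e2 : 1 - p - 1 = - p by ring.
rewrite e2 in e.
have h : (1 + N.+1%:R) `^ (- p) <= c `^ (- p) by apply: powR_antitone => //; lra.
rewrite -addrA lerD2l -lerBrDl -mulrBr.
have -> : 1 - (1 + N.+1%:R) `^ (1 - p) - (1 - (1 + N%:R) `^ (1 - p)) = (p - 1) * c `^ (- p) by lra.
by rewrite mulrA mulVf ?mul1r// gt_eqF.
Qed.

End powers.

Section lattice.
Context {R : realType}.
Implicit Types (j k : Z2).

Local Notation kn := (@knorm R).

Lemma knE k : kn k = nc ((k.1%:~R : R) +i* k.2%:~R). Proof. by []. Qed.

Lemma kn_ge0 k : 0 <= kn k. Proof. exact: sqrtr_ge0. Qed.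

Lemma kn_sqr k : kn k ^+ 2 = k.1%:~R ^+ 2 + k.2%:~R ^+ 2.
Proof. by rewrite sqr_sqrtr// addr_ge0// sqr_ge0. Qed.

Definition nsq k : nat := (`|k.1| ^ 2 + `|k.2| ^ 2)%N.

Lemma kn_nsq k : kn k ^+ 2 = (nsq k)%:R.
Proof.
have h (x : int) : (x%:~R : R) ^+ 2 = (`|x| ^ 2)%N%:R.
  by case: x => n; rewrite ?NegzE ?rmorphN ?sqrrN natrX.
by rewrite kn_sqr natrD !h.
Qed.

Lemma kn_sqrt k : kn k = Num.sqrt (nsq k)%:R.
Proof. by rewrite -kn_nsq sqrtr_sqr ger0_norm// kn_ge0. Qed.

Lemma knN k : kn (- k) = kn k.
Proof. by rewrite /knorm /= !rmorphN/= !sqrrN. Qed.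

Lemma knD j k : kn (j + k) <= kn j + kn k.
Proof.
rewrite !knE; apply: le_trans (ncD _ _).
by rewrite /= !rmorphD.
Qed.

Lemma knB j k : kn (j - k) <= kn j + kn k.
Proof. by rewrite -[kn k]knN; exact: knD. Qed.

Lemma kn_dist j k : kn j - kn k <= kn (j - k).
Proof. by rewrite lerBlDr -{1}[j](subrK k) knD. Qed.

Lemma kn0 : kn 0 = 0. Proof. by rewrite /knorm/= !expr0n/= addr0 sqrtr0. Qed.

Lemma nsq_gt0 k : k != 0 -> (0 < nsq k)%N.
Proof.
rewrite /nsq addn_gt0 !expn_gt0 /= !orbF !absz_gt0; case: k => x y.
by move=> k0; apply: contraR k0; rewrite negb_or !negbK /= => /andP[/eqP -> /eqP ->].
Qed.

Lemma kn_ge1 k : k != 0 -> 1 <= kn k.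
Proof. by move=> /nsq_gt0 h; rewrite kn_sqrt -[leLHS]sqrtr1 ler_sqrt ?ler0n// ler1n. Qed.

Lemma kn_gt0 k : k != 0 -> 0 < kn k.
Proof. by move=> /kn_ge1; exact: lt_le_trans. Qed.

Lemma kn_powRS k (r : R) : k != 0 -> kn k `^ (r + 1) = kn k * kn k `^ r.
Proof.
move=> k0; have kp : 0 < kn k := kn_gt0 k0; rewrite powRD; last by apply/implyP => _; rewrite gt_eqF.
by rewrite powRr1 ?kn_ge0// mulrC.
Qed.

Lemma kn_powRP k (r : R) : k != 0 -> kn k `^ r = kn k * kn k `^ (r - 1).
Proof. by move=> k0; rewrite -kn_powRS// subrK. Qed.

Definition cross k j : R := k.1%:~R * j.2%:~R - k.2%:~R * j.1%:~R.

(** Lagrange's identity: |k|^2 |j|^2 - (k x j)^2 is the square of the dot product. *)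
Lemma cross_le k j : `|cross k j| <= kn k * kn j.
Proof.
rewrite -(@ler_pXn2r _ 2)// ?nnegrE ?mulr_ge0 ?kn_ge0// exprMn !kn_sqr real_normK ?num_real//.
rewrite /cross; set a := _%:~R; set b := _%:~R; set c := _%:~R; set d := _%:~R.
by rewrite -subr_ge0 (_ : _ - _ = (a * d + c * b) ^+ 2) ?sqr_ge0//; ring.
Qed.

Definition zrange (N : nat) : seq int := map Posz (iota 0 N.+1) ++ map Negz (iota 0 N).

Lemma zrangeP N x : (x \in zrange N) = (`|x| <= N)%N.
Proof.
rewrite mem_cat; case: x => n.
  rewrite mem_map ?mem_iota; last by move=> ? ? [].
  rewrite /= add0n ltnS; apply/orP/idP => [[//|]|]; last by left.
  by case/mapP.
rewrite orbC mem_map ?mem_iota; last by move=> ? ? [].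
rewrite /= add0n; apply/orP/idP => [[//|]|]; last by left.
by case/mapP.
Qed.

Lemma zrange_uniq N : uniq (zrange N).
Proof.
rewrite cat_uniq !map_inj_uniq ?iota_uniq/=; [|by move=> ? ? []..].
by rewrite andbT; apply/hasPn => x /mapP[n _ ->]; apply/negP => /mapP[].
Qed.

Definition box (N : nat) : seq Z2 := [seq (x, y) | x <- zrange N, y <- zrange N].

Lemma boxP N k : (k \in box N) = (`|k.1| <= N)%N && (`|k.2| <= N)%N.
Proof.
case: k => x y; apply/allpairsP/idP => [[[a b] /= [ha hb [-> ->]]]|/andP[ha hb]].
  by rewrite -!zrangeP ha.
by exists (x, y); rewrite !zrangeP.
Qed.

Lemma box_uniq N : uniq (box N).
Proof. by apply: allpairs_uniq; rewrite ?zrange_uniq// => -[a b] [c d] _ _ [-> ->]. Qed.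

Lemma size_box N : size (box N) = ((2 * N).+1 * (2 * N).+1)%N.
Proof. by rewrite size_allpairs size_cat !size_map !size_iota; congr (_ * _)%N; lia. Qed.

Lemma sub_box (s : seq Z2) : exists N, {subset s <= box N}.
Proof.
exists (\max_(k <- s) maxn `|k.1| `|k.2|)%N => k ks.
rewrite boxP -geq_max; exact: (@leq_bigmax_seq _ s xpredT (fun k => maxn `|k.1| `|k.2|)).
Qed.

(** For a nonzero lattice point (x, y), (1 + |x|)(1 + |y|) <= (9/2) |j|^2. Hence |j|^beta is at most
    a constant times a product of one-dimensional weights with exponent beta / 2 < -1, and the
    double sum factors. *)
Lemma kn_power_bounded (beta : R) : beta < -2 ->
  exists2 K : R, 0 < K & abs_bounded (fun j : Z2 => if j == 0 then 0 else kn j `^ beta) K.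
Proof.
move=> hb; have p1 : 1 < - (beta / 2) by lra.
have [S hS] := sum_powR_bounded p1.
pose w (x : int) : R := (1 + `|x|%N%:R) `^ (beta / 2).
have w0 x : 0 <= w x by exact: powR_ge0.
have sumw N : \sum_(x <- zrange N) w x <= 2 * S.
  have iotaE (f : nat -> R) M : \sum_(n <- iota 0 M) f n = \sum_(n < M) f n.
    by rewrite -(big_mkord xpredT) /index_iota subn0.
  rewrite big_cat !big_map !iotaE mulr2n mulrDl mul1r; apply: lerD.
    by have := hS N.+1; rewrite opprK.
  apply: le_trans (hS N); rewrite opprK.
  apply: ler_sum => n _; apply: powR_antitone; rewrite ?ltr_pwDl//; first by lra.
  by rewrite lerD2l ler_nat.
pose C : R := (9 / 2 : R) `^ (- (beta / 2)).
have C0 : 0 <= C by exact: powR_ge0.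
have bound j : `|if j == 0 then 0 else kn j `^ beta| <= C * (w j.1 * w j.2).
  case: eqP => [_|/eqP j0]; first by rewrite normr0 !mulr_ge0// powR_ge0.
  rewrite ger0_norm ?powR_ge0// /w -powRM ?addr_ge0//.
  set x : R := `|j.1|%N%:R; set y : R := `|j.2|%N%:R.
  have x0 : 0 <= x by []. have y0 : 0 <= y by [].
  have e : kn j ^+ 2 = x ^+ 2 + y ^+ 2 by rewrite kn_nsq natrD !natrX.
  have k1 := kn_ge1 j0.
  have h : (1 + x) * (1 + y) <= 9 / 2 * kn j ^+ 2.
    have : 1 <= x ^+ 2 + y ^+ 2 by rewrite -e expr_ge1// (le_trans _ k1).
    rewrite e; have := sqr_ge0 (x - 1); have := sqr_ge0 (y - 1); have := sqr_ge0 (x - y); nra.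
  have -> : kn j `^ beta = (kn j ^+ 2) `^ (beta / 2).
    by rewrite -powR_mulrn ?kn_ge0// -powRrM; congr (_ `^ _); field.
  rewrite /C powRN ler_pdivlMl ?powR_gt0// -powRM ?sqr_ge0//.
  apply: powR_antitone h; first by lra.
  by apply: mulr_gt0; lra.
exists (C * (2 * S * (2 * S)) + 1).
  rewrite ltr_wpDl// !mulr_ge0//; apply: le_trans (hS 0); rewrite big_ord0//.
move=> s us; have [N sN] := sub_box s.
apply: (@le_trans _ _ (\sum_(j <- s) C * (w j.1 * w j.2))); first by apply: ler_sum.
apply: (@le_trans _ _ (\sum_(j <- box N) C * (w j.1 * w j.2))).
  by apply: ler_sum_subset; rewrite ?box_uniq// => j; rewrite !mulr_ge0.
rewrite -mulr_sumr big_allpairs/= ler_wpDr// ler_wpM2l//.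
under eq_bigr do rewrite -mulr_sumr.
by rewrite -mulr_suml ler_pM// sumr_ge0.
Qed.

End lattice.

(** * Advection of decaying fields *)

Section decaying_fields.
Context {R : realType}.
Implicit Types (j k : Z2) (A r : R) (f g psi : field R).

Local Notation kn := (@knorm R).

(** The space in which the iteration is run, with r = beta - 1. A pointwise rate, unlike a Sobolev
    norm, gives the energy of a single band directly. *)
Definition decays r A f := f 0 = 0 /\ forall j, j != 0 -> nc (f j) <= A * kn j `^ r.

Definition wt (beta : R) j : R := if j == 0 then 0 else kn j `^ beta.

Lemma wt_ge0 beta j : 0 <= wt beta j.
Proof. by rewrite /wt; case: ifP => // _; exact: powR_ge0. Qed.

Lemma nc_bounded_le (c : Z2 -> R[i]) (w : Z2 -> R) C K : 0 <= C ->
  (forall t, nc (c t) <= C * w t) -> abs_bounded w K -> nc_bounded c (C * K).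
Proof.
move=> C0 cw wK s us; apply: (@le_trans _ _ (\sum_(t <- s) C * `|w t|)).
  by apply: ler_sum => t _; apply: le_trans (cw t) _; rewrite ler_wpM2l// ler_norm.
by rewrite -mulr_sumr ler_wpM2l// wK.
Qed.

Lemma abs_bounded_shift (w : Z2 -> R) K k : abs_bounded w K ->
  abs_bounded (fun j => w (k - j)) K.
Proof.
move=> wK s us; rewrite -(big_map (fun j => k - j) xpredT (fun j => `|w j|)); apply: wK.
by rewrite map_inj_uniq// => x y /(congr1 (fun z => k - z)); rewrite !subKr.
Qed.

Lemma abs_boundedD (w w' : Z2 -> R) K K' : abs_bounded w K -> abs_bounded w' K' ->
  abs_bounded (w \+ w') (K + K').
Proof.
move=> h h' s us; apply: le_trans (lerD (h s us) (h' s us)).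
by rewrite -big_split; apply: ler_sum => t _; exact: ler_normD.
Qed.

Lemma decays_coord1 r A f j : 0 <= A -> decays r A f ->
  `|j.1%:~R| * nc (f j) <= A * wt (r + 1) j.
Proof.
move=> A0 [f0 fA]; rewrite /wt; case: eqP => [->|/eqP j0].
  by rewrite f0 nc0 !mulr0.
have h1 : `|j.1%:~R : R| <= kn j by rewrite knE; exact: (@Re_le_nc R (_ +i* _)).
rewrite kn_powRS// mulrCA; apply: ler_pM => //; first exact: nc_ge0.
exact: fA.
Qed.

Lemma decays_coord2 r A f j : 0 <= A -> decays r A f ->
  `|j.2%:~R| * nc (f j) <= A * wt (r + 1) j.
Proof.
move=> A0 [f0 fA]; rewrite /wt; case: eqP => [->|/eqP j0].
  by rewrite f0 nc0 !mulr0.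
have h1 : `|j.2%:~R : R| <= kn j by rewrite knE; exact: (@Im_le_nc R (_ +i* _)).
rewrite kn_powRS// mulrCA; apply: ler_pM => //; first exact: nc_ge0.
exact: fA.
Qed.

Lemma wt_le1 r j : r <= 0 -> wt r j <= 1.
Proof.
move=> r0; rewrite /wt; case: eqP => // /eqP j0.
have e1 : (1 : R) `^ r = 1 by rewrite powR1.
by rewrite -e1; apply: powR_antitone => //; exact: kn_ge1.
Qed.

(* The symbol of [perp_grad psi . grad f] is [(k - j) x j], which equals [k x j]. *)
Definition adv_term psi f k j : R[i] := (- cross k j)%:C * psi (k - j) * f j.

Section advection.
Variables (beta K U : R).
Hypotheses (beta_lt : beta < -2) (K0 : 0 < K) (U0 : 0 <= U) (wK : abs_bounded (wt beta) K).

(** Both convolutions converge absolutely, because the coefficients of the velocity are bounded by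
    [U] and those of the gradient of f are summable with weight |j|^beta; they can therefore be
    merged into one sum. *)
Lemma advectE psi A f k : 0 <= A -> decays beta U psi -> decays (beta - 1) A f ->
  advect (perp_grad psi) f k = csum (adv_term psi f k).
Proof.
move=> A0 dpsi df; have UA0 : 0 <= U * A by exact: mulr_ge0.
have b2 := beta_lt.
rewrite /advect /= /fmul.
have bnd x y : x <= U * wt (beta + 1) y -> x <= U.
  by move=> h; apply: le_trans h _; rewrite ler_piMr// wt_le1//; lra.
have i1 j : nc ('i : R[i]) = 1 by exact: nc_i.
rewrite -(@csumD _ _ _ _ (U * A * K) (U * A * K)).
- congr csum; apply/funext => j; rewrite /adv_term /dx /dy /cross /=.
  rewrite !rmorphB/=.
  case: (psi (k - j)) => a b; case: (f j) => c d.
  by apply/eqP; rewrite eq_complex /=; apply/andP; split; apply/eqP; ring.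
- apply: (nc_bounded_le UA0 _ wK) => j; rewrite /= ncM ncN /dx /dy !ncM !nc_i !nc_real !mul1r.
  rewrite -[leRHS]mulrA; apply: ler_pM; rewrite ?mulr_ge0 ?nc_ge0//.
    exact: bnd (decays_coord2 _ U0 dpsi).
  by apply: le_trans (decays_coord1 _ A0 df) _; rewrite subrK.
- apply: (nc_bounded_le UA0 _ wK) => j; rewrite /= ncM /dx /dy !ncM !nc_i !nc_real !mul1r.
  rewrite -[leRHS]mulrA; apply: ler_pM; rewrite ?mulr_ge0 ?nc_ge0//.
    exact: bnd (decays_coord1 _ U0 dpsi).
  by apply: le_trans (decays_coord2 _ A0 df) _; rewrite subrK.
Qed.

(* Either [j] or [k - j] has length at least [|k| / 2]. *)
Lemma wtM_le k j : k != 0 ->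
  wt beta (k - j) * wt beta j <= 2 `^ (- beta) * kn k `^ beta * (wt beta j + wt beta (k - j)).
Proof.
move=> k0; have kp := kn_gt0 (R:=R) k0; have b2 := beta_lt.
have half x y : kn k / 2 <= kn x -> 0 <= y -> wt beta x * y <= 2 `^ (- beta) * kn k `^ beta * y.
  move=> h y0; rewrite ler_wpM2r// /wt; case: eqP => _.
    by rewrite mulr_ge0 ?powR_ge0.
  apply: le_trans (powR_antitone _ _ h) _; [lra|by rewrite divr_gt0|].
  by rewrite powRM ?invr_ge0 ?kn_ge0// mulrC -powR_inv1// -powRrM mulN1r.
have C0 : 0 <= 2 `^ (- beta) * kn k `^ beta by rewrite mulr_ge0 ?powR_ge0.
rewrite mulrDr; case: (leP (kn k / 2) (kn j)) => h.
  rewrite mulrC; apply: le_trans (half _ _ h (wt_ge0 _ _)) _.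
  by rewrite lerDr mulr_ge0 ?wt_ge0.
apply: le_trans (half (k - j) _ _ (wt_ge0 _ _)) _; last by rewrite lerDl mulr_ge0 ?wt_ge0.
by have := @kn_dist R k j; lra.
Qed.

(** [advC * U] is the contraction factor of the iteration. There is one [K] for each of the two
    factors of the convolution that may carry the large wavenumber. *)
Definition advC : R := 2 `^ (- beta) * (K + K).

Lemma advC_gt0 : 0 < advC. Proof. by rewrite mulr_gt0 ?powR_gt0 ?addr_gt0. Qed.

Lemma advC_ge0 : 0 <= advC. Proof. exact: ltW advC_gt0. Qed.

(** In the bound |k x j| <= |k| |j|, the factor |j| raises |j|^(beta-1) to the summable |j|^beta,
    while |k| leaves the sum; [wtM_le] then extracts |k|^beta. *)
Lemma adv_term_bounded psi A f k : 0 <= A -> decays beta U psi -> decays (beta - 1) A f ->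
  nc_bounded (adv_term psi f k) (U * A * advC * (kn k * wt beta k)).
Proof.
move=> A0 [p0 dp] [f0 df]; have UA0 : 0 <= U * A by exact: mulr_ge0.
have [->|k0] := eqVneq k 0.
  move=> s us; rewrite kn0 mul0r mulr0 big1// => j _.
  by rewrite /adv_term /cross !mul0r subrr oppr0 !mul0r nc0.
have -> : U * A * advC * (kn k * wt beta k) =
    (U * A * (kn k * (2 `^ (- beta) * kn k `^ beta))) * (K + K).
  by rewrite /advC /wt (negbTE k0); ring.
apply: nc_bounded_le (abs_boundedD wK (abs_bounded_shift k wK)).
  by rewrite !mulr_ge0 ?powR_ge0 ?kn_ge0.
move=> j; rewrite /adv_term !ncM nc_real normrN.
have [->|j0] := eqVneq j 0.
  by rewrite f0 nc0 mulr0 mulr_ge0 ?mulr_ge0 ?addr_ge0 ?powR_ge0 ?kn_ge0 ?wt_ge0.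
have [->|kj] := eqVneq k j.
  by rewrite subrr p0 nc0 mulr0 mul0r mulr_ge0 ?mulr_ge0 ?addr_ge0 ?powR_ge0 ?kn_ge0 ?wt_ge0.
have kj0 : k - j != 0 by rewrite subr_eq0.
have e1 := @kn_powRP R j beta j0.
apply: (@le_trans _ _ ((kn k * kn j) * (U * wt beta (k - j)) * (A * kn j `^ (beta - 1)))).
  apply: ler_pM; rewrite ?mulr_ge0 ?nc_ge0//; last exact: df.
  by apply: ler_pM; rewrite ?nc_ge0 ?cross_le// /wt (negbTE kj0) dp.
have := wtM_le j k0; rewrite {2}/wt (negbTE j0) e1 => h.
rewrite (_ : _ * _ = U * A * kn k * (wt beta (k - j) * (kn j * kn j `^ (beta - 1)))); last by ring.
apply: le_trans (ler_wpM2l _ h) _; first by rewrite mulr_ge0// kn_ge0.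
by rewrite le_eqVlt; apply/orP; left; apply/eqP; rewrite /=; ring.
Qed.

Lemma advect_le psi A f k : 0 <= A -> decays beta U psi -> decays (beta - 1) A f ->
  nc (advect (perp_grad psi) f k) <= U * A * advC * (kn k * wt beta k).
Proof.
by move=> A0 dp df; rewrite (advectE _ A0)//; exact: nc_csum_le (adv_term_bounded _ A0 dp df).
Qed.

Lemma advect0 psi A f : 0 <= A -> decays beta U psi -> decays (beta - 1) A f ->
  advect (perp_grad psi) f 0 = 0.
Proof.
move=> A0 dp df; apply: nc_eq0; apply: le_trans (advect_le 0 A0 dp df) _.
by rewrite kn0 mul0r mulr0.
Qed.

Lemma decaysB r A A' f g : decays r A f -> decays r A' g -> decays r (A + A') (f \- g).
Proof.
move=> [f0 fA] [g0 gA]; split; first by rewrite /= f0 g0 subrr.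
move=> j j0; apply: le_trans (ncD _ _) _; rewrite ncN mulrDl.
by apply: lerD; [exact: fA|exact: gA].
Qed.

Lemma decaysD r A A' f g : decays r A f -> decays r A' g -> decays r (A + A') (f \+ g).
Proof.
move=> [f0 fA] [g0 gA]; split; first by rewrite /= f0 g0 addr0.
move=> j j0; apply: le_trans (ncD _ _) _; rewrite mulrDl.
by apply: lerD; [exact: fA|exact: gA].
Qed.

Lemma decays_le r A A' f : A <= A' -> decays r A f -> decays r A' f.
Proof.
move=> AA' [f0 fA]; split => // j j0; apply: le_trans (fA j j0) _.
by rewrite ler_wpM2r// powR_ge0.
Qed.

Lemma advectB psi A A' f g k : 0 <= A -> 0 <= A' -> decays beta U psi ->
  decays (beta - 1) A f -> decays (beta - 1) A' g ->
  advect (perp_grad psi) (f \- g) k = advect (perp_grad psi) f k - advect (perp_grad psi) g k.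
Proof.
move=> A0 A0' dp df dg; rewrite !(advectE _ _ dp (A := A + A')) ?addr_ge0//; last first.
- exact: decaysB.
- by apply: decays_le df; rewrite lerDl.
- by apply: decays_le dg; rewrite lerDr.
have bf := adv_term_bounded k A0 dp df; have bg := adv_term_bounded k A0' dp dg.
rewrite -mulN1r -(csumM _ bg) -(csumD bf (nc_boundedM (-1) bg)).
by congr csum; apply/funext => j; rewrite /adv_term /=; ring.
Qed.

Lemma lap_inv_decays A f : 0 <= A -> f 0 = 0 ->
  (forall k, k != 0 -> nc (f k) <= A * (kn k * wt beta k)) -> decays (beta - 1) A (lap_inv f).
Proof.
move=> A0 f0 fA; split; first by rewrite /lap_inv eqxx.
move=> j j0; rewrite /lap_inv (negbTE j0) ncM ncN nc_real ger0_norm ?invr_ge0 ?sqr_ge0//.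
have kp := kn_gt0 (R:=R) j0.
rewrite ler_pdivrMl ?exprn_gt0//; apply: le_trans (fA j j0) _.
rewrite /wt (negbTE j0) kn_powRP//.
by rewrite le_eqVlt; apply/orP; left; apply/eqP; ring.
Qed.

(** The advection has size |k|^(beta+1) and the inverse Laplacian gains |k|^(-2), which returns to
    the exponent beta - 1 with one more factor [U]. *)
Lemma lap_inv_advect_decays psi A f : 0 <= A -> decays beta U psi -> decays (beta - 1) A f ->
  decays (beta - 1) (advC * U * A) (lap_inv (advect (perp_grad psi) f)).
Proof.
move=> A0 dp df; have h : advC * U * A = U * A * advC by ring.
apply: lap_inv_decays; rewrite ?(advect0 A0 dp df)//.
  by have C0 := advC_ge0; rewrite mulr_ge0// mulr_ge0.
by move=> k _; rewrite h; exact: advect_le.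
Qed.

Lemma lap_inv_advectB psi A A' f g : 0 <= A -> 0 <= A' -> decays beta U psi ->
  decays (beta - 1) A f -> decays (beta - 1) A' g ->
  lap_inv (advect (perp_grad psi) f) \- lap_inv (advect (perp_grad psi) g) =
  lap_inv (advect (perp_grad psi) (f \- g)).
Proof.
move=> A0 A0' dp df dg; apply/funext => k; rewrite /= /lap_inv.
case: ifP => _; first by rewrite subrr.
by rewrite (advectB k A0 A0' dp df dg) mulrBr.
Qed.

End advection.

End decaying_fields.

(** * The limit of the iteration *)

Section geometric_limits.
Context {R : realType}.
Implicit Types (x : nat -> R) (c q : R).

(** The sequences x_n + 2 c q^n and x_n - 2 c q^n are monotone and enclose the limit. Monotonicity
    is c q^n <= 2 c (q^n - q^(n+1)), which is where q <= 1/2 enters. *)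
Lemma geo_cvg x c q : 0 <= c -> 0 <= q -> q <= 2^-1 ->
  (forall n, `|x n.+1 - x n| <= c * q ^+ n) ->
  cvgn x /\ forall n, `|limn x - x n| <= 2 * c * q ^+ n.
Proof.
move=> c0 q0 q2 h.
have q1 : `|q| < 1 by rewrite ger0_norm//; lra.
have g0 : (fun n => 2 * c * q ^+ n) @ \oo --> (0 : R).
  by rewrite -[0](mulr0 (2 * c)); apply: cvgM; [exact: cvg_cst|exact: cvg_expr].
have step n : c * q ^+ n <= 2 * c * q ^+ n - 2 * c * q ^+ n.+1.
  have := mulr_ge0 c0 (exprn_ge0 n q0); rewrite exprS; set y := c * _ => y0.
  have -> : 2 * c * (q * q ^+ n) = 2 * q * y by rewrite /y; ring.
  have -> : 2 * c * q ^+ n = 2 * y by rewrite /y; ring.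
  nra.
pose u n := x n + 2 * c * q ^+ n; pose v n := x n - 2 * c * q ^+ n.
have ui : nonincreasing_seq u.
  apply/nonincreasing_seqP => n; rewrite /u.
  by have := h n; have := step n; rewrite ler_norml => ? /andP[]; lra.
have vi : nondecreasing_seq v.
  apply/nondecreasing_seqP => n; rewrite /v.
  by have := h n; have := step n; rewrite ler_norml => ? /andP[]; lra.
have pos n : 0 <= 2 * c * q ^+ n by rewrite !mulr_ge0// exprn_ge0.
have uc : cvgn u.
  apply: nonincreasing_is_cvgn => //; exists (v 0) => _ [n _ <-].
  by apply: le_trans (vi _ _ (leq0n n)) _; rewrite /u /v; have := pos n; lra.
have xu : x @ \oo --> limn u.
  rewrite -[limn u]subr0 (_ : x = fun n => u n - 2 * c * q ^+ n); last first.
    by apply/funext => n; rewrite /u addrK.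
  exact: cvgB.
have vx : v @ \oo --> limn u by rewrite -[limn u]subr0; exact: cvgB.
split; first by apply/cvg_ex; exists (limn u).
move=> n; rewrite (cvg_lim _ xu)//.
have h1 : limn u <= u n by exact: nonincreasing_cvgn_ge.
have h2 : v n <= limn u.
  rewrite -(cvg_lim _ vx)//; apply: nondecreasing_cvgn_le => //.
  by apply/cvg_ex; exists (limn u).
by rewrite ler_norml; move: h1 h2; rewrite /u /v; lra.
Qed.

Lemma geo_le0 (y c q : R) : 0 <= q -> q <= 2^-1 -> (forall n, y <= c * q ^+ n) -> y <= 0.
Proof.
move=> q0 q2 h; have q1 : `|q| < 1 by rewrite ger0_norm//; lra.
have g0 : (fun n => c * q ^+ n) @ \oo --> (0 : R).
  by rewrite -[0](mulr0 c); apply: cvgM; [exact: cvg_cst|exact: cvg_expr].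
rewrite -(cvg_lim _ g0)//; apply: limr_ge; first by apply/cvg_ex; exists 0.
exact: nearW.
Qed.

Definition clim (z : nat -> R[i]) : R[i] :=
  limn (fun n => complex.Re (z n)) +i* limn (fun n => complex.Im (z n)).

Lemma geo_clim (z : nat -> R[i]) c q : 0 <= c -> 0 <= q -> q <= 2^-1 ->
  (forall n, nc (z n.+1 - z n) <= c * q ^+ n) ->
  [/\ cvgn (fun n => complex.Re (z n)), cvgn (fun n => complex.Im (z n)) &
     forall n, nc (clim z - z n) <= 4 * c * q ^+ n].
Proof.
move=> c0 q0 q2 h.
have [r1 r2] := @geo_cvg (fun n => complex.Re (z n)) _ _ c0 q0 q2 (fun n =>
  ltac:(by rewrite -ReN -ReD; exact: le_trans (Re_le_nc _) (h n))).
have [i1 i2] := @geo_cvg (fun n => complex.Im (z n)) _ _ c0 q0 q2 (fun n =>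
  ltac:(by rewrite -ImN -ImD; exact: le_trans (Im_le_nc _) (h n))).
split => // n; apply: le_trans (nc_le _) _; rewrite ReD ImD ReN ImN /=.
by apply: le_trans (lerD (r2 n) (i2 n)) _; lra.
Qed.

End geometric_limits.

Section solution.
Context {R : realType}.
Variables (beta K U A q : R) (g psi : field R).
Hypotheses (beta_lt : beta < -2) (K0 : 0 < K) (U0 : 0 <= U) (wK : abs_bounded (wt beta) K).
Hypotheses (A0 : 0 <= A) (qE : q = advC beta K * U) (q_small : q <= 2^-1) (g0 : g 0 = 0).
Hypotheses (dpsi : decays beta U psi) (dg : decays (beta - 1) A (\- lap_inv g)).

Local Notation kn := (@knorm R).
Local Notation u := (perp_grad psi).
Local Notation th := (iterate u g).

Let q0 : 0 <= q. Proof. by rewrite qE mulr_ge0 ?(advC_ge0 beta K0). Qed.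

Lemma iterateS n : th n.+1 = (\- lap_inv g) \+ lap_inv (advect u (th n)).
Proof.
apply/funext => k /=; rewrite /lap_inv; case: ifP => _; first by rewrite !(oppr0, addr0).
by rewrite /= mulrBr; ring.
Qed.

Lemma iterate_decays_ex n : exists2 B, 0 <= B & decays (beta - 1) B (th n).
Proof.
elim: n => [|n [B B0 dB]]; first by exists A.
exists (A + q * B); first by rewrite addr_ge0// mulr_ge0.
by rewrite iterateS qE; apply: decaysD => //; apply: lap_inv_advect_decays dB.
Qed.

Lemma iterate_diff_decays n : decays (beta - 1) (q ^+ n.+1 * A) (th n.+1 \- th n).
Proof.
elim: n => [|n IH].
  rewrite iterateS expr1 (_ : _ \- _ = lap_inv (advect u (th 0%N))).
    by rewrite qE; exact: lap_inv_advect_decays.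
  by apply/funext => k /=; ring.
have [B B0 dB] := iterate_decays_ex n; have [B' B0' dB'] := iterate_decays_ex n.+1.
rewrite (_ : _ \- _ = lap_inv (advect u (th n.+1 \- th n))); last first.
  rewrite -(lap_inv_advectB beta_lt U0 wK B0' B0 dpsi dB' dB).
  by rewrite [in LHS]iterateS [X in _ \- X]iterateS; apply/funext => k /=; ring.
by rewrite exprS -mulrA [X in X * _]qE; apply: lap_inv_advect_decays => //; rewrite mulr_ge0// exprn_ge0.
Qed.

Definition solution : field R := fun k => clim (th ^~ k).

Lemma iterate_geo k n : nc (th n.+1 k - th n k) <= q * A * wt (beta - 1) k * q ^+ n.
Proof.
have [d0 dk] := iterate_diff_decays n; rewrite /wt; case: eqP => [->|/eqP k0].
  by rewrite [X in nc X]d0 nc0 mulr0 mul0r.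
apply: le_trans (dk k k0) _; rewrite le_eqVlt; apply/orP; left; apply/eqP.
by rewrite exprS; ring.
Qed.

Lemma solution_geo k :
  [/\ cvgn (fun n => complex.Re (th n k)), cvgn (fun n => complex.Im (th n k)) &
     forall n, nc (solution k - th n k) <= 4 * (q * A * wt (beta - 1) k) * q ^+ n].
Proof. by apply: geo_clim => // [|n]; [rewrite !mulr_ge0 ?wt_ge0|exact: iterate_geo]. Qed.

Lemma solution_diff_decays n : decays (beta - 1) (4 * A * q ^+ n.+1) (solution \- th n).
Proof.
have h k : nc (solution k - th n k) <= 4 * A * q ^+ n.+1 * wt (beta - 1) k.
  have [_ _ /(_ n) h] := solution_geo k; apply: le_trans h _.
  by rewrite le_eqVlt; apply/orP; left; apply/eqP; rewrite exprS; ring.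
split; first by apply: nc_eq0; apply: le_trans (h 0) _; rewrite /wt eqxx mulr0.
by move=> j j0; apply: le_trans (h j) _; rewrite /wt (negbTE j0).
Qed.

Lemma solution_decays : decays (beta - 1) (4 * A * q + A) solution.
Proof.
rewrite (_ : solution = (solution \- th 0%N) \+ th 0%N); last first.
  by apply/funext => k /=; rewrite subrK.
by apply: decaysD dg; rewrite -[q]expr1; exact: solution_diff_decays.
Qed.

Lemma solution_solves : solves u g solution.
Proof.
rewrite /solves; apply/funext => k /=.
have [->|k0] := eqVneq k 0.
  have B0 : 0 <= 4 * A * q + A by rewrite addr_ge0 ?mulr_ge0.
  rewrite (advect0 beta_lt U0 wK B0 dpsi solution_decays).
  by rewrite /lap kn0 expr0n/= !oppr0 mul0r oppr0 g0 addr0.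
pose c : R[i] := (knorm k ^+ 2)%:C.
have thE n : c * th n.+1 k = g k - advect u (th n) k.
  rewrite /= /lap_inv (negbTE k0) /= !mulNr opprK mulrA -rmorphM/= divff ?mul1r//.
  by rewrite expf_eq0/= gt_eqF// kn_gt0.
(* For each n, the residual at k is |k|^2 times the distance to iterate n+1 plus the advection of
   the distance to iterate n. Both are O(q^n) with constants depending on k, so the residual is
   0. *)
apply/eqP; rewrite -subr_eq0; apply/eqP/nc_eq0.
apply: (@geo_le0 _ _ (kn k ^+ 2 * (4 * A * q ^+ 2 * kn k `^ (beta - 1))
   + U * (4 * A * q) * advC beta K * (kn k * wt beta k)) q) => // n.
have [B B0 dB] := iterate_decays_ex n.
have e : - lap solution k + advect u solution k - g k =
    c * (solution k - th n.+1 k) + advect u (solution \- th n) k.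
  have -> : advect u (solution \- th n) k = advect u solution k - advect u (th n) k.
    have B0' : 0 <= 4 * A * q + A by rewrite addr_ge0 ?mulr_ge0.
    exact: (advectB beta_lt U0 wK k B0' B0 dpsi solution_decays dB).
  by rewrite mulrBr thE /lap /c; ring.
rewrite e; apply: le_trans (ncD _ _) _; rewrite mulrDl; apply: lerD.
  rewrite ncM nc_real ger0_norm ?sqr_ge0// -mulrA ler_wpM2l ?sqr_ge0//.
  have [_ /(_ k k0) h] := solution_diff_decays n.+1; apply: le_trans h _.
  by rewrite le_eqVlt; apply/orP; left; apply/eqP; rewrite !exprS; ring.
have B0' : 0 <= 4 * A * q ^+ n.+1 by rewrite !mulr_ge0 ?exprn_ge0.
apply: le_trans (advect_le beta_lt U0 wK k B0' dpsi (solution_diff_decays n)) _.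
by rewrite le_eqVlt; apply/orP; left; apply/eqP; rewrite !exprS; ring.
Qed.

Lemma L2sq_le (w : Z2 -> R) f C : 0 <= C -> abs_bounded w K ->
  (forall j, cmod2 (f j) <= C * w j) -> (L2sq f <= (C * K)%:E)%E.
Proof.
move=> C0 wK' fw; apply: esum_bounded => [t|s us]; first by rewrite -nc_sqr sqr_ge0.
apply: (@le_trans _ _ (\sum_(t <- s) C * `|w t|)); last by rewrite -mulr_sumr ler_wpM2l// wK'.
apply: ler_sum => t _; rewrite ger0_norm -?nc_sqr ?sqr_ge0// nc_sqr.
by apply: le_trans (fw t) _; rewrite ler_wpM2l// ler_norm.
Qed.

Let wt2 r j : r <= beta -> wt r j ^+ 2 <= wt beta j.
Proof.
move=> rb; have b2 := beta_lt; apply: (@le_trans _ _ (wt r j)).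
  by rewrite expr2 ler_piMr ?wt_ge0// wt_le1//; lra.
rewrite /wt; case: eqP => // /eqP j0; apply: ler_powR => //; exact: kn_ge1.
Qed.

Lemma decays_L2sq B f : 0 <= B -> decays (beta - 1) B f -> (L2sq f <= (B ^+ 2 * K)%:E)%E.
Proof.
move=> B0 [f0 fB]; apply: (L2sq_le (sqr_ge0 _) wK) => j.
rewrite -nc_sqr; apply: (@le_trans _ _ ((B * wt (beta - 1) j) ^+ 2)).
  rewrite ler_pXn2r ?nnegrE ?nc_ge0 ?mulr_ge0 ?wt_ge0// /wt.
  by case: eqP => [->|/eqP /fB //]; rewrite f0 nc0 mulr0.
by rewrite exprMn ler_wpM2l ?sqr_ge0// wt2//; lra.
Qed.

Lemma decays_H1sq B f : 0 <= B -> decays (beta - 1) B f ->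
  (H1sq f <= (B ^+ 2 * K + B ^+ 2 * K)%:E)%E.
Proof.
move=> B0 df; rewrite /H1sq EFinD.
have e : wt (beta - 1 + 1) = wt beta :> (Z2 -> R) by rewrite subrK.
apply: leeD; apply: (L2sq_le (sqr_ge0 _) wK) => j; rewrite -nc_sqr;
  apply: (@le_trans _ _ ((B * wt beta j) ^+ 2));
  rewrite ?exprMn ?ler_wpM2l ?sqr_ge0 ?wt2//; rewrite -exprMn ler_pXn2r ?nnegrE ?nc_ge0 ?mulr_ge0 ?wt_ge0//
    /dx /dy !ncM nc_i nc_real mul1r -e.
  exact: decays_coord1.
exact: decays_coord2.
Qed.

Lemma iterate_cvg : H1sq (th n \- solution) @[n --> \oo] --> (0 : \bar R)%E.
Proof.
have q1 : `|q ^+ 2| < 1 by rewrite ger0_norm ?sqr_ge0//; have := q0; have := q_small; nra.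
pose B n := 4 * A * q ^+ n.+1.
have B0 n : 0 <= B n by rewrite !mulr_ge0 ?exprn_ge0.
have dB n : decays (beta - 1) (B n) (th n \- solution).
  have [d0 dk] := solution_diff_decays n; split => [|j j0].
    by rewrite /= -opprB; move: d0 => /= ->; rewrite oppr0.
  by rewrite -ncN opprB; exact: dk.
apply: (@squeeze_cvge _ _ _ _ (fun=> 0%E) _
  (fun n => (2 * (4 * A * q) ^+ 2 * K * (q ^+ 2) ^+ n)%:E)).
- apply: nearW => n; apply/andP; split.
    by rewrite adde_ge0// esum_ge0// => t _; rewrite lee_fin -nc_sqr sqr_ge0.
  apply: le_trans (decays_H1sq (B0 n) (dB n)) _.
  have e : q ^+ 2 ^+ n = (q ^+ n) ^+ 2 by rewrite exprAC.
  by rewrite lee_fin /B e le_eqVlt; apply/orP; left; apply/eqP; rewrite (exprS q n); ring.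
- exact: cvg_cst.
- apply: cvg_EFin; first exact: nearW.
  rewrite -[0](mulr0 (2 * (4 * A * q) ^+ 2 * K)); apply: cvgM; first exact: cvg_cst.
  exact: cvg_expr.
Qed.

Hypotheses (psi_real : real_valued psi) (g_real : real_valued g).

(** Conjugation of the sum corresponds to replacing j by -j, under which the cross product of k and
    j is unchanged when k also changes sign. *)
Lemma advect_real A' f : 0 <= A' -> decays (beta - 1) A' f -> real_valued f ->
  real_valued (advect u f).
Proof.
move=> A0' df fr k; rewrite !(advectE beta_lt U0 wK _ A0' dpsi df).
have b := adv_term_bounded beta_lt U0 wK k A0' dpsi df.
have b' := adv_term_bounded beta_lt U0 wK (- k) A0' dpsi df.
rewrite -(csum_conj b) -(csum_reindex (@opprK _) (@opprK _) b').
congr csum; apply/funext => j /=; rewrite /adv_term !conjM -(fr j) -(psi_real (k - j)).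
have -> : - k - - j = - (k - j) by rewrite opprB opprK addrC.
congr (_ * _ * _).
have -> : cross (- k) (- j) = cross k j :> R.
  by rewrite /cross /= !rmorphN/= !mulrNN.
by rewrite /real_complex_def /conjc oppr0.
Qed.

Lemma lap_inv_real (f : field R) : real_valued f -> real_valued (lap_inv f).
Proof.
move=> fr k; rewrite /lap_inv oppr_eq0; case: ifP => _.
  by rewrite /conjc /= oppr0.
rewrite conjM -fr knN; congr (_ * _).
by rewrite conjN /real_complex_def /conjc /= oppr0.
Qed.

Lemma iterate_real n : real_valued (th n).
Proof.
have l k : (\- lap_inv g) (- k) = conjc ((\- lap_inv g) k).
  by rewrite /= conjN lap_inv_real.
elim: n => [|n IH]; first exact: l.
have [B B0 dB] := iterate_decays_ex n.
rewrite iterateS => k /=; rewrite conjD; congr (_ + _); first exact: l.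
exact: lap_inv_real (advect_real B0 dB IH) k.
Qed.

Lemma solution_real : real_valued solution.
Proof.
move=> k; have [c1 c2 _] := solution_geo k.
rewrite /solution /clim /conjc; congr (_ +i* _).
  by congr (limn _); apply/funext => n; rewrite iterate_real; case: (th n k).
rewrite -limN//; congr (limn _); apply/funext => n; rewrite iterate_real.
have -> : (- (fun m => complex.Im (th m k))) n = - complex.Im (th n k) by [].
by case: (th n k).
Qed.

End solution.

(** * Fourier coefficients and the supremum norm *)

Section exponentials.
Context {R : realType}.
Implicit Types (x y : R) (n : nat) (m : int).

Lemma expiD x y : expi (x + y) = expi x * expi y.
Proof. by apply/eqP; rewrite eq_complex /= cosD sinD eqxx addrC [cos x * _]mulrC [sin x * _]mulrC; apply/eqP; ring. Qed.

Lemma expi0 : expi (0 : R) = 1.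
Proof. by rewrite /expi cos0 sin0. Qed.

Lemma expiN x : expi (- x) = conjc (expi x).
Proof. by rewrite /expi cosN sinN. Qed.

Lemma expi_mulrn x n : expi (x *+ n) = expi x ^+ n.
Proof.
by elim: n => [|n IH]; rewrite ?mulr0n ?expi0 ?expr0// mulrS expiD IH exprS.
Qed.

Lemma expi_2pi m : expi (m%:~R * (2 * pi) : R) = 1.
Proof.
have h n : expi (n%:R * (2 * pi) : R) = 1.
  rewrite mulr_natl expi_mulrn (_ : expi _ = 1) ?expr1n// /expi mulr_natl.
  by rewrite cos2pi sin2pi.
case: m => n; first exact: h.
by rewrite NegzE rmorphN/= mulNr expiN h; apply/eqP; rewrite eq_complex /= oppr0 !eqxx.
Qed.

Lemma expi_neq1 x : 0 < x -> x < 2 * pi -> expi x <> 1.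
Proof.
move=> x0 x2 [c _]; have: 0 < sin (x / 2).
  by apply: sin_gt0_pi; rewrite divr_gt0//= ltr_pdivrMr// mulrC.
have e : x = x / 2 *+ 2 by rewrite -mulr_natr divfK.
rewrite e cos_mulr2n in c; have := cos2Dsin2 (x / 2) => ss s0.
have := exprn_gt0 2 s0; move: c; rewrite -mulr_natl; lra.
Qed.

(** A geometric sum over an N-th root of unity other than 1. The half step offset places the nodes
    in the open interval (0, 2 pi), where [Linfty_ge_point] applies. *)
Lemma grid_sum N m : (0 < `|m| < N)%N ->
  \sum_(a < N) expi (m%:~R * (2 * pi * (a%:R + 2^-1) / N%:R) : R) = 0.
Proof.
move=> /andP[m0 mN]; have N0 : (0 < N)%N by exact: leq_ltn_trans mN.
have NR : 0 < N%:R :> R by rewrite ltr0n.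
pose z := expi (m%:~R * (2 * pi) / N%:R : R).
rewrite (eq_bigr (fun a : 'I_N => expi (m%:~R * (2 * pi) / N%:R * 2^-1) * z ^+ a)); last first.
  move=> a _; rewrite -expi_mulrn -expiD; congr expi.
  by rewrite -[in RHS](mulr_natr _ a); field; rewrite gt_eqF.
rewrite -mulr_sumr.
have zN : z ^+ N = 1.
  by rewrite /z -expi_mulrn -[X in expi X]mulr_natr divfK ?expi_2pi// gt_eqF.
suff z1 : z - 1 != 0.
  have := subrX1 z N; rewrite zN subrr => /esym/eqP; rewrite mulf_eq0 (negbTE z1)/= => /eqP ->.
  by rewrite mulr0.
rewrite subr_eq0; apply/eqP.
have P2 : 0 < 2 * pi :> R := two_pi_gt0.
have key n : (0 < n < N)%N -> expi (n%:R * (2 * pi) / N%:R : R) <> 1.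
  move=> /andP[n0 nN]; apply: expi_neq1; first by rewrite divr_gt0// mulr_gt0// ltr0n.
  by rewrite ltr_pdivrMr// mulrC ltr_pM2l// ltr_nat.
rewrite /z; case: m m0 mN {z zN} => n /= m0 mN; first by apply: key; rewrite m0.
rewrite NegzE rmorphN/= !mulNr expiN => /(congr1 conjc); rewrite conjcK => h.
apply: (key n.+1); first by rewrite mN.
by rewrite h; apply/eqP; rewrite eq_complex /= oppr0 !eqxx.
Qed.

End exponentials.

(** * Coefficients of a trigonometric polynomial and its essential supremum *)

Section supremum_bound.
Context {R : realType}.
Implicit Types (k j : Z2) (f : field R) (x : R * R).

Definition trig (s : seq Z2) f x : R[i] :=
  \sum_(k <- s) f k * expi (k.1%:~R * x.1 + k.2%:~R * x.2).

Lemma eval_trig (s : seq Z2) f x : uniq s -> (forall k, k \notin s -> f k = 0) -> Defs.eval f x = trig s f x.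
Proof. by move=> us f0; apply: csum_finite => // k /f0 ->; rewrite mul0r. Qed.

Local Notation cont h x := (h @ x --> h x).

Lemma continuous_phase (h : R -> R) k x : continuous h ->
  cont (fun y : R * R => h (k.1%:~R * y.1 + k.2%:~R * y.2)) x.
Proof.
move=> hc; apply: (@continuous_comp _ _ _ (fun y : R * R => k.1%:~R * y.1 + k.2%:~R * y.2) h); last exact: hc.
by apply: cvgD; apply: cvgM; [exact: cvg_cst|exact: cvg_fst|exact: cvg_cst|exact: cvg_snd].
Qed.

Lemma continuous_sum_seq (I : Type) (s : seq I) (h : I -> R * R -> R) x :
  (forall i, cont (h i) x) -> cont (fun y => \sum_(i <- s) h i y) x.
Proof.
move=> hc; elim: s => [|i s IH].
  rewrite big_nil (_ : (fun y => _) = (fun=> 0)); first exact: cvg_cst.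
  by apply/funext => y; rewrite big_nil.
rewrite big_cons (_ : (fun y => _) = h i \+ (fun y => \sum_(i <- s) h i y)); last first.
  by apply/funext => y; rewrite big_cons.
by apply: cvgD; [exact: hc|exact: IH].
Qed.

Lemma continuous_Re_trig s f x : cont (fun y => complex.Re (trig s f y)) x.
Proof.
rewrite (_ : (fun y => _) = (fun y => \sum_(k <- s) complex.Re (f k * expi (k.1%:~R * y.1 + k.2%:~R * y.2)))); last first.
  by apply/funext => y; rewrite Re_sum.
apply: continuous_sum_seq => k.
rewrite ReM (_ : (fun y => _) = (fun y => complex.Re (f k) * cos (k.1%:~R * y.1 + k.2%:~R * y.2)
   - complex.Im (f k) * sin (k.1%:~R * y.1 + k.2%:~R * y.2))); last first.
  by apply/funext => y; rewrite ReM.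
apply: cvgB; (apply: cvgM; first exact: cvg_cst); apply: continuous_phase;
  [exact: continuous_cos|exact: continuous_sin].
Qed.

Lemma continuous_Im_trig s f x : cont (fun y => complex.Im (trig s f y)) x.
Proof.
rewrite (_ : (fun y => _) = (fun y => \sum_(k <- s) complex.Im (f k * expi (k.1%:~R * y.1 + k.2%:~R * y.2)))); last first.
  by apply/funext => y; rewrite Im_sum.
apply: continuous_sum_seq => k.
rewrite ImM (_ : (fun y => _) = (fun y => complex.Re (f k) * sin (k.1%:~R * y.1 + k.2%:~R * y.2)
   + complex.Im (f k) * cos (k.1%:~R * y.1 + k.2%:~R * y.2))); last first.
  by apply/funext => y; rewrite ImM.
apply: cvgD; (apply: cvgM; first exact: cvg_cst); apply: continuous_phase;
  [exact: continuous_sin|exact: continuous_cos].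
Qed.

(** A trigonometric polynomial is continuous, so a value above M is exceeded on a small product of
    balls around x. This product lies inside the torus and has positive measure, hence M is no
    essential upper bound. *)
Lemma Linfty_ge_point (v : field R * field R) s x : uniq s ->
  (forall k, k \notin s -> v.1 k = 0 /\ v.2 k = 0) ->
  0 < x.1 < 2 * pi -> 0 < x.2 < 2 * pi ->
  ((Num.sqrt (cmod2 (Defs.eval v.1 x) + cmod2 (Defs.eval v.2 x)))%:E <= Linfty v)%E.
Proof.
move=> us v0 x1 x2; pose F y := Num.sqrt (cmod2 (Defs.eval v.1 y) + cmod2 (Defs.eval v.2 y)).
have Fc : F @ x --> F x.
  have e1 y : Defs.eval v.1 y = trig s v.1 y by apply: eval_trig => // k /v0[].
  have e2 y : Defs.eval v.2 y = trig s v.2 y by apply: eval_trig => // k /v0[].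
  rewrite (_ : F = Num.sqrt \o (fun y => cmod2 (trig s v.1 y) + cmod2 (trig s v.2 y))); last first.
    by apply/funext => y; rewrite /F /= e1 e2.
  apply: continuous_comp; last exact: sqrt_continuous.
  by rewrite /cmod2; apply: cvgD; apply: cvgD; apply: cvgM;
    try exact: continuous_Re_trig; exact: continuous_Im_trig.
rewrite leNgt; apply/negP; rewrite /Linfty; set mu := mrestr _ _.
have mball (a e : R) : measurable (ball a e : set (measurableTypeR R)).
  by rewrite ball_itv; exact: measurable_itv.
have box_gt0 a b (e : R) : 0 < e -> (ball a e `*` ball b e `<=` @torus R) -> (0 < mu (ball a e `*` ball b e))%E.
  move=> e0 sub; rewrite /mu /= /mrestr setIidl// product_measure1E; [|exact: mball..].
  rewrite [X in (_ < X * _)%E]lebesgue_measure_ball ?ltW// [X in (_ < _ * X)%E]lebesgue_measure_ball ?ltW//.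
  by rewrite -EFinM lte_fin mulr_gt0// pmulrn_lgt0.
have P2 : 0 < 2 * pi :> R := two_pi_gt0.
have small e : 0 < e -> e <= x.1 -> e <= x.2 -> e <= 2 * pi - x.1 -> e <= 2 * pi - x.2 ->
    ball x.1 e `*` ball x.2 e `<=` @torus R.
  move=> e0 e1 e2 e3 e4 [a b] /= []; rewrite /ball /= !ltr_distlC => /andP[a1 a2] /andP[b1 b2].
  by split; rewrite /= in_itv/=; lra.
pose e0 := Num.min (Num.min x.1 x.2) (Num.min (2 * pi - x.1) (2 * pi - x.2)).
have e00 : 0 < e0 by rewrite !lt_min; lra.
have [l1 l2 l3 l4] : [/\ e0 <= x.1, e0 <= x.2, e0 <= 2 * pi - x.1 & e0 <= 2 * pi - x.2].
  by split; rewrite !ge_min lexx ?orbT.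
rewrite unlock /Lnorm.
(* The norm with exponent +oo is an essential supremum only when the total measure is positive. *)
have muT : (0 < mu [set: _])%E.
  apply: lt_le_trans (box_gt0 _ _ _ e00 (small _ e00 l1 l2 l3 l4)) _.
  apply: le_measure => //; rewrite ?inE//; by apply: measurableX; exact: mball.
rewrite muT => Llt.
have [M [LM MF]] : exists M : R, (ess_sup mu (abse \o (fun y => (F y)%:E)) <= M%:E)%E /\ M < F x.
  move: Llt; case: (ess_sup _ _) => [r||] //=.
    by rewrite lte_fin => ?; exists r; split.
  by move=> _; exists (F x - 1); split; [exact: leNye|rewrite ltrBlDr ltrDl].
move/ess_supP : LM => [N [mN muN sN]].
have : nbhs x [set y | M < F y] by apply: (Fc [set z | M < z]); exact: lt_nbhsr.
move=> [[A B] /= [nA nB] AB].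
move/nbhs_ballP : nA => [ea /= ea0 bA]; move/nbhs_ballP : nB => [eb /= eb0 bB].
pose e := Num.min e0 (Num.min ea eb).
have ep : 0 < e by rewrite lt_min e00/= lt_min ea0 eb0.
have ee0 : e <= e0 by rewrite ge_min lexx.
have eea : e <= ea by rewrite !ge_min lexx ?orbT.
have eeb : e <= eb by rewrite !ge_min lexx ?orbT.
have := box_gt0 _ _ _ ep (small _ ep (le_trans ee0 l1) (le_trans ee0 l2) (le_trans ee0 l3) (le_trans ee0 l4)).
rewrite ltNge => /negP; apply; rewrite -muN.
apply: le_measure; rewrite ?inE//; first by apply: measurableX; exact: mball.
move=> [a b] [/= ha hb]; apply: sN => /= h.
have /AB /= : (A `*` B) (a, b) by split; [apply: bA; exact: (le_ball eea) ha|apply: bB; exact: (le_ball eeb) hb].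
rewrite ltNge => /negP; apply; move: h; rewrite lee_fin; apply: le_trans; exact: ler_norm.
Qed.

(** Exact quadrature: on a grid of N = 2M + 1 nodes in each direction, the exponentials with
    frequencies in [box M] are orthogonal, so the coefficient is a mean of values of the polynomial
    times unimodular factors. *)
Lemma trig_coef s f (M : nat) (L : R) j :
  {subset s <= box M} -> uniq s -> j \in s ->
  (forall x, 0 < x.1 < 2 * pi -> 0 < x.2 < 2 * pi -> nc (trig s f x) <= L) -> nc (f j) <= L.
Proof.
move=> sM us js h; pose N := (2 * M).+1.
have NR : 0 < N%:R :> R by rewrite ltr0n.
pose p (a : 'I_N) : R := 2 * pi * (a%:R + 2^-1) / N%:R.
have P2 : 0 < 2 * pi :> R := two_pi_gt0.
have p_in a : 0 < p a < 2 * pi.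
  have a0 : 0 < a%:R + 2^-1 :> R by rewrite ltr_wpDl.
  apply/andP; split; first exact: (divr_gt0 (mulr_gt0 P2 a0) NR).
  rewrite /p ltr_pdivrMr// ltr_pM2l//.
  have : (a : nat).+1%:R <= N%:R :> R by rewrite ler_nat.
  by rewrite -natr1; lra.
have grid m : (`|m| < N)%N -> \sum_(a < N) expi (m%:~R * p a) = if m == 0 then N%:R else 0.
  move=> mN; case: eqP => [->|/eqP m0]; last by apply: grid_sum; rewrite absz_gt0 m0.
  under eq_bigr do rewrite mul0r expi0.
  by rewrite sumr_const card_ord.
have e : \sum_(a < N) \sum_(b < N) trig s f (p a, p b) * expi (- (j.1%:~R * p a + j.2%:~R * p b))
    = f j * (N%:R * N%:R).
  transitivity (\sum_(k <- s) f k * ((\sum_(a < N) expi ((k.1 - j.1)%:~R * p a)) *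
     (\sum_(b < N) expi ((k.2 - j.2)%:~R * p b)))).
    under eq_bigr => a _ do under eq_bigr => b _ do rewrite /trig mulr_suml.
    under eq_bigr => a _ do rewrite exchange_big/=.
    rewrite exchange_big/=; apply: eq_bigr => k _.
    rewrite big_distrlr/= mulr_sumr; apply: eq_bigr => a _.
    rewrite mulr_sumr; apply: eq_bigr => b _; rewrite -mulrA -!expiD; congr (_ * expi _).
    by rewrite !rmorphB/=; ring.
  rewrite (bigD1_seq j)//= !subrr !grid// eqxx big_seq_cond big1 ?addr0// => k /andP[ks kj].
  have := sM _ ks; have := sM _ js; rewrite !boxP => /andP[j1 j2] /andP[k1 k2].
  rewrite !grid; [|rewrite /N; lia..].
  case: eqP => [/eqP d1|_]; last by rewrite mul0r mulr0.
  case: eqP => [/eqP d2|_]; last by rewrite !mulr0.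
  case/negP: kj; move: d1 d2; rewrite !subr_eq0 => /eqP d1 /eqP d2.
  by rewrite -pair_eqE /= d1 d2 !eqxx.
have Nc : nc (N%:R : R[i]) = N%:R.
  have -> : (N%:R : R[i]) = (N%:R : R)%:C by rewrite rmorph_nat.
  by rewrite nc_real ger0_norm.
have : nc (f j * (N%:R * N%:R)) <= L * (N%:R * N%:R).
  rewrite -e; apply: le_trans (nc_sum _ _ _) _.
  have -> : L * (N%:R * N%:R) = \sum_(a < N) \sum_(b < N) L.
    by rewrite !sumr_const card_ord -mulrnA -natrM mulr_natr.
  apply: ler_sum => a _; apply: le_trans (nc_sum _ _ _) _; apply: ler_sum => b _.
  by rewrite ncM nc_expi mulr1; apply: h; exact: p_in.
by rewrite !ncM !Nc ler_pM2r// mulr_gt0.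
Qed.

Lemma source0 (gamma : R -> R) xi : gamma 0 = 0 -> source gamma xi 0 = 0.
Proof. by move=> g0; rewrite /source kn0 g0 mul0r oppr0 mul0r. Qed.

Lemma lap_inv_source (gamma : R -> R) xi k : gamma 0 = 0 ->
  lap_inv (source gamma xi) k = (gamma (knorm k))%:C * expi (xi k).
Proof.
move=> g0; rewrite /lap_inv; case: eqP => [->|/eqP k0]; first by rewrite kn0 g0 mul0r.
rewrite /source mulrA mulrNN -rmorphM/= [_^-1 * _]mulrC -mulrA divff ?mulr1//.
by rewrite expf_eq0/= gt_eqF// kn_gt0.
Qed.

Lemma gamma_out (gamma : R -> R) (kappa_g : R) k :
  (forall kappa, kappa_g <= kappa -> gamma kappa = 0) ->
  k \notin box (Num.truncn kappa_g).+1 -> gamma (knorm k) = 0.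
Proof.
move=> gk kM; apply: gk; apply: ltW; move: kM; rewrite boxP negb_and -!ltnNge.
have tr (x : int) : ((Num.truncn kappa_g).+1 < `|x|)%N -> kappa_g < `|x%:~R : R|.
  move=> Mx; apply: lt_trans (truncnS_gt _) _.
  by rewrite -intr_norm -natr_absz ltr_nat.
case/orP => /tr h; apply: lt_le_trans h _; rewrite knE;
  [exact: (@Re_le_nc R (_ +i* _))|exact: (@Im_le_nc R (_ +i* _))].
Qed.

(** The j-th coefficients of the two components have modulus |j_x gamma_j| and |j_y gamma_j|, and a
    nonzero integer component has size at least 1. This brings the norm of the source into the bound
    on the remainder. *)
Lemma Linfty_ge_gamma (gamma : R -> R) xi (kappa_g : R) j : gamma 0 = 0 ->
  (forall kappa, kappa_g <= kappa -> gamma kappa = 0) ->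
  (`|gamma (knorm j)|%:E <= Linfty (grad_inv (source gamma xi)))%E.
Proof.
move=> g0 gk; set v := grad_inv _.
have Lge0 : (0 <= Linfty v)%E by exact: Lnorm_ge0.
have [->|j0] := eqVneq j 0; first by rewrite kn0 g0 normr0.
pose M := (Num.truncn kappa_g).+1.
have out k : k \notin box M -> gamma (knorm k) = 0 by exact: gamma_out gk.
have vout k : k \notin box M -> v.1 k = 0 /\ v.2 k = 0.
  by move=> /out kM; rewrite /v /= /dx /dy !lap_inv_source// kM !mul0r !mulr0.
have [jM|/out ->] := boolP (j \in box M); last by rewrite normr0.
move: Lge0; case LE : (Linfty v) => [L| |]// L0; last by rewrite leey.
have pt x : 0 < x.1 < 2 * pi -> 0 < x.2 < 2 * pi -> nc (trig (box M) v.1 x) <= L /\ nc (trig (box M) v.2 x) <= L.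
  move=> x1 x2; have := Linfty_ge_point (box_uniq M) vout x1 x2.
  rewrite LE lee_fin !(eval_trig _ (box_uniq M)); [|by move=> k /vout[]..].
  have ns (z : R[i]) : nc z = Num.sqrt (cmod2 z) by rewrite -nc_sqr sqrtr_sqr ger0_norm ?nc_ge0.
  have s0 (z : R[i]) : 0 <= cmod2 z by rewrite -nc_sqr sqr_ge0.
  by move=> h; split; apply: le_trans h; rewrite ns; apply: ler_wsqrtr; rewrite ?lerDl ?lerDr.
have c1 := @trig_coef (box M) v.1 M L j (fun=> id) (box_uniq M) jM (fun x a b => (pt x a b).1).
have c2 := @trig_coef (box M) v.2 M L j (fun=> id) (box_uniq M) jM (fun x a b => (pt x a b).2).
have big (x : int) : x != 0 -> 1 <= `|x%:~R : R|.
  by move=> x0; rewrite -intr_norm -natr_absz ler1n absz_gt0.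
have cE (x : int) : x != 0 -> `|x%:~R| * `|gamma (knorm j)| <= L -> `|gamma (knorm j)| <= L.
  by move=> /big x1; apply: le_trans; rewrite ler_peMl.
rewrite lee_fin; have [j1|j1] := eqVneq j.1 0.
  have j2 : j.2 != 0.
    by apply: contra j0 => /eqP j2; rewrite -pair_eqE /= j1 j2 !eqxx.
  apply: (cE _ j2); move: c2; rewrite /v /= /dy lap_inv_source// !ncM nc_i nc_expi !nc_real.
  by rewrite mul1r mulr1.
apply: (cE _ j1); move: c1; rewrite /v /= /dx lap_inv_source// !ncM nc_i nc_expi !nc_real.
by rewrite mul1r mulr1.
Qed.

End supremum_bound.

(** * Independence *)

Section bounded_expectation.
Context {d : measure_display} {Omega : measurableType d} {R : realType}.
Variable P : probability Omega R.
Implicit Types (f g : Omega -> R) (c : R).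

(** Every variable whose expectation is taken below is bounded, the source having finitely many
    modes; this class is closed under ring operations and integrable on a probability space. *)
Definition bmeas f := measurable_fun [set: Omega] f /\ exists C, forall w, `|f w| <= C.

Definition Ex f : R := \int[P]_w f w.

Lemma bmeas_cst c : bmeas (fun=> c).
Proof. by split; [exact: measurable_cst|exists `|c|]. Qed.

Lemma bmeasD f g : bmeas f -> bmeas g -> bmeas (fun w => f w + g w).
Proof.
move=> [mf [C fC]] [mg [C' gC]]; split; first exact: measurable_funD.
by exists (C + C') => w; apply: le_trans (ler_normD _ _) _; rewrite lerD.
Qed.

Lemma bmeasM f g : bmeas f -> bmeas g -> bmeas (fun w => f w * g w).
Proof.
move=> [mf [C fC]] [mg [C' gC]]; split; first exact: measurable_funM.
by exists (C * C') => w; rewrite normrM ler_pM.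
Qed.

Lemma bmeasZ c f : bmeas f -> bmeas (fun w => c * f w).
Proof. by move=> mf; apply: bmeasM => //; exact: bmeas_cst. Qed.

Lemma bmeasN f : bmeas f -> bmeas (fun w => - f w).
Proof.
by move=> [mf [C fC]]; split; [exact: measurable_funN|exists C => w; rewrite normrN].
Qed.

Lemma bmeasB f g : bmeas f -> bmeas g -> bmeas (fun w => f w - g w).
Proof. by move=> mf mg; apply: bmeasD => //; exact: bmeasN. Qed.

Lemma bmeas_sum (I : Type) (s : seq I) (F : I -> Omega -> R) :
  (forall i, bmeas (F i)) -> bmeas (fun w => \sum_(i <- s) F i w).
Proof.
move=> mF; elim: s => [|i s IH].
  by under eq_fun do rewrite big_nil; exact: bmeas_cst.
by under eq_fun do rewrite big_cons; exact: bmeasD.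
Qed.

Lemma bmeas_prod (I : Type) (s : seq I) (F : I -> Omega -> R) :
  (forall i, bmeas (F i)) -> bmeas (fun w => \prod_(i <- s) F i w).
Proof.
move=> mF; elim: s => [|i s IH].
  by under eq_fun do rewrite big_nil; exact: bmeas_cst.
by under eq_fun do rewrite big_cons; exact: bmeasM.
Qed.

Lemma bmeasX f n : bmeas f -> bmeas (fun w => f w ^+ n).
Proof.
move=> mf; elim: n => [|n IH]; first by under eq_fun do rewrite expr0; exact: bmeas_cst.
by under eq_fun do rewrite exprS; exact: bmeasM.
Qed.

Lemma bmeas_integrable f : bmeas f -> P.-integrable [set: Omega] (EFin \o f).
Proof.
move=> [mf [C fC]]; apply: measurable_bounded_integrable => //.
  by rewrite [X in (X < _)%E]probability_setT ltry.
exists C; split; first exact: num_real.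
by move=> x Cx w _; apply: le_trans (fC w) (ltW Cx).
Qed.

Lemma ExD f g : bmeas f -> bmeas g -> Ex (fun w => f w + g w) = Ex f + Ex g.
Proof. by move=> mf mg; apply: RintegralD => //; exact: bmeas_integrable. Qed.

Lemma ExB f g : bmeas f -> bmeas g -> Ex (fun w => f w - g w) = Ex f - Ex g.
Proof. by move=> mf mg; apply: RintegralB => //; exact: bmeas_integrable. Qed.

Lemma ExZ c f : bmeas f -> Ex (fun w => c * f w) = c * Ex f.
Proof. by move=> mf; apply: RintegralZl => //; exact: bmeas_integrable. Qed.

Lemma Ex_cst c : Ex (fun=> c) = c.
Proof. rewrite /Ex Rintegral_cst// (_ : fine _ = 1) ?mulr1//.
by rewrite [X in fine X]probability_setT. Qed.

Lemma Ex_sum (I : Type) (s : seq I) (F : I -> Omega -> R) :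
  (forall i, bmeas (F i)) -> Ex (fun w => \sum_(i <- s) F i w) = \sum_(i <- s) Ex (F i).
Proof.
move=> mF; elim: s => [|i s IH].
  by rewrite big_nil -[RHS](Ex_cst 0); congr Ex; apply/funext => w; rewrite big_nil.
rewrite big_cons -IH -ExD//; last exact: bmeas_sum.
by congr Ex; apply/funext => w; rewrite big_cons.
Qed.

Lemma Ex_le f g : bmeas f -> bmeas g -> (forall w, f w <= g w) -> Ex f <= Ex g.
Proof. by move=> mf mg fg; apply: le_Rintegral => //; exact: bmeas_integrable. Qed.

Lemma Ex_ge0 f : (forall w, 0 <= f w) -> 0 <= Ex f.
Proof. by move=> f0; apply: Rintegral_ge0. Qed.

Lemma Ex_norm_le f c : bmeas f -> (forall w, `|f w| <= c) -> `|Ex f| <= c.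
Proof.
move=> mf fc; rewrite ler_norml; apply/andP; split.
  by rewrite -[- c]Ex_cst; apply: Ex_le => // [|w]; [exact: bmeas_cst|have := fc w; rewrite ler_norml => /andP[]].
by rewrite -[leRHS]Ex_cst; apply: Ex_le => // [|w]; [exact: bmeas_cst|have := fc w; rewrite ler_norml => /andP[]].
Qed.

Lemma Ex_expectation f : bmeas f -> ('E_P[f] = (Ex f)%:E)%E.
Proof.
move=> mf; rewrite unlock /Ex /Rintegral fineK//.
by apply: integrable_fin_num => //; exact: bmeas_integrable.
Qed.

Lemma Ex_variance f : bmeas f -> ('V_P[f] = (Ex (fun w => (f w - Ex f) ^+ 2))%:E)%E.
Proof.
move=> mf; rewrite -Ex_expectation; last by apply: bmeasX; apply: bmeasB => //; exact: bmeas_cst.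
have e := Ex_expectation mf.
by rewrite /variance unlock e /=; congr expectation; apply/funext => w; rewrite /= expr2.
Qed.

(** The mean minimises the second moment. It allows the variance to be estimated about an explicit
    number instead of the mean. *)
Lemma Ex_variance_le f c : bmeas f -> Ex (fun w => (f w - Ex f) ^+ 2) <= Ex (fun w => (f w - c) ^+ 2).
Proof.
move=> mf; set m := Ex f; have mc k := bmeas_cst k.
have m2 : bmeas (fun w => (f w - c) ^+ 2) by apply: bmeasX; exact: bmeasB.
have m3 : bmeas (fun w => 2 * (m - c) * f w) by exact: bmeasZ.
rewrite (_ : (fun w => (f w - m) ^+ 2) =
    (fun w => (f w - c) ^+ 2 - 2 * (m - c) * f w + (m ^+ 2 - c ^+ 2))); last first.
  by apply/funext => w; ring.
rewrite ExD ?ExB ?ExZ ?Ex_cst//; last exact: bmeasB.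
rewrite -/m -subr_ge0 (_ : _ - _ = (m - c) ^+ 2) ?sqr_ge0//; ring.
Qed.

Lemma Ex_sqr_le f : bmeas f -> Ex f ^+ 2 <= Ex (fun w => f w ^+ 2).
Proof.
move=> mf; set m := Ex f; have mc k := bmeas_cst k.
have : 0 <= Ex (fun w => (f w - m) ^+ 2) by apply: Ex_ge0 => w; exact: sqr_ge0.
have m2 : bmeas (fun w => f w ^+ 2) by exact: bmeasX.
have m3 : bmeas (fun w => 2 * m * f w) by exact: bmeasZ.
rewrite (_ : (fun w => (f w - m) ^+ 2) = (fun w => f w ^+ 2 - 2 * m * f w + m ^+ 2)); last first.
  by apply/funext => w; ring.
rewrite ExD ?ExB ?ExZ ?Ex_cst//; last exact: bmeasB.
by rewrite -/m; nra.
Qed.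

Lemma Ex_indic (A : set Omega) : measurable A -> Ex (fun w => \1_A w) = fine (P A).
Proof. by move=> mA; rewrite /Ex /Rintegral integral_indic// setIT. Qed.

End bounded_expectation.

(** * Factorisation of expectations of independent variables *)

Section independence.
Context {d : measure_display} {Omega : measurableType d} {R : realType}.
Variable P : probability Omega R.

Local Notation Ex := (@Ex d Omega R P).

Definition bfun (h : R -> R) := measurable_fun [set: R] h /\ exists C, forall x, `|h x| <= C.

Lemma bfun_comp (h : R -> R) (X : Omega -> R) : bfun h -> measurable_fun [set: Omega] X ->
  bmeas (fun w => h (X w)).
Proof.
move=> [mh [C hC]] mX; split; first exact: (measurableT_comp mh mX).
by exists C => w; exact: hC.
Qed.

Lemma bfun_indic (A : set R) : measurable A -> bfun (\1_A : R -> R).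
Proof.
move=> mA; split; first exact: measurable_indic.
by exists 1 => w; rewrite indicE; case: (_ \in _); rewrite ?normr1 ?normr0.
Qed.

(** The range of h is cut into intervals of length e, and on the preimage of each h is replaced by
    the left end of the interval. *)
Lemma step_approximation (h : R -> R) (e : R) : bfun h -> 0 < e ->
  exists s : seq (R * set R), (forall p, p \in s -> measurable p.2) /\
    forall x, `|h x - \sum_(p <- s) p.1 * \1_(p.2) x| <= e.
Proof.
move=> [mh [C hC]] e0; pose M := `|C| + 1.
pose n := (Num.truncn (2 * M / e)).+1.
pose A (l : nat) := h @^-1` `[l%:R * e - M, l.+1%:R * e - M[%classic.
exists [seq (l%:R * e - M, A l) | l <- iota 0 n]; split.
  move=> p /mapP[l _ ->] /=; rewrite -[A l]setTI; apply: mh => //.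
move=> x; rewrite big_map.
have hx : `|h x| < M by apply: le_lt_trans (hC x) _; have := ler_norm C; rewrite /M; lra.
have y0 : 0 <= (h x + M) / e by rewrite divr_ge0 ?ltW//; move: hx; rewrite ltr_norml; lra.
pose l0 := Num.truncn ((h x + M) / e).
have /andP[l1 l2] := truncn_itv y0; rewrite -/l0 in l1 l2.
rewrite ler_pdivlMr// in l1; rewrite ltr_pdivrMr// in l2.
have l0n : (l0 < n)%N.
  rewrite ltnS; apply: le_truncn; rewrite ler_pM2r ?invr_gt0//.
  by move: hx; rewrite ltr_norml; lra.
rewrite (bigD1_seq l0) ?mem_iota ?iota_uniq//= big1 ?addr0; last first.
  move=> l ll0; rewrite indicE memNset ?mulr0// /A /= in_itv/= => /andP[a1 a2].
  case/negP: ll0; rewrite -(rwP eqP).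
  apply/eqP; rewrite eqn_leq; apply/andP; split.
    have : l%:R * e < l0.+1%:R * e by lra.
    by rewrite ltr_pM2r// ltr_nat ltnS.
  have : l0%:R * e < l.+1%:R * e by lra.
  by rewrite ltr_pM2r// ltr_nat ltnS.
rewrite indicE mem_set ?mulr1; last by rewrite /A /= in_itv/=; lra.
rewrite -natr1 in l2.
by rewrite ler_norml; lra.
Qed.

(** Linearity extends the product rule from indicators to step functions, and a uniform error e in h
    changes the difference of the two sides by at most 2 C e, where C bounds H. *)
Lemma factor_function (H X : Omega -> R) : bmeas H -> measurable_fun [set: Omega] X ->
  (forall A : set R, measurable A ->
     Ex (fun w => H w * \1_A (X w)) = Ex H * Ex (fun w => \1_A (X w))) ->
  forall h, bfun h -> Ex (fun w => H w * h (X w)) = Ex H * Ex (fun w => h (X w)).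
Proof.
move=> bH mX fac h bh; have [mH [C HC]] := bH.
have C0 : 0 <= C by apply: le_trans (HC point); exact: normr_ge0.
apply/eqP; rewrite -subr_eq0 -normr_le0; apply/ler_addgt0Pl => e' e'0; rewrite addr0.
pose e := e' / (2 * C + 1).
have e0 : 0 < e by rewrite divr_gt0//; lra.
have [s [ms hs]] := step_approximation bh e0.
pose S x := \sum_(p <- s) p.1 * \1_(p.2) x.
have bind (p : R * set R) : p \in s -> bmeas (fun w => \1_(p.2) (X w) : R).
  by move=> /ms mp; exact: (bfun_comp (bfun_indic mp) mX).
have bS_ (t : seq (R * set R)) : {subset t <= s} -> bmeas (fun w => \sum_(p <- t) p.1 * \1_(p.2) (X w)) /\
   Ex (fun w => H w * (\sum_(p <- t) p.1 * \1_(p.2) (X w))) =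
     Ex H * Ex (fun w => \sum_(p <- t) p.1 * \1_(p.2) (X w)).
  elim: t => [|p t IH] ts.
    split; first by under eq_fun do rewrite big_nil; exact: bmeas_cst.
    rewrite (_ : (fun w => \sum_(p <- [::]) _) = (fun=> 0)); last by apply/funext => w; rewrite big_nil.
    rewrite Ex_cst mulr0 (_ : (fun w => _) = (fun=> 0)) ?Ex_cst//.
    by apply/funext => w; rewrite big_nil mulr0.
  have [b1 e1] := IH (fun q qt => ts q (mem_behead (s:=p::t) qt)).
  have ps : p \in s by apply: ts; rewrite mem_head.
  have b2 := bmeasZ p.1 (bind p ps).
  split; first by under eq_fun do rewrite big_cons; exact: bmeasD.
  rewrite (_ : (fun w => \sum_(q <- p :: t) _) =
    (fun w => p.1 * \1_(p.2) (X w) + \sum_(q <- t) q.1 * \1_(q.2) (X w))); last first.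
    by apply/funext => w; rewrite big_cons.
  have e2 : Ex (fun w => p.1 * \1_(p.2) (X w)) = p.1 * Ex (fun w => \1_(p.2) (X w)).
    exact: (ExZ P _ (bind p ps)).
  have bHp := bmeasM bH (bind p ps).
  have e3 : Ex (fun w => H w * (p.1 * \1_(p.2) (X w))) = Ex H * Ex (fun w => p.1 * \1_(p.2) (X w)).
    rewrite e2 (_ : (fun w => H w * _) = (fun w => p.1 * (H w * \1_(p.2) (X w)))).
      by rewrite (ExZ P _ bHp) (fac _ (ms _ ps)) mulrCA.
    by apply/funext => w; rewrite mulrCA.
  rewrite (ExD P b2 b1) mulrDr -e1 -e3 -ExD; [|exact: bmeasM|exact: bmeasM].
  by congr Ex; apply/funext => w; rewrite big_cons mulrDr.
have [bS eS] := bS_ s (fun p => id).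
have bhX := bfun_comp bh mX.
rewrite (_ : _ - _ = Ex (fun w => H w * (h (X w) - S (X w))) - Ex H * Ex (fun w => h (X w) - S (X w))); last first.
  rewrite (_ : (fun w => H w * (_ - _)) = (fun w => H w * h (X w) - H w * S (X w))); last first.
    by apply/funext => w; ring.
  rewrite !ExB//; [|exact: bmeasM|exact: bmeasM].
  by rewrite [X in _ - X - _]eS; ring.
have bd := bmeasB bhX bS.
apply: le_trans (ler_normB _ _) _; rewrite normrM.
have h1 : `|Ex (fun w => H w * (h (X w) - S (X w)))| <= C * e.
  apply: Ex_norm_le => [|w]; first exact: bmeasM.
  by rewrite normrM ler_pM// hs.
have h2 : `|Ex H| * `|Ex (fun w => h (X w) - S (X w))| <= C * e.
  apply: ler_pM => //; first exact: Ex_norm_le.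
  by apply: Ex_norm_le => // w; exact: hs.
apply: le_trans (lerD h1 h2) _.
rewrite (_ : _ + _ = (2 * C) * e); last by ring.
rewrite /e mulrCA ger_pMr// ler_pdivrMr; lra.
Qed.

Section complex_factors.
Context {I : choiceType} {D : set I}.
Variable X : I -> {RV P >-> R}.
Hypothesis indX : mutually_independent D X.

Definition cfun (f : R -> R[i]) := bfun (fun x => complex.Re (f x)) /\ bfun (fun x => complex.Im (f x)).

Definition ind_prod (A : I -> set R) (s : seq I) w : R := \prod_(i <- s) \1_(A i) (X i w).

Lemma measurable_RV i : measurable_fun [set: Omega] (X i).
Proof. exact: measurable_funPT. Qed.

Lemma bmeas_ind_prod A s : (forall i, measurable (A i)) -> bmeas (ind_prod A s).
Proof.
by move=> mA; apply: bmeas_prod => i; apply: (bfun_comp (bfun_indic (mA i))); exact: measurable_RV.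
Qed.

Lemma Ex_ind_prod A s : uniq s -> (forall i, i \in s -> D i) -> (forall i, measurable (A i)) ->
  Ex (ind_prod A s) = \prod_(i <- s) Ex (fun w => \1_(A i) (X i w)).
Proof.
move=> us sD mA.
have mXA i : measurable (X i @^-1` A i) by rewrite -[X in measurable X]setTI; exact: measurable_RV.
have -> : ind_prod A s = \1_(\bigcap_(i in [set` s]) X i @^-1` A i).
  apply/funext => w; rewrite indicE; case: (boolP (w \in _)) => [|].
    rewrite inE => h; rewrite /ind_prod big_seq big1// => i si.
    by rewrite indicE mem_set//; exact: h.
  move=> /negP h; have [i si /negP ni] : exists2 i, i \in s & X i w \notin A i.
    apply: contrapT => h2; apply: h; rewrite inE => i /= si; apply: contrapT => nAi.
    by apply: h2; exists i => //; apply/negP; rewrite inE.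
  by rewrite /ind_prod (bigD1_seq i)//= indicE (negbTE (introN idP ni)) mul0r.
rewrite Ex_indic; last first.
  by rewrite bigcap_seq; apply: bigsetI_measurable => i _.
have PE i : P (X i @^-1` A i) = (Ex (fun w => \1_(A i) (X i w)))%:E.
  have -> : (fun w => \1_(A i) (X i w) : R) = \1_(X i @^-1` A i) by [].
  by rewrite (Ex_indic P (mXA i)) fineK// fin_num_measure.
rewrite indX// (eq_bigr _ (fun i _ => PE i)).
have -> (x : I -> R) : (\prod_(i <- s) (x i)%:E)%E = (\prod_(i <- s) x i)%:E.
  by elim/big_rec2: _ => // i y1 y2 _ ->; rewrite EFinM.
by [].
Qed.

Definition cfactor (c : R[i]) (f : I -> R -> R[i]) (r : seq I) w : R[i] :=
  c * \prod_(i <- r) f i (X i w).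

(** Since - Im z = Re (i z), the real parts alone satisfy a recursion once the constant c is allowed
    to vary. Inductions on products of complex factors can thus stay with real expectations. *)
Lemma cfactor_cons c f p r w :
  complex.Re (cfactor c f (p :: r) w) =
    complex.Re (cfactor c f r w) * complex.Re (f p (X p w)) +
    complex.Re (cfactor ('i * c) f r w) * complex.Im (f p (X p w)).
Proof.
rewrite /cfactor big_cons; case: (f p _) => a b; case: (\prod_(i <- r) _) => x y; case: c => u v /=.
by ring.
Qed.

Lemma bmeas_cfactor c f r : (forall i, cfun (f i)) -> bmeas (fun w => complex.Re (cfactor c f r w)).
Proof.
move=> cf; elim: r c => [|p r IH] c.
  by under eq_fun do rewrite /cfactor big_nil mulr1; exact: bmeas_cst.
under eq_fun do rewrite cfactor_cons; have [fr fi] := cf p.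
by apply: bmeasD; apply: bmeasM; [exact: IH|exact: (bfun_comp fr (measurable_RV p))|
  exact: IH|exact: (bfun_comp fi (measurable_RV p))].
Qed.

(** The list [s] of events makes the induction on [r] possible. To treat the head p, its factor is
    first replaced by an indicator and p is moved to [s], with the event at p exchanged;
    [factor_function] then passes from indicators to the function of p. *)
Lemma Ex_cfactor_ind r : forall c f A s, (forall i, cfun (f i)) -> uniq (r ++ s) ->
  (forall i, i \in r ++ s -> D i) -> (forall i, measurable (A i)) ->
  Ex (fun w => complex.Re (cfactor c f r w) * ind_prod A s w) =
  Ex (fun w => complex.Re (cfactor c f r w)) * Ex (ind_prod A s).
Proof.
elim: r => [|p r IH] c f A s cf us sD mA.
  have e w : complex.Re (cfactor c f [::] w) = complex.Re c by rewrite /cfactor big_nil mulr1.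
  under eq_fun do rewrite e; rewrite (ExZ P _ (bmeas_ind_prod s mA)).
  by congr (_ * _); under eq_fun do rewrite e; rewrite Ex_cst.
have [fr fi] := cf p; have mX := measurable_RV p.
have br := bfun_comp fr mX; have bi := bfun_comp fi mX.
move: us; rewrite /= => /andP[pn us].
have us0 : uniq (r ++ [::]) by rewrite cats0; move: us; rewrite cat_uniq => /andP[].
have sD' i : i \in r ++ s -> D i by move=> h; apply: sD; rewrite inE h orbT.
have sD0 i : i \in r ++ [::] -> D i by rewrite cats0 => h; apply: sD'; rewrite mem_cat h.
have bG c' := bmeas_cfactor c' r cf; have bS := bmeas_ind_prod s mA.
have key c' h s' : uniq (r ++ s') -> p \notin r ++ s' -> (forall i, i \in r ++ s' -> D i) -> bfun h ->
    Ex (fun w => complex.Re (cfactor c' f r w) * ind_prod A s' w * h (X p w)) =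
    Ex (fun w => complex.Re (cfactor c' f r w)) * Ex (ind_prod A s') * Ex (fun w => h (X p w)).
  move=> us' pn' sD1 bh; have bS' := bmeas_ind_prod s' mA.
  rewrite -(IH c' f A s' cf us' sD1 mA).
  apply: (factor_function (bmeasM (bG c') bS') mX) => // B mB.
  pose A' i := if i == p then B else A i.
  have mA' i : measurable (A' i) by rewrite /A'; case: ifP.
  have A's w : ind_prod A' s' w = ind_prod A s' w.
    rewrite /ind_prod; apply: eq_big_seq => i si; rewrite /A'; case: eqP => // ip.
    by move: pn'; rewrite -ip mem_cat si orbT.
  have A'ps w : ind_prod A' (p :: s') w = ind_prod A s' w * \1_B (X p w).
    by rewrite /ind_prod big_cons -/(ind_prod A' s' w) A's /A' eqxx mulrC.
  have us2 : uniq (r ++ p :: s').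
    by rewrite (uniq_catCA r [:: p] s') /= pn' us'.
  have sD2 i : i \in r ++ p :: s' -> D i.
    rewrite mem_cat inE => /or3P[hi|/eqP ->|hi].
    - by apply: sD1; rewrite mem_cat hi.
    - by apply: sD; rewrite mem_head.
    - by apply: sD1; rewrite mem_cat hi orbT.
  have us3 : uniq (p :: s').
    by move: us2; rewrite cat_uniq => /and3P[].
  have sD3 i : i \in p :: s' -> D i by move=> hi; apply: sD2; rewrite mem_cat hi orbT.
  have us4 : uniq s' by case/andP: us3.
  have sD4 i : i \in s' -> D i by move=> hi; apply: sD3; rewrite inE hi orbT.
  have := IH c' f A' (p :: s') cf us2 sD2 mA'.
  rewrite (_ : (fun w => _ * ind_prod A' (p :: s') w) =
    (fun w => complex.Re (cfactor c' f r w) * ind_prod A s' w * \1_B (X p w))); last first.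
    by apply/funext => w; rewrite A'ps mulrA.
  move=> ->; rewrite (IH c' f A s' cf us' sD1 mA) (Ex_ind_prod us3 sD3 mA') (Ex_ind_prod us4 sD4 mA).
  rewrite big_cons /A' eqxx -!mulrA; congr (_ * _); rewrite mulrC; congr (_ * _).
  apply: eq_big_seq => i si; case: eqP => // ip.
  by move: pn'; rewrite -ip mem_cat si orbT.
have e1 : Ex (fun w => complex.Re (cfactor c f (p :: r) w)) =
    Ex (fun w => complex.Re (cfactor c f r w)) * Ex (fun w => complex.Re (f p (X p w))) +
    Ex (fun w => complex.Re (cfactor ('i * c) f r w)) * Ex (fun w => complex.Im (f p (X p w))).
  under [X in Ex X]eq_fun do rewrite cfactor_cons.
  have pn0 : p \notin r ++ [::] by move: pn; rewrite cats0 mem_cat negb_or => /andP[].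
  have one : Ex (ind_prod A [::]) = 1.
    by rewrite -[RHS](Ex_cst P 1); congr Ex; apply/funext => w; rewrite /ind_prod big_nil.
  have k1 := key c _ [::] us0 pn0 sD0 fr; have k2 := key ('i * c) _ [::] us0 pn0 sD0 fi.
  rewrite one mulr1 in k1; rewrite one mulr1 in k2.
  rewrite ExD; [|exact: bmeasM|exact: bmeasM]; rewrite -k1 -k2.
  by congr (Ex _ + Ex _); apply/funext => w; rewrite /ind_prod big_nil mulr1.
rewrite e1 mulrDl.
move: (key c _ s us pn sD' fr) (key ('i * c) _ s us pn sD' fi) => k1 k2.
rewrite [X in _ = X + _]mulrAC [X in _ = _ + X]mulrAC -k1 -k2.
rewrite -ExD; [|by apply: bmeasM => //; exact: bmeasM|by apply: bmeasM => //; exact: bmeasM].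
by congr Ex; apply/funext => w; rewrite cfactor_cons; ring.
Qed.

Lemma Ex_cfactor_cons c f p r : (forall i, cfun (f i)) -> uniq (p :: r) ->
  (forall i, i \in p :: r -> D i) ->
  Ex (fun w => complex.Re (f p (X p w))) = 0 -> Ex (fun w => complex.Im (f p (X p w))) = 0 ->
  Ex (fun w => complex.Re (cfactor c f (p :: r) w)) = 0.
Proof.
move=> cf /andP[pr ur] prD er ei; under eq_fun do rewrite cfactor_cons.
have [fr fi] := cf p; have mX := measurable_RV p.
have prD' i : i \in r ++ [:: p] -> D i.
  by rewrite mem_cat inE => h; apply: prD; rewrite inE orbC.
have us : uniq (r ++ [:: p]) by rewrite cats1 rcons_uniq pr.
have br := bfun_comp fr mX; have bi := bfun_comp fi mX.
have bG c' := bmeas_cfactor c' r cf.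
have key c' h : bfun h -> Ex (fun w => h (X p w)) = 0 ->
    Ex (fun w => complex.Re (cfactor c' f r w) * h (X p w)) = 0.
  move=> bh h0; rewrite (factor_function (bG c') mX _ bh) ?h0 ?mulr0// => B mB.
  have := @Ex_cfactor_ind r c' f (fun=> B) [:: p] cf us prD' (fun=> mB).
  have e w : ind_prod (fun=> B) [:: p] w = \1_B (X p w) by rewrite /ind_prod big_seq1.
  by rewrite (_ : ind_prod (fun=> B) [:: p] = (fun w => \1_B (X p w)))//; apply/funext => w; rewrite e.
move: (key c _ fr er) (key ('i * c) _ fi ei) => k1 k2.
by rewrite ExD; [rewrite k1 k2 addr0|exact: bmeasM|exact: bmeasM].
Qed.

End complex_factors.

End independence.

(** * Uniform phases and their characters *)

Section uniform_phases.
Context {d : measure_display} {Omega : measurableType d} {R : realType}.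
Variable P : probability Omega R.

Local Notation Ex := (@Ex d Omega R P).

Lemma continuous_bfun (h : R -> R) C : continuous h -> (forall x, `|h x| <= C) -> bfun h.
Proof. by move=> ch hC; split; [exact: continuous_measurable_fun|exists C]. Qed.

Lemma cos_norm (x : R) : `|cos x| <= 1.
Proof. by rewrite ler_norml cos_le1 cos_geN1. Qed.

Lemma sin_norm (x : R) : `|sin x| <= 1.
Proof. by rewrite ler_norml sin_le1 sin_geN1. Qed.

Lemma uniform_mean0 (X : {RV P >-> R}) (h H : R -> R) : uniform_phase X ->
  continuous h -> (forall x, is_derive x (1 : R) H (h x)) -> (forall x, `|h x| <= 1) ->
  H (2 * pi) = H 0 -> Ex (fun w => h (X w)) = 0.
Proof.
move=> uX ch dH h1 H0.
have bh : bfun h by exact: continuous_bfun ch h1.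
have mX : measurable_fun [set: Omega] X by exact: measurable_funPT.
have P2 : 0 < 2 * pi :> R := two_pi_gt0.
(* Adding 1 makes the integrand nonnegative, as the change of variables to the uniform law demands;
   the integral of 1 + h over a period is then given by the primitive x + H x. *)
have c1 : continuous (fun x : R => 1 + h x).
  by move=> x; apply: cvgD; [exact: cvg_cst|exact: ch].
have mf : measurable_fun [set: measurableTypeR R] (fun x : R => (1 + h x)%:E).
  by apply/measurable_EFinP; exact: continuous_measurable_fun.
have f0 x : (0 <= (1 + h x)%:E)%E.
  by rewrite lee_fin; have := h1 x; rewrite ler_norml => /andP[]; lra.
have e : (\int[P]_w (1 + h (X w))%:E = 1)%E.
  have mX' : measurable_fun [set: Omega] (X : Omega -> measurableTypeR R) by exact: mX.
  transitivity (\int[uniform_prob (@two_pi_gt0 R)]_y (1 + h y)%:E)%E.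
    rewrite -[LHS](@ge0_integral_pushforward _ _ _ (measurableTypeR R) _ _ mX' P setT (fun y => (1 + h y)%:E))//.
    by apply: eq_measure_integral => A mA _; exact: uX.
  rewrite integral_uniform// (@continuous_FTC2 _ _ (fun x => x + H x) 0 (2 * pi))//.
  - rewrite H0 add0r -EFinB -EFinM; congr (_%:E).
    by rewrite subr0 addrK mulVf// gt_eqF.
  - by apply: continuous_subspaceT.
  - have dF x : derivable (fun x => x + H x) x 1.
      exact: derivableD.
    have cF (x : R) : {for x, continuous (fun x => x + H x)}.
      by apply: differentiable_continuous; apply/derivable1_diffP; exact: dF.
    split=> [x _||]; first exact: dF.
      exact: cvg_at_right_filter (cF 0).
    exact: cvg_at_left_filter (cF (2 * pi)).
  - move=> x _; rewrite derive1E deriveD//.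
    by rewrite derive_id; congr (_ + _); exact: derive_val.
have b1 := bmeas_cst (Omega := Omega) (1 : R); have bX := bfun_comp bh mX.
have : Ex (fun w => 1 + h (X w)) = 1 by rewrite /Ex /Rintegral e.
by rewrite (ExD P b1 bX) Ex_cst; lra.
Qed.

Lemma uniform_cos (X : {RV P >-> R}) : uniform_phase X -> Ex (fun w => cos (X w)) = 0.
Proof.
move=> uX; apply: (uniform_mean0 uX (H := sin)).
- exact: continuous_cos.
- exact: cos_norm.
- by rewrite mulr_natl sin2pi sin0.
Qed.

Lemma uniform_sin (X : {RV P >-> R}) : uniform_phase X -> Ex (fun w => sin (X w)) = 0.
Proof.
move=> uX; have dH (x : R) : is_derive x (1 : R) (fun x => - cos x) (sin x).
  by have := is_deriveN (is_derive_cos x); rewrite opprK.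
apply: (uniform_mean0 uX _ dH).
- exact: continuous_sin.
- exact: sin_norm.
- by rewrite mulr_natl cos2pi cos0.
Qed.

Lemma cfun_expi (a : R) : cfun (fun x => expi (a * x)).
Proof.
have ca : continuous (fun x : R => a * x) by move=> x; apply: cvgM; [exact: cvg_cst|exact: cvg_id].
split; apply: (@continuous_bfun _ 1) => /= x; rewrite ?cos_norm ?sin_norm//.
  by apply: (@continuous_comp _ _ _ (fun x : R => a * x) cos); [exact: ca|exact: continuous_cos].
by apply: (@continuous_comp _ _ _ (fun x : R => a * x) sin); [exact: ca|exact: continuous_sin].
Qed.

Lemma bfunM (f g : R -> R) : bfun f -> bfun g -> bfun (fun x => f x * g x).
Proof.
move=> [mf [C fC]] [mg [C' gC]]; split; first exact: measurable_funM.
by exists (C * C') => w; rewrite normrM ler_pM.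
Qed.

Lemma bfunD (f g : R -> R) : bfun f -> bfun g -> bfun (fun x => f x + g x).
Proof.
move=> [mf [C fC]] [mg [C' gC]]; split; first exact: measurable_funD.
by exists (C + C') => w; apply: le_trans (ler_normD _ _) _; rewrite lerD.
Qed.

Lemma bfunN (f : R -> R) : bfun f -> bfun (fun x => - f x).
Proof.
by move=> [mf [C fC]]; split; [exact: measurable_funN|exists C => w; rewrite normrN].
Qed.

Lemma bfun_cst (c : R) : bfun (fun=> c).
Proof. by split; [exact: measurable_cst|exists `|c|]. Qed.

Lemma cfunM (f g : R -> R[i]) : cfun f -> cfun g -> cfun (fun x => f x * g x).
Proof.
move=> [fr fi] [gr gi]; split.
  by under eq_fun do rewrite ReM; apply: bfunD; [exact: bfunM|apply: bfunN; exact: bfunM].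
by under eq_fun do rewrite ImM; apply: bfunD; exact: bfunM.
Qed.

Lemma cfun_prod (I : Type) (s : seq I) (Q : pred I) (F : I -> R -> R[i]) :
  (forall i, cfun (F i)) -> cfun (fun x => \prod_(i <- s | Q i) F i x).
Proof.
move=> cF; elim: s => [|i s IH].
  by under eq_fun do rewrite big_nil; split; exact: bfun_cst.
under eq_fun do rewrite big_cons; case: (Q i) => //.
exact: cfunM.
Qed.

End uniform_phases.

Section phase_characters.
Context {d : measure_display} {Omega : measurableType d} {R : realType}.
Variable P : probability Omega R.
Variables phi xi : Z2 -> {RV P >-> R}.
Hypothesis phases : random_phases phi xi.

Local Notation Ex := (@Ex d Omega R P).
Local Notation index := (bool * Z2)%type.

Definition phase (i : index) : {RV P >-> R} := if i.1 then phi i.2 else xi i.2.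

Definition z2p (k : Z2) : bool := (0 < k.2) || ((k.2 == 0) && (0 < k.1)).

Lemma z2pP k : Z2plus k <-> z2p k.
Proof.
rewrite /z2p; split=> [[->//|[-> ->]]|/orP[|/andP[/eqP]]]; rewrite ?eqxx ?orbT//; first by left.
by right.
Qed.

Lemma z2pN k : k != 0 -> ~~ z2p k -> z2p (- k).
Proof.
case: k => x y; rewrite /z2p /= -pair_eqE /= => k0.
by move: k0; rewrite !oppr_gt0 oppr_eq0; case: (ltgtP y 0); case: (ltgtP x 0).
Qed.

Definition ineg (i : index) : index := (i.1, - i.2).

Lemma inegK : involutive ineg.
Proof. by case=> b k; rewrite /ineg /= opprK. Qed.

(** Independence is assumed on the half-plane only. Every other phase is, modulo 2 pi, minus the
    phase at the opposite wavenumber, so a character is a function of the phase at [irep i], with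
    the sign [isgn i]. *)
Definition irep (i : index) : index := if z2p i.2 then i else ineg i.

Definition isgn (i : index) : R := if z2p i.2 then 1 else -1.

Definition character (i : index) (w : Omega) : R[i] := expi (phase i w).

Lemma characterN i w : i.2 != 0 -> character (ineg i) w = conjc (character i w).
Proof.
have [_ _ ophi oxi] := phases.
have key j : z2p j.2 -> character (ineg j) w = conjc (character j w).
  case: j => b k /= /z2pP kp; rewrite /character /phase /=.
  case: b => /=; [have [n ->] := ophi k kp w|have [n ->] := oxi k kp w];
  by rewrite expiD expi_2pi mulr1 expiN.
move=> i0; case: (boolP (z2p i.2)) => [|/(z2pN i0) h]; first exact: key.
by have := key (ineg i) h; rewrite inegK => ->; rewrite conjcK.
Qed.

Lemma character_rep i w : i.2 != 0 -> character i w = expi (isgn i * phase (irep i) w).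
Proof.
move=> i0; rewrite /isgn /irep; case: ifP => _; first by rewrite mul1r.
by rewrite mulN1r expiN -/(character (ineg i) w) characterN// conjcK.
Qed.

Lemma irep_Z2plus i : i.2 != 0 -> Z2plus (irep i).2.
Proof. by move=> i0; apply/z2pP; rewrite /irep; case: ifPn => // /z2pN; exact. Qed.

Lemma irep_eq i j : irep i = irep j -> i = j \/ i = ineg j.
Proof.
rewrite /irep; case: ifP => _; case: ifP => _.
- by left.
- by right.
- by move=> <-; right; rewrite inegK.
- by move=> /(can_inj inegK); left.
Qed.

(** The factor at p depends on a uniform phase that is independent of all the other factors, because
    neither p nor its opposite occurs in L; its mean is 0. *)
Lemma Ex_characters_eq0 c p (L : seq index) : p.2 != 0 -> (forall i, i \in L -> i.2 != 0) ->
  p \notin L -> ineg p \notin L ->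
  Ex (fun w => complex.Re (c * \prod_(i <- p :: L) character i w)) = 0.
Proof.
move=> p0 L0 pL npL; have [uni ind _ _] := phases.
pose r := undup (map irep L).
(* All factors of L with the same representative are functions of the same phase, so they are
   collected into one function of it. *)
pose f (i : index) (x : R) : R[i] := if i == irep p then expi (isgn p * x)
  else \prod_(l <- L | irep l == i) expi (isgn l * x).
have pr : irep p \notin r.
  rewrite mem_undup; apply/mapP => -[l lL /irep_eq[pl|pl]]; first by rewrite pl lL in pL.
  by rewrite pl inegK lL in npL.
have cf i : cfun (f i).
  rewrite /f; case: eqP => _; first exact: cfun_expi.
  by apply: cfun_prod => l; exact: cfun_expi.
have -> : (fun w => complex.Re (c * \prod_(i <- p :: L) character i w)) =
    (fun w => complex.Re (cfactor (fun i => phase i) c f (irep p :: r) w)).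
  apply/funext => w; rewrite /cfactor !big_cons; congr (complex.Re (c * (_ * _))).
    by rewrite character_rep// /f eqxx.
  rewrite (eq_big_seq (fun l => expi (isgn l * phase (irep l) w))); last first.
    by move=> l lL; rewrite character_rep// L0.
  rewrite [RHS](eq_big_seq (fun i => \prod_(l <- L | irep l == i) expi (isgn l * phase i w))); last first.
    by move=> i ir; rewrite /f; case: eqP => // ip; rewrite -ip ir in pr.
  rewrite (exchange_big_dep xpredT)//=; apply: eq_big_seq => l lL.
  have lr : irep l \in r by rewrite mem_undup map_f.
  rewrite big_mkcond (bigD1_seq (irep l))//= ?undup_uniq// eqxx big1 ?mulr1// => i il.
  by rewrite eq_sym (negbTE il).
have Dr i : i \in irep p :: r -> Z2plus i.2.
  rewrite inE mem_undup => /orP[/eqP ->|/mapP[l lL ->]]; first exact: irep_Z2plus.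
  by apply: irep_Z2plus; exact: L0.
have up : uniform_phase (phase (irep p)).
  by rewrite /phase; have := uni _ (irep_Z2plus p0) => -[u1 u2]; case: ifP.
have fp x : f (irep p) x = expi (isgn p * x) by rewrite /f eqxx.
apply: (Ex_cfactor_cons ind) => //.
- by rewrite /= pr undup_uniq.
- under eq_fun do rewrite fp; rewrite /expi /= /isgn; case: ifP => _.
    by under eq_fun do rewrite mul1r; exact: uniform_cos.
  by under eq_fun do rewrite mulN1r cosN; exact: uniform_cos.
- under eq_fun do rewrite fp; rewrite /expi /= /isgn; case: ifP => _.
    by under eq_fun do rewrite mul1r; exact: uniform_sin.
  under eq_fun do rewrite mulN1r sinN -mulN1r.
  rewrite ExZ ?uniform_sin ?mulr0//; apply: (@bfun_comp _ _ _ sin).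
    exact: continuous_bfun (@continuous_sin R) (@sin_norm R).
  exact: measurable_funPT.
Qed.

End phase_characters.

(** * Fourth moments of the energy *)

Section complex_random_variables.
Context {d : measure_display} {Omega : measurableType d} {R : realType}.
Implicit Types (Z V : Omega -> R[i]).

Definition cbmeas Z := bmeas (fun w => complex.Re (Z w)) /\ bmeas (fun w => complex.Im (Z w)).

Lemma cbmeas_cst (z : R[i]) : cbmeas (fun=> z).
Proof. by split; exact: bmeas_cst. Qed.

Lemma cbmeasM Z V : cbmeas Z -> cbmeas V -> cbmeas (fun w => Z w * V w).
Proof.
move=> [zr zi] [vr vi]; split.
  by under eq_fun do rewrite ReM; apply: bmeasB; exact: bmeasM.
by under eq_fun do rewrite ImM; apply: bmeasD; exact: bmeasM.
Qed.

Lemma cbmeasD Z V : cbmeas Z -> cbmeas V -> cbmeas (fun w => Z w + V w).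
Proof.
move=> [zr zi] [vr vi]; split.
  by under eq_fun do rewrite ReD; exact: bmeasD.
by under eq_fun do rewrite ImD; exact: bmeasD.
Qed.

Lemma cbmeas_sum (I : Type) (s : seq I) (F : I -> Omega -> R[i]) :
  (forall i, cbmeas (F i)) -> cbmeas (fun w => \sum_(i <- s) F i w).
Proof.
move=> mF; elim: s => [|i s IH].
  by under eq_fun do rewrite big_nil; exact: cbmeas_cst.
by under eq_fun do rewrite big_cons; exact: cbmeasD.
Qed.

Lemma cbmeas_prod (I : Type) (s : seq I) (F : I -> Omega -> R[i]) :
  (forall i, cbmeas (F i)) -> cbmeas (fun w => \prod_(i <- s) F i w).
Proof.
move=> mF; elim: s => [|i s IH].
  by under eq_fun do rewrite big_nil; exact: cbmeas_cst.
by under eq_fun do rewrite big_cons; exact: cbmeasM.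
Qed.

End complex_random_variables.

(** * Polynomials in the characters and the energy fluctuations *)

Section character_polynomials.
Context {d : measure_display} {Omega : measurableType d} {R : realType}.
Variable P : probability Omega R.
Variables phi xi : Z2 -> {RV P >-> R}.
Hypothesis phases : random_phases phi xi.

Local Notation Ex := (@Ex d Omega R P).
Local Notation index := (bool * Z2)%type.
Local Notation ch := (character phi xi).
Implicit Types (S : index -> Prop) (Z V : Omega -> R[i]).

(** The predicate [S] records which characters may occur, which is all that is needed to see that a
    given phase is absent. *)
Definition phasepoly S Z := exists ts : seq (R[i] * seq index),
  (forall t i, t \in ts -> i \in t.2 -> S i) /\
  forall w, Z w = \sum_(t <- ts) t.1 * \prod_(i <- t.2) ch i w.

Lemma phasepoly_cst S z : phasepoly S (fun=> z).
Proof.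
exists [:: (z, [::])]; split; first by move=> t i; rewrite inE => /eqP ->.
by move=> w; rewrite big_seq1 big_nil mulr1.
Qed.

Lemma phasepoly_ch S i : S i -> phasepoly S (ch i).
Proof.
move=> Si; exists [:: (1, [:: i])]; split.
  by move=> t j; rewrite inE => /eqP -> /=; rewrite inE => /eqP ->.
by move=> w; rewrite !big_seq1 mul1r.
Qed.

Lemma phasepolyD S Z V : phasepoly S Z -> phasepoly S V -> phasepoly S (fun w => Z w + V w).
Proof.
move=> [ts [hs e]] [ts' [hs' e']]; exists (ts ++ ts'); split.
  by move=> t i; rewrite mem_cat => /orP[/hs|/hs']; exact.
by move=> w; rewrite big_cat e e'.
Qed.

Lemma phasepolyM S Z V : phasepoly S Z -> phasepoly S V -> phasepoly S (fun w => Z w * V w).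
Proof.
move=> [ts [hs e]] [ts' [hs' e']].
exists [seq (t.1 * t'.1, t.2 ++ t'.2) | t <- ts, t' <- ts']; split.
  move=> t i /allpairsP[[u v] /= [uts vts ->]] /=; rewrite mem_cat => /orP[] h.
    exact: hs uts h.
  exact: hs' vts h.
move=> w; rewrite big_allpairs_dep/= e e' big_distrlr /=; apply: eq_bigr => t _.
by apply: eq_bigr => t' _; rewrite big_cat /=; ring.
Qed.

Lemma phasepoly_sum S (I : eqType) (s : seq I) (F : I -> Omega -> R[i]) :
  (forall i, i \in s -> phasepoly S (F i)) -> phasepoly S (fun w => \sum_(i <- s) F i w).
Proof.
elim: s => [|i s IH] h.
  by under eq_fun do rewrite big_nil; exact: phasepoly_cst.
under eq_fun do rewrite big_cons; apply: phasepolyD; first by apply: h; rewrite mem_head.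
by apply: IH => j js; apply: h; rewrite inE js orbT.
Qed.

Lemma cbmeas_character i : cbmeas (ch i).
Proof.
have mX : measurable_fun [set: Omega] (phase phi xi i) by exact: measurable_funPT.
split; [apply: (@bfun_comp _ _ _ cos _ _ mX)|apply: (@bfun_comp _ _ _ sin _ _ mX)].
  exact: continuous_bfun (@continuous_cos R) (@cos_norm R).
exact: continuous_bfun (@continuous_sin R) (@sin_norm R).
Qed.

Lemma cbmeas_phasepoly S Z : phasepoly S Z -> cbmeas Z.
Proof.
move=> [ts [_ e]]; rewrite (_ : Z = fun w => \sum_(t <- ts) t.1 * \prod_(i <- t.2) ch i w); last exact/funext.
apply: cbmeas_sum => t; apply: cbmeasM; first exact: cbmeas_cst.
by apply: cbmeas_prod => i; exact: cbmeas_character.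
Qed.

Lemma Ex_phasepoly_eq0 p V : p.2 != 0 ->
  phasepoly (fun i => [/\ i.2 != 0, i != p & i != ineg p]) V ->
  Ex (fun w => complex.Re (ch p w * V w)) = 0.
Proof.
move=> p0 [ts [hs e]].
pose F t w := complex.Re (t.1 * \prod_(i <- p :: t.2) ch i w).
have bF t : bmeas (F t).
  have [] // : cbmeas (fun w => t.1 * \prod_(i <- p :: t.2) ch i w).
  apply: cbmeasM; first exact: cbmeas_cst.
  by apply: cbmeas_prod => i; exact: cbmeas_character.
rewrite (_ : (fun w => _) = (fun w => \sum_(t <- ts) F t w)); last first.
  apply/funext => w; rewrite e mulr_sumr Re_sum; apply: eq_bigr => t _.
  by rewrite /F big_cons; congr complex.Re; ring.
rewrite Ex_sum// big_seq big1// => t tts.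
apply: Ex_characters_eq0 => //.
- by move=> i it; have [] := hs t i tts it.
- by apply/negP => /(hs t p tts)[_]; rewrite eqxx.
- by apply/negP => /(hs t _ tts)[_ _]; rewrite eqxx.
Qed.

Variables (M : nat) (J : seq Z2) (c : Z2 -> Z2 -> R).
Hypotheses (JM : {subset J <= box M}) (uJ : uniq J) (J0 : 0 \notin J).

(** Shape of the k-th coefficient of the first correction. The tag [true] marks the phases of the
    velocity, [false] those of the source. *)
Definition amplitude k w : R[i] :=
  \sum_(j <- J) (c k j)%:C * (ch (true, k - j) w * ch (false, j) w).

Definition mean_energy k : R := \sum_(j <- J) c k j ^+ 2.

Definition fluctuation k w : R := cmod2 (amplitude k w) - mean_energy k.

Lemma offdiag_neq0 k j : k \notin box M -> j \in J -> k - j != 0.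
Proof. by move=> kM jJ; rewrite subr_eq0; apply: contraNneq kM => ->; exact: JM. Qed.

Lemma J_neq0 j : j \in J -> j != 0.
Proof. by move=> jJ; apply: contraNneq J0 => <-. Qed.

Definition offdiag : seq (Z2 * Z2) := [seq p <- [seq (i, j) | i <- J, j <- J] | p.1 != p.2].

Lemma offdiagP p : (p \in offdiag) = [&& p.1 \in J, p.2 \in J & p.1 != p.2].
Proof.
case: p => i j; rewrite mem_filter /= andbC andbA; congr andb.
apply/allpairsP/andP => [[[a b] /= [ha hb [-> ->]]]|[hi hj]]; first by split.
by exists (i, j).
Qed.

(** The diagonal terms of |amplitude|^2 are deterministic, characters being unimodular, and cancel
    the mean. That k lies outside [box M] keeps k - j away from 0, where a character and its
    conjugate are not related. *)
Lemma fluctuationE k w : k \notin box M ->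
  (fluctuation k w)%:C = \sum_(p <- offdiag) ch (true, k - p.1) w *
    ((c k p.1 * c k p.2)%:C * (ch (false, p.1) w * (ch (true, p.2 - k) w * ch (false, - p.2) w))).
Proof.
move=> kM.
have conjE j : j \in J -> conjc ((c k j)%:C * (ch (true, k - j) w * ch (false, j) w)) =
    (c k j)%:C * (ch (true, j - k) w * ch (false, - j) w).
  move=> jJ; have h1 := characterN phases w (i := (true, k - j)) (offdiag_neq0 kM jJ).
  have h2 := characterN phases w (i := (false, j)) (J_neq0 jJ).
  rewrite /ineg /= opprB in h1; rewrite /ineg /= in h2.
  by rewrite !conjM h1 h2; congr (_ * _); rewrite /real_complex_def /conjc oppr0.
have chch i : i.2 != 0 -> ch i w * ch (ineg i) w = 1.
  move=> i0; rewrite (characterN phases)// /character /expi /conjc.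
  apply/eqP; rewrite eq_complex /=; apply/andP; split; apply/eqP.
    by rewrite mulrN opprK -!expr2 cos2Dsin2.
  by ring.
have XX : (cmod2 (amplitude k w))%:C = amplitude k w * conjc (amplitude k w).
  rewrite /cmod2; case: (amplitude k w) => a b; rewrite /conjc.
  by apply/eqP; rewrite eq_complex /=; apply/andP; split; apply/eqP; ring.
rewrite /fluctuation rmorphB/= XX {2}/amplitude conj_sum.
rewrite (eq_big_seq (fun j => (c k j)%:C * (ch (true, j - k) w * ch (false, - j) w))); last exact: conjE.
rewrite /amplitude big_distrlr/=.
have -> : \sum_(i <- J) \sum_(j <- J) (c k i)%:C * (ch (true, k - i) w * ch (false, i) w) *
      ((c k j)%:C * (ch (true, j - k) w * ch (false, - j) w)) =
    \sum_(p <- [seq (i, j) | i <- J, j <- J]) ch (true, k - p.1) w *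
    ((c k p.1 * c k p.2)%:C * (ch (false, p.1) w * (ch (true, p.2 - k) w * ch (false, - p.2) w))).
  rewrite big_allpairs /=; apply: eq_bigr => i _; apply: eq_bigr => j _.
  by rewrite rmorphM/=; ring.
rewrite (bigID (fun p => p.1 != p.2))/= -big_filter -/offdiag.
rewrite (_ : \sum_(p <- _ | ~~ _) _ = (mean_energy k)%:C) ?addrK//.
rewrite big_mkcond big_allpairs/= /mean_energy rmorph_sum/=.
rewrite [LHS]big_seq_cond [RHS]big_seq_cond; apply: eq_bigr => i /andP[iJ _].
rewrite (bigD1_seq i)//= eqxx/= big1 ?addr0; last by move=> j ji; rewrite eq_sym ji.
have h1 := chch (true, k - i) (offdiag_neq0 kM iJ); have h2 := chch (false, i) (J_neq0 iJ).
rewrite /ineg /= opprB in h1; rewrite /ineg /= in h2.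
rewrite (_ : _ * _ = (c k i * c k i)%:C * (ch (true, k - i) w * ch (true, i - k) w) * (ch (false, i) w * ch (false, - i) w)); last by ring.
by rewrite h1 h2 !mulr1 expr2.
Qed.

(** The energies at k and l share a velocity phase only if k - i = l - j or k - i = j - l for modes
    i and j, hence only if k - l or k + l is small. *)
Definition near_by (N : nat) (a b : Z2) : bool := (a - b \in box N) || (a + b \in box N).

Lemma boxD N N' a b : a \in box N -> b \in box N' -> a + b \in box (N + N').
Proof.
rewrite !boxP /= => /andP[a1 a2] /andP[b1 b2]; clear -a1 a2 b1 b2.
by apply/andP; split; lia.
Qed.

Lemma boxN N a : (- a \in box N) = (a \in box N).
Proof. by rewrite !boxP /= !abszN. Qed.

Lemma boxB N N' a b : a \in box N -> b \in box N' -> a - b \in box (N + N').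
Proof. by move=> ha hb; apply: boxD => //; rewrite boxN. Qed.

(** A coincidence of k - i with l - a or a - l would put k - l = i - a or k + l = i + a in
    [box (2 * M)]. *)
Lemma phasepoly_fluctuation k l i j : k \notin box M -> l \notin box M -> i \in J -> j \in J -> i != j ->
  ~~ near_by (2 * M) k l ->
  phasepoly (fun x => [/\ x.2 != 0, x != (true, k - i) & x != ineg (true, k - i)]) (fun w => (fluctuation l w)%:C).
Proof.
move=> kM lM iJ jJ ij; rewrite negb_or => /andP[n1 n2].
rewrite (_ : (fun w => _) = (fun w => \sum_(p <- offdiag) ch (true, l - p.1) w *
    ((c l p.1 * c l p.2)%:C * (ch (false, p.1) w * (ch (true, p.2 - l) w * ch (false, - p.2) w))))); last first.
  by apply/funext => w; exact: fluctuationE.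
apply: phasepoly_sum => -[a b]; rewrite offdiagP /= => /and3P[aJ bJ ab].
have iM := JM iJ; have aM := JM aJ; have bM := JM bJ.
rewrite mul2n -addnn in n1 n2.
have sub (x y : Z2) : l - y = k - x -> k - l = x - y.
  by move=> e; rewrite -[k](subrK x) -e; ring.
have add (x y : Z2) : y - l = k - x -> k + l = y + x.
  by move=> e; rewrite -[k](subrK x) -e; ring.
have pe (x y : Z2) (u v : bool) : (u, x) == (v, y) -> x = y by move=> /eqP[_ ->].
apply: phasepolyM; last apply: phasepolyM; last apply: phasepolyM; last apply: phasepolyM.
- apply: phasepoly_ch; split => /=; first exact: offdiag_neq0.
    by apply: contra n1 => /pe e; rewrite (sub _ _ e) boxB.
  apply: contra n2 => /pe /= /(congr1 -%R); rewrite opprK opprB => e.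
  by rewrite (add _ _ e) boxD.
- exact: phasepoly_cst.
- apply: phasepoly_ch; split => //=; exact: J_neq0.
- apply: phasepoly_ch; split => /=; first by rewrite -oppr_eq0 opprB offdiag_neq0.
    by apply: contra n2 => /pe e; rewrite (add _ _ e) boxD.
  apply: contra n1 => /pe /= /(congr1 -%R); rewrite opprK opprB => e.
  by rewrite (sub _ _ e) boxB.
- by apply: phasepoly_ch; split => //=; rewrite oppr_eq0 J_neq0.
Qed.

(* Each term of the first factor contains a phase [phi (k1 - i)] that occurs nowhere else. *)
Lemma Ex_isolated k1 k2 k3 k4 : k1 \notin box M -> k2 \notin box M -> k3 \notin box M -> k4 \notin box M ->
  ~~ near_by (2 * M) k1 k2 -> ~~ near_by (2 * M) k1 k3 -> ~~ near_by (2 * M) k1 k4 ->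
  Ex (fun w => fluctuation k1 w * (fluctuation k2 w * (fluctuation k3 w * fluctuation k4 w))) = 0.
Proof.
move=> m1 m2 m3 m4 n2 n3 n4.
have pe (x y : Z2) (u v : bool) : (u, x) == (v, y) -> x = y by move=> /eqP[_ ->].
pose V p w := (c k1 p.1 * c k1 p.2)%:C * (ch (false, p.1) w * (ch (true, p.2 - k1) w * ch (false, - p.2) w)) *
  ((fluctuation k2 w)%:C * ((fluctuation k3 w)%:C * (fluctuation k4 w)%:C)).
have VS p : p \in offdiag -> phasepoly (fun x => [/\ x.2 != 0, x != (true, k1 - p.1) & x != ineg (true, k1 - p.1)]) (V p).
  case: p => i j; rewrite offdiagP /= => /and3P[iJ jJ ij].
  have iM := JM iJ; have jM := JM jJ.
  apply: phasepolyM; last first.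
    by apply: phasepolyM; last apply: phasepolyM; exact: (phasepoly_fluctuation (j := j)).
  apply: phasepolyM; first exact: phasepoly_cst.
  apply: phasepolyM; last apply: phasepolyM.
  - by apply: phasepoly_ch; split => //=; exact: J_neq0.
  - apply: phasepoly_ch; split => /=; first by rewrite -oppr_eq0 opprB offdiag_neq0.
      (* If the conjugate phase at j - k1 were the phase at k1 - i, then 2 k1 = i + j and k1 would
         lie in [box M]. *)
      apply: contra m1 => /pe e.
      have /(boxD iM) : j \in box M := jM.
      rewrite (_ : i + j = k1 + k1); last first.
        by rewrite -[j](subrK k1) e; ring.
      by rewrite !boxP /= => /andP[b1 b2]; clear -b1 b2; apply/andP; split; lia.
    rewrite /ineg /= opprB; apply: contra ij => /pe /addIr ->.
    exact: eqxx.
  - by apply: phasepoly_ch; split => //=; rewrite oppr_eq0 J_neq0.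
rewrite (_ : (fun w => _) = (fun w => \sum_(p <- offdiag) complex.Re (ch (true, k1 - p.1) w * V p w))); last first.
  apply/funext => w; rewrite -Re_sum.
  transitivity (complex.Re ((fluctuation k1 w)%:C * ((fluctuation k2 w)%:C * ((fluctuation k3 w)%:C * (fluctuation k4 w)%:C)))).
    by rewrite -!rmorphM/=.
  rewrite fluctuationE// mulr_suml; congr complex.Re; apply: eq_bigr => p _.
  by rewrite /V; ring.
have -> : (fun w => \sum_(p <- offdiag) complex.Re (ch (true, k1 - p.1) w * V p w)) =
   (fun w => \sum_(p <- offdiag) (if p \in offdiag then complex.Re (ch (true, k1 - p.1) w * V p w) else 0)).
  by apply/funext => w; apply: eq_big_seq => p ->.
rewrite Ex_sum; last first.
  move=> p; case: (boolP (p \in offdiag)) => ps; last exact: bmeas_cst.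
  by have [] := cbmeasM (cbmeas_character (true, k1 - p.1)) (cbmeas_phasepoly (VS p ps)).
rewrite big_seq big1// => p ps; rewrite ps; apply: Ex_phasepoly_eq0; last exact: VS.
by move: ps; rewrite offdiagP => /and3P[pJ _ _]; rewrite /= offdiag_neq0.
Qed.

End character_polynomials.

Lemma near_by_trans (M : nat) (a b c : Z2) : near_by (2 * M) a b -> near_by (2 * M) a c ->
  near_by (4 * M) b c.
Proof.
rewrite (_ : 4 * M = 2 * M + 2 * M)%N; last by lia.
move=> /orP[h1|h1] /orP[h2|h2]; apply/orP.
- left; have -> : b - c = (a - c) - (a - b) by ring.
  exact: boxB.
- right; have -> : b + c = (a + c) - (a - b) by ring.
  exact: boxB.
- right; have -> : b + c = (a + b) - (a - c) by ring.
  exact: boxB.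
- left; have -> : b - c = (a + b) - (a + c) by ring.
  exact: boxB.
Qed.

Lemma near_by_sym (M : nat) (a b : Z2) : near_by M a b = near_by M b a.
Proof. by rewrite /near_by -[a - b]opprB boxN [a + b]addrC. Qed.

Lemma box_widen (M N : nat) a : (M <= N)%N -> a \in box M -> a \in box N.
Proof.
by move=> MN; rewrite !boxP => /andP[h1 h2]; rewrite (leq_trans h1 MN) (leq_trans h2 MN).
Qed.

Lemma near_by_widen (M N : nat) (a b : Z2) : (M <= N)%N -> near_by M a b -> near_by N a b.
Proof. by move=> MN /orP[] h; apply/orP; [left|right]; exact: box_widen h. Qed.

(* An index with no other one close to it contributes nothing to a fourth moment, by [Ex_isolated];
   hence the contributing quadruples split into two close pairs. *)
Lemma near_by_pairs (M : nat) (a b c d : Z2) (r := near_by (2 * M)) (r2 := near_by (4 * M)) :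
  [|| r a b, r a c | r a d] -> [|| r b a, r b c | r b d] -> [|| r c a, r c b | r c d] ->
  [|| r d a, r d b | r d c] -> [|| r2 a b && r2 c d, r2 a c && r2 b d | r2 a d && r2 b c].
Proof.
have w x y : r x y -> r2 x y by apply: near_by_widen; lia.
have t x y z : r x y -> r x z -> r2 y z by exact: near_by_trans.
have s x y : r x y = r y x by exact: near_by_sym.
rewrite (s b a) (s c a) (s c b) (s d a) (s d b) (s d c).
have := w a b; have := w a c; have := w a d; have := w b c; have := w b d; have := w c d.
have := t a c d; have := t a b d; have := t a b c.
have := t b c d; have := t b a c; have := t b a d; rewrite (s b a).
have := t c a b; have := t c a d; have := t c b d; rewrite (s c a) (s c b).
have := t d a b; have := t d a c; have := t d b c; rewrite (s d a) (s d b) (s d c).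
(* With these instances of the two rules the claim is propositional in the six values of [r] and the
   six of [r2], and is checked by cases. *)
case: (r a b); case: (r a c); case: (r a d); case: (r b c); case: (r b d); case: (r c d) => //=;
by do ?[move=> /(_ isT)]; case: (r2 a b); case: (r2 a c); case: (r2 a d); case: (r2 b c); case: (r2 b d); case: (r2 c d) => //= *;
  repeat match goal with H : is_true true -> is_true true -> is_true false |- _ => by have := H isT isT | H : is_true true -> is_true false |- _ => by have := H isT end.
Qed.

(** * The fourth moment of a sum of fluctuations *)

Section fourth_moment.
Context {d : measure_display} {Omega : measurableType d} {R : realType}.
Variable P : probability Omega R.
Variables phi xi : Z2 -> {RV P >-> R}.
Hypothesis phases : random_phases phi xi.
Variables (M : nat) (J : seq Z2) (c : Z2 -> Z2 -> R).
Hypotheses (JM : {subset J <= box M}) (uJ : uniq J) (J0 : 0 \notin J).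

Local Notation Ex := (@Ex d Omega R P).
Local Notation F := (fluctuation phi xi J c).

Lemma cbmeas_amplitude k : cbmeas (amplitude phi xi J c k).
Proof.
apply: cbmeas_sum => j; apply: cbmeasM; first exact: cbmeas_cst.
by apply: cbmeasM; exact: cbmeas_character.
Qed.

Lemma bmeas_fluctuation k : bmeas (F k).
Proof.
have [ar ai] := cbmeas_amplitude k; apply: bmeasB; last exact: bmeas_cst.
by apply: bmeasD; exact: bmeasX.
Qed.

Lemma count_inj_le (Q s : seq Z2) (f : Z2 -> Z2) : uniq Q -> injective f ->
  \sum_(b <- Q) ((f b \in s)%:R : R) <= (size s)%:R.
Proof.
move=> uQ fi; rewrite (_ : \sum_(b <- Q) _ = (size [seq b <- Q | f b \in s])%:R).
  rewrite ler_nat -(size_map f); apply: uniq_leq_size.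
    by rewrite map_inj_uniq// filter_uniq.
  by move=> x /mapP[b]; rewrite mem_filter => /andP[h _] ->.
elim: Q {uQ} => [|b Q IH]; first by rewrite big_nil.
by rewrite big_cons IH /=; case: (f b \in s); rewrite ?add0r//= nat1r.
Qed.

Definition near_count : R := 2 * (size (box (4 * M)))%:R.

Lemma near_by_row (Q : seq Z2) a : uniq Q ->
  \sum_(b <- Q) ((near_by (4 * M) a b)%:R : R) <= near_count.
Proof.
move=> uQ; apply: (@le_trans _ _ (\sum_(b <- Q) ((a - b \in box (4 * M))%:R + (a + b \in box (4 * M))%:R))).
  by apply: ler_sum => b _; rewrite /near_by; case: (_ \in _); case: (_ \in _); rewrite //= ?addr0 ?add0r// lerDl.
rewrite big_split /near_count mulr2n mulrDl mul1r; apply: lerD; apply: count_inj_le => //.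
by move=> x y /addrI /oppr_inj.
Qed.

Lemma sum4 (Q : seq Z2) (f : Z2 -> R) :
  (\sum_(k <- Q) f k) ^+ 4 =
  \sum_(k1 <- Q) \sum_(k2 <- Q) \sum_(k3 <- Q) \sum_(k4 <- Q) f k1 * (f k2 * (f k3 * f k4)).
Proof.
rewrite !exprS expr0 mulr1 mulr_suml; apply: eq_bigr => k1 _.
rewrite mulr_suml mulr_sumr; apply: eq_bigr => k2 _.
rewrite mulr_suml mulr_sumr mulr_sumr; apply: eq_bigr => k3 _.
by rewrite !mulr_sumr.
Qed.

(** There are three ways to split a quadruple into two pairs, and each wavenumber has at most
    [near_count] neighbours. The growth in the number of points is therefore quadratic, as for
    independent centred variables. *)
Lemma fourth_moment (Q : seq Z2) (B : R) : 0 <= B -> uniq Q ->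
  (forall k, k \in Q -> k \notin box M) -> (forall k w, k \in Q -> `|F k w| <= B) ->
  Ex (fun w => (\sum_(k <- Q) F k w) ^+ 4) <= 3 * (near_count * (size Q)%:R) ^+ 2 * B ^+ 4.
Proof.
move=> B0 uQ QM FB.
pose n a b : R := (near_by (4 * M) a b)%:R.
have bF := bmeas_fluctuation.
have bF4 k1 k2 k3 k4 : bmeas (fun w => F k1 w * (F k2 w * (F k3 w * F k4 w))).
  by do 3 ?[apply: bmeasM => //].
have quad k1 k2 k3 k4 : k1 \in Q -> k2 \in Q -> k3 \in Q -> k4 \in Q ->
    Ex (fun w => F k1 w * (F k2 w * (F k3 w * F k4 w))) <=
    (n k1 k2 * n k3 k4 + n k1 k3 * n k2 k4 + n k1 k4 * n k2 k3) * B ^+ 4.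
  move=> q1 q2 q3 q4.
  have npos : 0 <= (n k1 k2 * n k3 k4 + n k1 k3 * n k2 k4 + n k1 k4 * n k2 k3) * B ^+ 4.
    by rewrite mulr_ge0 ?exprn_ge0// !addr_ge0// mulr_ge0.
  have iso a b c' d' : a \in Q -> b \in Q -> c' \in Q -> d' \in Q ->
      ~~ [|| near_by (2 * M) a b, near_by (2 * M) a c' | near_by (2 * M) a d'] ->
      Ex (fun w => F a w * (F b w * (F c' w * F d' w))) = 0.
    move=> qa qb qc qd /norP[n1 /norP[n2 n3]].
    by apply: (Ex_isolated phases c JM uJ J0 (QM _ qa) (QM _ qb) (QM _ qc) (QM _ qd) n1 n2 n3).
  have [h1|/(iso _ _ _ _ q1 q2 q3 q4) ->//] := boolP [|| near_by (2 * M) k1 k2, near_by (2 * M) k1 k3 | near_by (2 * M) k1 k4].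
  have [h2|/(iso _ _ _ _ q2 q1 q3 q4) e] := boolP [|| near_by (2 * M) k2 k1, near_by (2 * M) k2 k3 | near_by (2 * M) k2 k4]; last first.
    by rewrite (_ : (fun w => _) = (fun w => F k2 w * (F k1 w * (F k3 w * F k4 w)))) ?e//; apply/funext => w; ring.
  have [h3|/(iso _ _ _ _ q3 q1 q2 q4) e] := boolP [|| near_by (2 * M) k3 k1, near_by (2 * M) k3 k2 | near_by (2 * M) k3 k4]; last first.
    by rewrite (_ : (fun w => _) = (fun w => F k3 w * (F k1 w * (F k2 w * F k4 w)))) ?e//; apply/funext => w; ring.
  have [h4|/(iso _ _ _ _ q4 q1 q2 q3) e] := boolP [|| near_by (2 * M) k4 k1, near_by (2 * M) k4 k2 | near_by (2 * M) k4 k3]; last first.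
    by rewrite (_ : (fun w => _) = (fun w => F k4 w * (F k1 w * (F k2 w * F k3 w)))) ?e//; apply/funext => w; ring.
  apply: (@le_trans _ _ (B ^+ 4)).
    apply: le_trans (ler_norm _) _; apply: Ex_norm_le => // w.
    rewrite !normrM !exprS expr0 mulr1.
    by do 3 ?[apply: ler_pM; rewrite ?mulr_ge0//; try exact: FB].
  rewrite ler_peMl ?exprn_ge0//.
  have := near_by_pairs h1 h2 h3 h4.
  have p12 : 0 <= n k1 k2 * n k3 k4 by rewrite mulr_ge0.
  have p13 : 0 <= n k1 k3 * n k2 k4 by rewrite mulr_ge0.
  have p14 : 0 <= n k1 k4 * n k2 k3 by rewrite mulr_ge0.
  move: p12 p13 p14; rewrite /n => p12 p13 p14.
  have t1 : true%:R = 1 :> R by [].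
  by case/or3P => /andP[-> ->]; rewrite t1 mulr1 ?t1; lra.
rewrite (_ : (fun w => _) = (fun w => \sum_(k1 <- Q) \sum_(k2 <- Q) \sum_(k3 <- Q) \sum_(k4 <- Q)
   F k1 w * (F k2 w * (F k3 w * F k4 w)))); last by apply/funext => w; rewrite sum4.
have b3 k1 k2 k3 : bmeas (fun w => \sum_(k4 <- Q) F k1 w * (F k2 w * (F k3 w * F k4 w))).
  by apply: bmeas_sum.
have b2 k1 k2 : bmeas (fun w => \sum_(k3 <- Q) \sum_(k4 <- Q) F k1 w * (F k2 w * (F k3 w * F k4 w))).
  by apply: bmeas_sum.
have b1 k1 : bmeas (fun w => \sum_(k2 <- Q) \sum_(k3 <- Q) \sum_(k4 <- Q) F k1 w * (F k2 w * (F k3 w * F k4 w))).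
  by apply: bmeas_sum.
rewrite Ex_sum//; under eq_bigr do rewrite Ex_sum//.
under eq_bigr do under eq_bigr do rewrite Ex_sum//.
under eq_bigr do under eq_bigr do under eq_bigr do rewrite Ex_sum//.
apply: (@le_trans _ _ (\sum_(k1 <- Q) \sum_(k2 <- Q) \sum_(k3 <- Q) \sum_(k4 <- Q)
    (n k1 k2 * n k3 k4 + n k1 k3 * n k2 k4 + n k1 k4 * n k2 k3) * B ^+ 4)).
  by do 4 ![rewrite [leLHS]big_seq [leRHS]big_seq; apply: ler_sum => ? ?]; exact: quad.
pose S := \sum_(a <- Q) \sum_(b <- Q) n a b.
have S0 : 0 <= S by rewrite sumr_ge0// => a _; rewrite sumr_ge0.
have SD : S <= near_count * (size Q)%:R.
  apply: (@le_trans _ _ (\sum_(a <- Q) near_count)); first by apply: ler_sum => a _; exact: near_by_row.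
  by rewrite big_const_seq count_predT iter_addr_0 mulr_natr.
have e : \sum_(k1 <- Q) \sum_(k2 <- Q) \sum_(k3 <- Q) \sum_(k4 <- Q)
    (n k1 k2 * n k3 k4 + n k1 k3 * n k2 k4 + n k1 k4 * n k2 k3) * B ^+ 4 = 3 * S ^+ 2 * B ^+ 4.
  have s1 : \sum_(k1 <- Q) \sum_(k2 <- Q) \sum_(k3 <- Q) \sum_(k4 <- Q) n k1 k2 * n k3 k4 = S ^+ 2.
    rewrite expr2 {1}/S mulr_suml; apply: eq_bigr => k1 _; rewrite mulr_suml; apply: eq_bigr => k2 _.
    by rewrite /S mulr_sumr; apply: eq_bigr => k3 _; rewrite mulr_sumr.
  have s2 : \sum_(k1 <- Q) \sum_(k2 <- Q) \sum_(k3 <- Q) \sum_(k4 <- Q) n k1 k3 * n k2 k4 = S ^+ 2.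
    by rewrite -s1; apply: eq_bigr => k1 _; rewrite exchange_big.
  have s3 : \sum_(k1 <- Q) \sum_(k2 <- Q) \sum_(k3 <- Q) \sum_(k4 <- Q) n k1 k4 * n k2 k3 = S ^+ 2.
    rewrite -s2; apply: eq_bigr => k1 _; apply: eq_bigr => k2 _; rewrite exchange_big/=.
    by apply: eq_bigr => k3 _; apply: eq_bigr.
  under eq_bigr do under eq_bigr do under eq_bigr do rewrite -mulr_suml.
  under eq_bigr do under eq_bigr do rewrite -mulr_suml.
  under eq_bigr do rewrite -mulr_suml.
  rewrite -mulr_suml; congr (_ * _).
  under eq_bigr do under eq_bigr do under eq_bigr do rewrite !big_split/=.
  under eq_bigr do under eq_bigr do rewrite !big_split/=.
  under eq_bigr do rewrite !big_split/=.
  by rewrite !big_split/= s1 s2 s3; ring.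
rewrite e ler_wpM2r ?exprn_ge0// ler_wpM2l// ler_pXn2r ?nnegrE//.
exact: le_trans S0 SD.
Qed.

End fourth_moment.

(** * Lattice points in a disc *)

Section circle_problem.
Context {R : realType}.

Definition annulus (a b : nat) : seq Z2 := [seq k <- box b | (a <= nsq k < b)%N].

Lemma annulusP a b k : (k \in annulus a b) = (a <= nsq k < b)%N.
Proof.
rewrite mem_filter; case: (boolP (a <= nsq k < b)%N) => //= /andP[_ kb].
have le_sq (n : nat) : (n <= n ^ 2)%N by case: n => // n; rewrite -{1}[n.+1]expn1 leq_pexp2l.
rewrite boxP; apply/andP; split; apply: leq_trans (le_sq _) _;
  apply: leq_trans (ltnW kb); rewrite /nsq; lia.
Qed.

Lemma annulus_uniq a b : uniq (annulus a b).
Proof. by rewrite filter_uniq// box_uniq. Qed.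

Lemma sum_annulus_cat (F : Z2 -> R) a b c : (a <= b)%N -> (b <= c)%N ->
  \sum_(k <- annulus a c) F k = \sum_(k <- annulus a b) F k + \sum_(k <- annulus b c) F k.
Proof.
move=> ab bc; rewrite -big_cat; apply: perm_big; apply: uniq_perm.
- exact: annulus_uniq.
- rewrite cat_uniq !annulus_uniq/= andbT; apply/hasPn => k; rewrite !annulusP => /andP[h _].
  by rewrite ltnNge h andbF.
move=> k; rewrite mem_cat !annulusP.
by case: (leqP b (nsq k)) => h; apply/idP/idP => [/andP[]|/orP[]/andP[]] *; lia.
Qed.

Definition disc_count n : R := (size (annulus 0 n))%:R.

Lemma size_annulus a b : (a <= b)%N -> (size (annulus a b))%:R = disc_count b - disc_count a.
Proof.
have sz (s : seq Z2) : (size s)%:R = \sum_(k <- s) 1 :> R.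
  by rewrite big_const_seq count_predT iter_addr_0.
by move=> ab; rewrite /disc_count !sz (sum_annulus_cat (fun=> 1) (leq0n a) ab) addrAC subrr add0r.
Qed.

Lemma zrange_sum (g : nat -> R) n : \sum_(x <- zrange n) g `|x|%N = g 0%N + 2 * \sum_(1 <= i < n.+1) g i.
Proof.
rewrite big_cat !big_map /= big_cons -addrA mulr2n mulrDl mul1r; congr (_ + (_ + _)).
  by rewrite /index_iota subSS subn0.
by rewrite /index_iota subSS subn0 -[1%N]addn0 iotaDl big_map.
Qed.

(** The count is the q with q^2 < m <= (q+1)^2. It is centred at sqrt m - 1/2 so that 1 + 2 q, the
    number of integers of both signs with square below m, is within 1 of 2 sqrt m. *)
Lemma count_squares (m n : nat) : (0 < m)%N -> (m <= n)%N ->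
  `|(\sum_(1 <= j < n.+1) ((j ^ 2 < m)%N%:R : R)) - (Num.sqrt (m%:R) - 2^-1)| <= 2^-1.
Proof.
move=> m0 mn.
have [q /andP[q1 q2]] : exists q, (q ^ 2 < m <= q.+1 ^ 2)%N.
  elim: m m0 {mn} => // -[_ _|m IH _]; first by exists 0%N.
  have [q /andP[h1 h2]] := IH isT.
  have [h|h] := leqP m.+2 (q.+1 ^ 2); first by exists q; lia.
  by exists q.+1; rewrite h/= (leq_trans (_ : _ <= (q.+1 ^ 2).+1)%N)//; nia.
have qn : (q <= n)%N by apply: leq_trans mn; nia.
have -> : \sum_(1 <= j < n.+1) ((j ^ 2 < m)%N%:R : R) = q%:R.
  rewrite (@big_cat_nat _ _ _ q.+1)//= big_nat (eq_bigr (fun=> 1)); last first.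
    move=> i /andP[_ iq]; rewrite (_ : (i ^ 2 < m)%N = true)//.
    by apply: leq_ltn_trans q1; rewrite leq_sqr.
  rewrite -big_nat sumr_const_nat subn1/= [X in _ + X]big_nat big1 ?addr0// => i /andP[qi _].
  rewrite (_ : (i ^ 2 < m)%N = false)//; apply/negbTE; rewrite -leqNgt.
  by apply: leq_trans q2 _; rewrite leq_sqr.
have s1 : q%:R <= Num.sqrt (m%:R : R).
  by rewrite -[q%:R]ger0_norm// -sqrtr_sqr ler_sqrt// -natrX ler_nat ltnW.
have s2 : Num.sqrt (m%:R : R) <= q%:R + 1.
  by rewrite natr1 -[q.+1%:R]ger0_norm// -sqrtr_sqr ler_sqrt ?sqr_ge0// -natrX ler_nat.
by rewrite ler_norml; apply/andP; split; lra.
Qed.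

(* [x + sin x * cos x] is the area of the part [0 <= s <= sin x] of the unit disc. *)
Lemma quarter_area_step (x y : R) : 0 <= x -> x <= y -> y <= pi / 2 ->
  2 * cos y * (sin y - sin x) <= (y + sin y * cos y) - (x + sin x * cos x) <=
  2 * cos x * (sin y - sin x).
Proof.
move=> x0 xy y2.
have dK (a z : R) : is_derive z 1 (fun t : R => 2 * a * sin t - (t + sin t * cos t))
    (2 * (a - cos z) * cos z).
  apply: is_derive_eq; rewrite /GRing.scale /=.
  by have := cos2Dsin2 z; rewrite !expr2; nra.
have cK a : {within `[x, y], continuous (fun t : R => 2 * a * sin t - (t + sin t * cos t))}.
  by apply: derivable_within_continuous => z _; have [] := dK a z.
have [c1 + e1] := MVT_segment xy (fun z _ => dK (cos x) z) (cK (cos x)).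
have [c2 + e2] := MVT_segment xy (fun z _ => dK (cos y) z) (cK (cos y)).
rewrite !in_itv/= => /andP[h3 h4] /andP[h1 h2].
have cle (a b : R) : 0 <= a -> a <= b -> b <= pi / 2 -> cos b <= cos a.
  move=> a0 ab b2; have p0 := pi_gt0 R.
  by rewrite leNgt ltr_cos ?in_itv/= -?leNgt//; lra.
have cge (z : R) : 0 <= z -> z <= pi / 2 -> 0 <= cos z.
  by move=> z0 z2; apply: cos_ge0_pihalf; rewrite z2 (le_trans _ z0)// oppr_le0 divr_ge0// pi_ge0.
have q1 := cle x c1 x0 h1 ltac:(lra); have q2 := cle c2 y ltac:(lra) h4 y2.
have p1 := cge c1 ltac:(lra) ltac:(lra); have p2 := cge c2 ltac:(lra) ltac:(lra).
have r1 : 0 <= 2 * (cos x - cos c1) * cos c1 * (y - x).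
  by rewrite !mulr_ge0//; lra.
have r2 : 0 <= 2 * (cos c2 - cos y) * cos c2 * (y - x).
  by rewrite !mulr_ge0//; lra.
by apply/andP; split; lra.
Qed.

(** Lower and upper Riemann sums, with step 1, for twice the area of a quarter of the disc of radius
    sqrt n. Telescoping the areas G i of vertical strips replaces the integral. *)
Lemma sum_sqrt_quarter n : (0 < n)%N ->
  \sum_(1 <= i < n.+1) 2 * Num.sqrt (n%:R - i%:R ^+ 2) <= n%:R * (pi / 2) :> R /\
  n%:R * (pi / 2) <=
  \sum_(0 <= i < n) 2 * Num.sqrt (n%:R - i%:R ^+ 2) :> R.
Proof.
move=> n0; set s : R := Num.sqrt n%:R.
have s0 : 0 < s by rewrite sqrtr_gt0 ltr0n.
have s2 : s ^+ 2 = n%:R by rewrite sqr_sqrtr.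
(* The sums run past i = sqrt n; clipping at 1 matches the value 0 of [Num.sqrt] at negative
   arguments. *)
pose x (i : nat) : R := Num.min 1 (i%:R / s).
have x01 i : 0 <= x i <= 1 by rewrite ge_min lexx le_min ler01 divr_ge0// ltW.
have xi i : -1 <= x i <= 1 by have := x01 i; lra.
pose t i : R := asin (x i).
have st i : sin (t i) = x i by apply: asinK; rewrite in_itv/= xi.
have ct i : s * cos (t i) = Num.sqrt (n%:R - i%:R ^+ 2).
  rewrite /t cos_asin// /x /Num.min; case: ifP => h.
    rewrite expr1n subrr sqrtr0 mulr0 ler0_sqrtr// subr_le0.
    by move: h; rewrite ltr_pdivlMr// mul1r -s2 => /ltW h; rewrite ler_pXn2r ?nnegrE// ltW.
  by rewrite {1}/s -sqrtrM// mulrBr mulr1 expr_div_n s2 mulrCA divff ?mulr1// gt_eqF// ltr0n.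
have tpi i : t i \in `[- (pi / 2), pi / 2]%R by rewrite in_itv/= asin_geNpi2 ?asin_lepi2.
have p0 := pi_gt0 R.
have t0 : 0 \in `[- (pi / 2), pi / 2 :> R]%R by rewrite in_itv/=; lra.
have t01 i : 0 <= t i <= pi / 2.
  rewrite asin_lepi2 ?xi// andbT leNgt; apply/negP; rewrite -ltr_sin// st sin0.
  by have := x01 i; lra.
have xmon i : x i <= x i.+1.
  rewrite le_min ge_min lexx/= ge_min; apply/orP; right.
  by rewrite ler_pM2r ?invr_gt0// ler_nat.
have tmon i : t i <= t i.+1.
  by rewrite leNgt -ltr_sin// !st -leNgt.
pose G i : R := n%:R * (t i + sin (t i) * cos (t i)).
have G0 : G 0%N = 0.
  rewrite /G st /t /x mul0r min_r ?ler01// -[X in asin X]sin0 sinK ?mul0r ?addr0 ?mulr0//.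
have Gn : G n = n%:R * (pi / 2).
  have xn : x n = 1.
    rewrite /x min_l// -s2 expr2 mulfK ?gt_eqF//.
    by rewrite /s -[leLHS]sqrtr1 ler_sqrt// ler1n.
  have a1 : asin 1 = pi / 2 :> R by rewrite -[X in asin X]sin_pihalf sinK// in_itv/=; lra.
  by rewrite /G /t xn a1 cos_pihalf mulr0 addr0.
have up i : 2 * Num.sqrt (n%:R - i.+1%:R ^+ 2) <= G i.+1 - G i.
  have /andP[_ b] := t01 i.+1; have /andP[a _] := t01 i.
  have /andP[h _] := quarter_area_step a (tmon i) b.
  rewrite -ct /G -mulrBr -s2; apply: le_trans (ler_wpM2l (sqr_ge0 _) h).
  rewrite !st (_ : s ^+ 2 * _ = 2 * (s * cos (t i.+1)) * (s * (x i.+1 - x i))); last by ring.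
  have [le1|lt1] := leP (i.+1%:R / s) 1.
    have -> : s * (x i.+1 - x i) = 1; last by rewrite mulr1.
    rewrite /x !min_r//; last first.
      by apply: le_trans le1; rewrite ler_pM2r ?invr_gt0// ler_nat.
    by rewrite -[i.+1%:R]natr1; field; rewrite gt_eqF.
  rewrite ct ler0_sqrtr ?mulr0 ?mul0r// subr_le0.
  by move: lt1; rewrite ltr_pdivlMr// mul1r -s2 => /ltW lt1; rewrite ler_pXn2r ?nnegrE// ltW.
have down i : G i.+1 - G i <= 2 * Num.sqrt (n%:R - i%:R ^+ 2).
  have /andP[_ b] := t01 i.+1; have /andP[a _] := t01 i.
  have /andP[_ h] := quarter_area_step a (tmon i) b.
  rewrite -ct /G -mulrBr -s2; apply: le_trans (ler_wpM2l (sqr_ge0 _) h) _.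
  rewrite !st (_ : s ^+ 2 * _ = 2 * (s * cos (t i)) * (s * (x i.+1 - x i))); last by ring.
  rewrite ler_piMr//; first by rewrite mulr_ge0// ct sqrtr_ge0.
  rewrite mulrC -ler_pdivlMr// mul1r.
  rewrite /x /Num.min; case: ltP => h1; case: ltP => h2; rewrite ?subrr ?invr_ge0 ?(ltW s0)//.
  - move: h1; rewrite -natr1 mulrDl mul1r; lra.
  - by have : i%:R / s <= i.+1%:R / s; [rewrite ler_pM2r ?invr_gt0// ler_nat|lra].
  - by rewrite -natr1 mulrDl mul1r; lra.
have tel : \sum_(0 <= i < n) (G i.+1 - G i) = n%:R * (pi / 2).
  by rewrite telescope_sumr// G0 subr0 Gn.
split; rewrite -tel; last by apply: ler_sum => i _; exact: down.
by rewrite big_add1/=; apply: ler_sum => i _; exact: up.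
Qed.

(** Points are counted by columns: a column that meets the disc is off by at most 1, there are
    O(sqrt n) of them, and the Riemann sum is off by at most its first term 2 sqrt n. Both errors
    are doubled by symmetry. *)
Lemma disc_count_le n : `|disc_count n - pi * n%:R| <= 6 * Num.sqrt n%:R.
Proof.
have [->|n0] := posnP n.
  rewrite mulr0 subr0 sqrtr0 mulr0 /disc_count.
  by rewrite (_ : annulus 0 0 = [::]) ?normr0//; apply/eqP; rewrite -has_filter; apply/hasPn => k _; rewrite ltn0.
pose F i : R := 2 * Num.sqrt (n%:R - i%:R ^+ 2).
have e : disc_count n = \sum_(x <- zrange n) \sum_(y <- zrange n) ((`|x| ^ 2 + `|y| ^ 2 < n)%N%:R : R).
  rewrite /disc_count /annulus size_filter -sum1_count natr_sum big_mkcond/= /box.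
  by rewrite big_allpairs; apply: eq_bigr => x _; apply: eq_bigr => y _; rewrite /nsq /=; case: ltnP.
pose c i : R := \sum_(y <- zrange n) ((i ^ 2 + `|y| ^ 2 < n)%N%:R : R).
have ce i : `|c i - F i| <= (i ^ 2 < n)%N%:R.
  rewrite /c (zrange_sum (fun y => (i ^ 2 + y ^ 2 < n)%N%:R)) addn0 /F.
  case: (ltnP (i ^ 2) n) => h.
    have := @count_squares (n - i ^ 2) n; rewrite subn_gt0 h leq_subr => /(_ isT isT).
    rewrite natrB ?(ltnW h)// natrX; under eq_bigr do rewrite ltn_subRL.
    have t1 : true%:R = 1 :> R by [].
    by rewrite t1 !ler_norml => /andP[h1 h2]; apply/andP; split; lra.
  rewrite ler0_sqrtr; last by rewrite subr_le0 -natrX ler_nat.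
  rewrite big1 ?mulr0 ?addr0 ?subr0 ?normr0// => j _.
  by rewrite (_ : (i ^ 2 + j ^ 2 < n)%N = false)//; apply/negbTE; rewrite -leqNgt (leq_trans h)// leq_addr.
have cnt : \sum_(1 <= i < n.+1) ((i ^ 2 < n)%N%:R : R) <= Num.sqrt n%:R.
  by have := @count_squares n n n0 (leqnn n); rewrite ler_norml => /andP[]; lra.
have s1 : 1 <= Num.sqrt n%:R :> R by rewrite -[leLHS]sqrtr1 ler_sqrt// ler1n.
have eF : F 0%N = 2 * Num.sqrt n%:R by rewrite /F expr0n subr0.
rewrite e (zrange_sum c) -/(c 0%N).
have d0 : `|c 0%N - F 0%N| <= 1 by have := ce 0%N; rewrite n0.
have d1 : `|\sum_(1 <= i < n.+1) c i - \sum_(1 <= i < n.+1) F i| <= Num.sqrt n%:R.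
  rewrite -sumrB; apply: le_trans (ler_norm_sum _ _ _) (le_trans _ cnt).
  by apply: ler_sum => i _; exact: ce.
have [a1 a2] := sum_sqrt_quarter n0; rewrite -/(F _) in a1 a2.
have a3 : \sum_(0 <= i < n) F i <= F 0%N + \sum_(1 <= i < n.+1) F i.
  by rewrite big_ltn// lerD2l [leRHS]big_nat_recr//= lerDl mulr_ge0// sqrtr_ge0.
move: d0 d1; rewrite !ler_norml => /andP[? ?] /andP[? ?].
rewrite -/(\sum_(1 <= i < n.+1) F i) in a1.
rewrite -/(\sum_(0 <= i < n) F i) in a2.
by apply/andP; split; lra.
Qed.

End circle_problem.

(** * From sums over annuli to integrals *)

Section band_sums.
Context {R : realType}.

(** Summation by parts puts the decrements of h on the partial sums of d; their total, together with
    the last weight, telescopes to h a. *)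
Lemma abel_bound (h d : nat -> R) (D : R) a b : (a <= b)%N -> 0 <= D ->
  (forall n, (a <= n)%N -> 0 <= h n.+1 <= h n) -> 0 <= h a ->
  (forall m, (a <= m <= b)%N -> `|\sum_(a <= n < m) d n| <= D) ->
  `|\sum_(a <= n < b) h n * d n| <= h a * D.
Proof.
move=> ab D0 hmon ha dD.
pose S m := \sum_(a <= n < m) d n.
have e : \sum_(a <= n < b) h n * d n = h b * S b + \sum_(a <= n < b) (h n - h n.+1) * S n.+1.
  elim: b ab {dD} => [|b IH] ab.
    by move: ab; rewrite leqn0 => /eqP ->; rewrite /S !big_geq// mulr0 addr0.
  have [e|ne] := eqVneq a b.+1; first by rewrite /S e !big_geq ?mulr0 ?addr0.
  have ab' : (a <= b)%N by lia.
  by rewrite !big_nat_recr//= IH// /S big_nat_recr//=; ring.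
have tel : h b * D + \sum_(a <= n < b) (h n - h n.+1) * D = h a * D.
  rewrite -mulr_suml (_ : \sum_(a <= n < b) _ = h a - h b); first by ring.
  rewrite -[RHS]opprB -telescope_sumr// -sumrN; apply: eq_bigr => n _; ring.
have hb : 0 <= h b.
  have [->//|ne] := eqVneq b a; have [|? _] := andP (hmon b.-1 _); first lia.
  by rewrite -(ltn_predK (_ : a < b)%N)//; lia.
rewrite e -tel; apply: le_trans (ler_normD _ _) _; apply: lerD.
  by rewrite normrM ger0_norm// ler_wpM2l// dD// ab leqnn.
apply: le_trans (ler_norm_sum _ _ _) _; rewrite big_nat [leRHS]big_nat.
apply: ler_sum => n /andP[an nb]; have /andP[h1 h2] := hmon n an.
by rewrite normrM ger0_norm ?subr_ge0// ler_wpM2l ?subr_ge0// dD// (leqW an).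
Qed.

Lemma annulus_layers (h : nat -> R) a b : (a <= b)%N ->
  \sum_(k <- annulus a b) h (nsq k) =
  \sum_(a <= n < b) h n * (disc_count n.+1 - disc_count n).
Proof.
elim: b => [|b IH] ab.
  by move: ab; rewrite leqn0 => /eqP ->; rewrite big_geq// big_seq big1.
have [->|ne] := eqVneq a b.+1.
  rewrite big_geq// big_seq big1// => k; rewrite annulusP; lia.
have ab' : (a <= b)%N by lia.
rewrite (sum_annulus_cat _ ab' (leqnSn b)) IH// big_nat_recr//=; congr (_ + _).
rewrite -size_annulus// -sum1_size natr_sum mulr_sumr big_seq [RHS]big_seq.
apply: eq_bigr => k; rewrite annulusP mulr1 => kb; congr h; lia.
Qed.

(** The layer |k|^2 = n has pi points on average. The partial sums of the deviations are differences
    of errors in the circle problem, each at most 6 sqrt b, so the irregularity of single layers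
    does no harm. *)
Lemma annulus_sum_integral (h : nat -> R) a b : (a <= b)%N -> 0 <= h a ->
  (forall n, (a <= n)%N -> 0 <= h n.+1 <= h n) ->
  `|\sum_(k <- annulus a b) h (nsq k) - pi * \sum_(a <= n < b) h n| <=
  h a * (12 * Num.sqrt b%:R).
Proof.
move=> ab ha hmon.
rewrite annulus_layers// mulr_sumr -sumrB.
rewrite (eq_bigr (fun n => h n * (disc_count n.+1 - disc_count n - pi))); last first.
  by move=> n _; ring.
apply: abel_bound => // m /andP[am mb].
rewrite sumrB telescope_sumr// sumr_const_nat -[pi *+ _]mulr_natr natrB//.
have := disc_count_le (R:=R) m; have := disc_count_le (R:=R) a.
have s1 : Num.sqrt a%:R <= Num.sqrt b%:R :> R by rewrite ler_sqrt ?ler_nat.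
have s2 : Num.sqrt m%:R <= Num.sqrt b%:R :> R by rewrite ler_sqrt ?ler_nat.
by rewrite !ler_norml => /andP[? ?] /andP[? ?]; apply/andP; split; lra.
Qed.

Lemma sum_powR_integral (b : R) m n : b < 0 -> (0 < m)%N -> (m <= n)%N ->
  (n%:R `^ b - m%:R `^ b) / b <= \sum_(m <= i < n) (i%:R : R) `^ (b - 1) <=
  (n%:R `^ b - m%:R `^ b) / b + m%:R `^ (b - 1).
Proof.
move=> b0 m0 mn.
have step i : (m <= i)%N -> i.+1%:R `^ (b - 1) <= (i.+1%:R `^ b - (i%:R : R) `^ b) / b <= i%:R `^ (b - 1).
  move=> mi; have i0 : 0 < (i%:R : R) by rewrite ltr0n (leq_trans m0).
  have le1 : i%:R <= i.+1%:R :> R by rewrite ler_nat.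
  have [c /andP[c1 c2] ->] := powR_MVT b i0 le1.
  have -> : i.+1%:R - i%:R = 1 :> R by rewrite -natr1; ring.
  rewrite mulr1 mulrAC mulfV ?mul1r ?lt_eqF//.
  by rewrite !powR_antitone//; lra.
have tel : \sum_(m <= i < n) ((i.+1%:R `^ b - (i%:R : R) `^ b) / b) = (n%:R `^ b - m%:R `^ b) / b.
  by rewrite -mulr_suml telescope_sumr.
rewrite -tel; apply/andP; split.
  by rewrite big_nat [leRHS]big_nat; apply: ler_sum => i /andP[/step/andP[]].
apply: (@le_trans _ _ (\sum_(m <= i < n.+1) i%:R `^ (b - 1))).
  by rewrite big_nat_recr//= lerDl powR_ge0.
rewrite big_ltn// addrC lerD2r big_add1/= big_nat [leRHS]big_nat.
by apply: ler_sum => i /andP[/step/andP[]].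
Qed.

Lemma nat_ceil (x : R) : 0 <= x -> exists2 n, x <= n%:R < x + 1 & forall m, (x <= m%:R) = (n <= m)%N.
Proof.
move=> x0.
have [n /andP[n1 n2]] : exists n, x <= n%:R < x + 1.
  have /andP[h1 h2] := truncn_itv x0.
  have [e|ne] := eqVneq (Num.truncn x)%:R x.
    by exists (Num.truncn x); rewrite e lexx ltrDl ltr01.
  exists (Num.truncn x).+1; rewrite ltW//= -natr1 ltrD2r lt_neqAle ne//.
exists n; first by rewrite n1.
move=> m; apply/idP/idP => [xm|nm]; last by apply: le_trans n1 _; rewrite ler_nat.
by rewrite -ltnS -(ltr_nat R) -natr1; lra.
Qed.

Lemma kn_powR k (r : R) : (knorm k : R) `^ (2 * r) = ((nsq k)%:R : R) `^ r.
Proof. by rewrite -kn_nsq -powR_mulrn ?kn_ge0// -powRrM. Qed.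

(** As |k|^2 is an integer, a band with real ends is the annulus between the ceilings of kappa^2 and
    4 kappa^2. *)
Lemma band_annulus (kappa : R) : 1 <= kappa -> exists a b,
  [/\ (0 < a)%N, (a <= b)%N, kappa ^+ 2 <= a%:R < kappa ^+ 2 + 1,
      4 * kappa ^+ 2 <= b%:R < 4 * kappa ^+ 2 + 1 &
      forall k, (k \in annulus a b) = (kappa <= knorm k < 2 * kappa)].
Proof.
move=> k1; have k2 : 1 <= kappa ^+ 2 by rewrite expr_ge1//; lra.
have [a /andP[a1 a2] ha] := @nat_ceil (kappa ^+ 2) ltac:(lra).
have [b /andP[b1 b2] hb] := @nat_ceil (4 * kappa ^+ 2) ltac:(lra).
have a0 : (0 < a)%N by rewrite -(ltr_nat R); lra.
have ab : (a <= b)%N by rewrite -ha; lra.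
exists a, b; rewrite a1 b1; split => // k; rewrite annulusP -ha [in LHS]ltnNge -hb -ltNge -kn_nsq.
congr andb.
  by rewrite ler_pXn2r ?nnegrE ?kn_ge0//; lra.
rewrite (_ : 4 * kappa ^+ 2 = (2 * kappa) ^+ 2); last by rewrite exprMn -natrX.
by rewrite ltr_pXn2r ?nnegrE ?kn_ge0//; lra.
Qed.

(** In the variable r = |k|^2 the lattice has density pi, and the main term is pi times the integral
    of r^(b-1) from kappa^2 to 4 kappa^2. The constant 36 is 12 times 3, from sqrt n <= 3 kappa; 6
    pi covers the passage from sum to integral and the rounding of the ends. *)
Lemma band_power_sum (b kappa : R) m n : b < 0 -> 1 <= kappa -> (0 < m)%N -> (m <= n)%N ->
  kappa ^+ 2 <= m%:R < kappa ^+ 2 + 1 -> 4 * kappa ^+ 2 <= n%:R < 4 * kappa ^+ 2 + 1 ->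
  `|\sum_(k <- annulus m n) (knorm k : R) `^ (2 * (b - 1)) -
    pi * ((4 `^ b - 1) / b) * kappa `^ (2 * b)| <= (36 + 6 * pi) * kappa `^ (2 * b - 1).
Proof.
move=> b0 k1 m0 mn /andP[m1 m2] /andP[n1 n2].
have k0 : 0 < kappa by lra.
have kk : 1 <= kappa ^+ 2 by rewrite expr_ge1//; lra.
have pp := pi_gt0 R.
pose h i : R := i%:R `^ (b - 1).
have hle : h m <= kappa `^ (2 * b - 2).
  have -> : kappa `^ (2 * b - 2) = (kappa ^+ 2) `^ (b - 1).
    by rewrite -powR_mulrn ?ltW// -powRrM; congr (_ `^ _); ring.
  by apply: powR_antitone; lra.
have hmon i : (m <= i)%N -> 0 <= h i.+1 <= h i.
  move=> mi; rewrite powR_ge0/= /h; apply: powR_antitone; [lra| |by rewrite ler_nat].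
  by rewrite ltr0n (leq_trans m0).
have A := annulus_sum_integral mn (powR_ge0 _ _) hmon.
have -> : \sum_(k <- annulus m n) (knorm k : R) `^ (2 * (b - 1)) = \sum_(k <- annulus m n) h (nsq k).
  by apply: eq_bigr => k _; rewrite kn_powR.
have sn : Num.sqrt n%:R <= 3 * kappa.
  have k30 : 0 <= 3 * kappa by lra.
  rewrite -[leRHS]ger0_norm// -sqrtr_sqr ler_sqrt ?sqr_ge0// exprMn -natrX.
  by apply: le_trans (ltW n2) _; rewrite (_ : (3 ^ 2)%N%:R = 9) //; lra.
have kS : kappa * kappa `^ (2 * b - 2) = kappa `^ (2 * b - 1).
  rewrite -{1}(powRr1 (ltW k0)) -powRD; first by congr (_ `^ _); ring.
  by apply/implyP => _; rewrite gt_eqF.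
have hle' : kappa `^ (2 * b - 2) <= kappa `^ (2 * b - 1) by rewrite ler_powR//; lra.
have hp := powR_ge0 kappa (2 * b - 2); have hp1 := powR_ge0 kappa (2 * b - 1).
have A1 : h m * (12 * Num.sqrt n%:R) <= 36 * kappa `^ (2 * b - 1).
  rewrite -kS (_ : 36 * _ = kappa `^ (2 * b - 2) * (12 * (3 * kappa))); last by ring.
  by apply: ler_pM => //; rewrite ?powR_ge0 ?mulr_ge0 ?sqrtr_ge0// ler_wpM2l.
have /andP[B1 B2] := sum_powR_integral b0 m0 mn.
(* The primitive of x^(b-1). *)
pose e x := x `^ b / b.
have sub (x : R) y : 0 < x -> x <= y -> y <= x + 1 -> e x <= e y <= e x + x `^ (b - 1).
  move=> x0 xy y1; have [c /andP[c1 c2] ec] := powR_MVT b x0 xy.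
  have -> : e y = e x + c `^ (b - 1) * (y - x).
    rewrite /e -[y `^ b](subrK (x `^ b)) ec mulrDl addrC; congr (_ + _).
    by field; rewrite lt_eqF.
  rewrite lerDl lerD2l mulr_ge0 ?powR_ge0 ?subr_ge0//=.
  apply: (@le_trans _ _ (x `^ (b - 1) * 1)); last by rewrite mulr1.
  apply: ler_pM; rewrite ?powR_ge0 ?subr_ge0//; last by rewrite lerBlDl.
  by apply: powR_antitone => //; rewrite subr_le0 (le_trans (ltW b0)).
have /andP[u1 u2] := sub (kappa ^+ 2) m%:R ltac:(lra) m1 (ltW m2).
have /andP[v1 v2] := sub (4 * kappa ^+ 2) n%:R ltac:(lra) n1 (ltW n2).
have p2 : (kappa ^+ 2) `^ (b - 1) = kappa `^ (2 * b - 2).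
  by rewrite -powR_mulrn ?ltW// -powRrM; congr (_ `^ _); ring.
have p3 : (4 * kappa ^+ 2) `^ (b - 1) <= (kappa ^+ 2) `^ (b - 1).
  by clear -b0 kk; apply: powR_antitone; lra.
have ek : e (4 * kappa ^+ 2) - e (kappa ^+ 2) = (4 `^ b - 1) / b * kappa `^ (2 * b).
  rewrite /e powRM ?sqr_ge0// (_ : (kappa ^+ 2) `^ b = kappa `^ (2 * b)); last first.
    by rewrite -powR_mulrn ?ltW// -powRrM.
  by ring.
have I : `|\sum_(m <= i < n) h i - (4 `^ b - 1) / b * kappa `^ (2 * b)| <= 6 * kappa `^ (2 * b - 1).
  change (\sum_(m <= i < n) (i%:R : R) `^ (b - 1)) with (\sum_(m <= i < n) h i) in B1, B2.
  rewrite -/(h m) mulrBl -/(e _) -/(e _) in B1 B2.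
  clear -B1 B2 u1 u2 v1 v2 hle hle' p2 p3 hp hp1 ek.
  by rewrite -ek ler_norml; apply/andP; split; lra.
rewrite -mulrA (_ : _ - _ = (\sum_(k <- annulus m n) h (nsq k) - pi * \sum_(m <= i < n) h i) +
   pi * (\sum_(m <= i < n) h i - (4 `^ b - 1) / b * kappa `^ (2 * b))); last by ring.
apply: le_trans (ler_normD _ _) _; rewrite [leRHS]mulrDl; apply: lerD; first exact: le_trans A A1.
rewrite normrM gtr0_norm// (_ : 6 * pi * _ = pi * (6 * kappa `^ (2 * b - 1))); last by ring.
by rewrite ler_wpM2l// ltW.
Qed.

End band_sums.

(** * Shells and compensation *)

Section shells.
Context {R : realType}.

(* [nsq k] is [|k| ^ 2], so that this is the shell [m ^ 2 <= |k| < (m + 1) ^ 2]. *)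
Definition shell (m : nat) : seq Z2 := annulus (m ^ 4) (m.+1 ^ 4).

(** Gives the index of the shell that contains a wavenumber from its [nsq]. *)
Definition root4 (n : nat) : nat := \max_(m < n.+1 | (m ^ 4 <= n)%N) m.

Lemma root4_eq m n : (m ^ 4 <= n < m.+1 ^ 4)%N -> root4 n = m.
Proof.
move=> /andP[mn nm]; apply/eqP; rewrite eqn_leq; apply/andP; split.
  apply/bigmax_leqP => i ni; rewrite -ltnS -(@ltn_exp2r _ _ 4)//.
  exact: leq_ltn_trans ni nm.
have mn1 : (m < n.+1)%N.
  by rewrite ltnS; apply: leq_trans mn; case: m {nm} => // m; rewrite -{1}[m.+1]expn1 leq_pexp2l.
exact: (@leq_bigmax_cond _ (fun i : 'I_n.+1 => (i ^ 4 <= n)%N) (fun i => i : nat) (Ordinal mn1)).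
Qed.

Lemma root4_exists n : exists m, (m ^ 4 <= n < m.+1 ^ 4)%N.
Proof.
elim: n => [|n [m /andP[h1 h2]]]; first by exists 0%N.
have [h|h] := ltnP n.+1 (m.+1 ^ 4); first by exists m; rewrite h (leq_trans h1).
exists m.+1; rewrite h (leq_ltn_trans h2)// ltn_exp2r//.
Qed.

Lemma shell_root4 m k : k \in shell m -> root4 (nsq k) = m.
Proof. by rewrite annulusP; exact: root4_eq. Qed.

Lemma sum_shells (f : Z2 -> R) m n : (m <= n)%N ->
  \sum_(k <- annulus (m ^ 4) (n ^ 4)) f k = \sum_(m <= i < n) \sum_(k <- shell i) f k.
Proof.
elim: n => [|n IH] mn.
  move: mn; rewrite leqn0 => /eqP ->; rewrite big_geq// big_seq big1//.
have [->|ne] := eqVneq m n.+1.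
  rewrite big_geq// big_seq big1// => k; rewrite annulusP; lia.
have mn' : (m <= n)%N by lia.
have e1 : (m ^ 4 <= n ^ 4)%N by rewrite leq_exp2r.
have e2 : (n ^ 4 <= n.+1 ^ 4)%N by rewrite leq_exp2r.
by rewrite (sum_annulus_cat _ e1 e2) IH// big_nat_recr.
Qed.

End shells.

(** * Random gains that fix the energy of a shell *)

Section compensation.
Context {d : measure_display} {Omega : measurableType d} {R : realType}.
Variable P : probability Omega R.
Variables (energy : Z2 -> Omega -> R) (e : Z2 -> R) (rho : R).
Hypotheses (energy_ge0 : forall k w, 0 <= energy k w) (energy_meas : forall k, bmeas (energy k)).
Hypothesis rho_itv : 0 < rho <= 4^-1.

Local Notation Ex := (@Ex d Omega R P).

(* Where the required gain is close to 1, multiplying the coefficients of a shell by it turns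
   the energy of the shell into its mean value; elsewhere the shell is left unchanged. *)
Definition gain (m : nat) (w : Omega) : R :=
  let B := \sum_(k <- shell m) energy k w in let t := \sum_(k <- shell m) e k in
  if (0 < t) && (`|B - t| <= rho * t) then Num.sqrt t * B `^ (- 2^-1) else 1.

Lemma gainP m w (B := \sum_(k <- shell m) energy k w) (t := \sum_(k <- shell m) e k) :
  gain m w = 1 /\ (0 < t -> rho * t < `|B - t|) \/
  [/\ 0 < B, 0 <= gain m w, gain m w ^+ 2 * B = t & `|B - t| <= rho * t].
Proof.
have /andP[r0 r4] := rho_itv; rewrite /gain -/B -/t.
case: ifP => [/andP[t0 h]|/negbT]; last first.
  by rewrite negb_and => /orP[|] h; left; split => // t0; [rewrite t0 in h|rewrite ltNge].
have B0 : 0 < B by move: h; rewrite ler_norml => /andP[h _]; nra.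
right; split => //; first by rewrite mulr_ge0 ?sqrtr_ge0 ?powR_ge0.
rewrite exprMn sqr_sqrtr ?ltW// powRXn ?ltW//.
rewrite (_ : - 2^-1 * 2%:R = -1); last by field.
by rewrite powR_inv1 ?ltW// -mulrA mulVf ?mulr1// gt_eqF.
Qed.

(** For a gain g >= 0, |g - 1| <= |g^2 - 1|, and |g^2 - 1| B = |t - B| <= rho t. As rho <= 1/4, t is
    at most 2 B. *)
Lemma gain_near1 m w : `|gain m w - 1| <= 2 * rho.
Proof.
have /andP[r0 r4] := rho_itv.
have [[-> _]|[B0 g0 gB h]] := gainP m w; first by rewrite subrr normr0; lra.
set g := gain m w in g0 gB *; move: B0 gB h.
set B := \sum_(k <- shell m) energy k w; set t := \sum_(k <- shell m) e k => B0 gB h.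
apply: (@le_trans _ _ `|g ^+ 2 - 1|).
  rewrite (_ : g ^+ 2 - 1 = (g - 1) * (g + 1)); last by ring.
  by rewrite normrM ler_peMr// ger0_norm; lra.
rewrite -(ler_pM2r B0) -[X in _ * X <= _](gtr0_norm B0) -normrM mulrBl gB mul1r distrC.
apply: le_trans (h) _; rewrite -mulrA mulrCA ler_wpM2l ?ltW//.
have t0 : 0 <= t by rewrite -gB mulr_ge0 ?sqr_ge0// ltW.
by move: h; rewrite ler_norml => /andP[h _]; nra.
Qed.

Lemma gain_ge0_le2 m w : 0 <= gain m w <= 2.
Proof.
have /andP[r0 r4] := rho_itv.
by have := gain_near1 m w; rewrite ler_norml => /andP[h1 h2]; apply/andP; split; lra.
Qed.

Lemma bmeas_gain m : bmeas (gain m).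
Proof.
have mB : measurable_fun [set: Omega] (fun w => \sum_(k <- shell m) energy k w).
  by have [] : bmeas (fun w => \sum_(k <- shell m) energy k w) by exact: bmeas_sum.
split; last by exists 2 => w; rewrite ger0_norm; have /andP[] := gain_ge0_le2 m w.
apply: measurable_fun_ifT => //.
  apply: measurable_and => //; apply: measurable_fun_ler => //.
  by apply: measurableT_comp => //; exact: measurable_funB.
by apply: measurable_funM => //; exact: (measurableT_comp (measurable_powR (- 2^-1))).
Qed.

Definition excess (Q : seq Z2) w : R := \sum_(k <- Q) (energy k w - e k).

(** The analogue of [excess] after compensation. The gain is that of the whole shell m, even when Q
    is only a part of it, as at the ends of a band. *)
Definition deviation m (Q : seq Z2) w : R := \sum_(k <- Q) (gain m w ^+ 2 * energy k w - e k).

Lemma bmeas_excess Q : bmeas (excess Q).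
Proof. by apply: bmeas_sum => k; apply: bmeasB => //; exact: bmeas_cst. Qed.

Lemma bmeas_deviation m Q : bmeas (deviation m Q).
Proof.
apply: bmeas_sum => k; apply: bmeasB; last exact: bmeas_cst.
by apply: bmeasM => //; apply: bmeasX; exact: bmeas_gain.
Qed.

Lemma excessE Q w : excess Q w = \sum_(k <- Q) energy k w - \sum_(k <- Q) e k.
Proof. exact: sumrB. Qed.

Lemma deviationE m Q w :
  deviation m Q w = excess Q w + (gain m w ^+ 2 - 1) * \sum_(k <- Q) energy k w.
Proof.
rewrite excessE /deviation sumrB -mulr_sumr; ring.
Qed.

(** The change |g^2 - 1| times the energy of Q is at most the same multiple of the energy of the
    shell, and this equals the excess of the shell whenever the gain is accepted. *)
Lemma edge_deviation m Q w : uniq Q -> {subset Q <= shell m} ->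
  `|deviation m Q w| <= `|excess Q w| + `|excess (shell m) w|.
Proof.
move=> uQ Qm; rewrite deviationE; apply: le_trans (ler_normD _ _) _; rewrite lerD2l.
have [[-> _]|[B0 g0 gB h]] := gainP m w; first by rewrite expr1n subrr mul0r normr0.
have -> : excess (shell m) w = - ((gain m w ^+ 2 - 1) * \sum_(k <- shell m) energy k w).
  by rewrite excessE -gB; ring.
rewrite normrN !normrM ler_wpM2l// !ger0_norm ?sumr_ge0//.
by apply: ler_sum_subset => //; exact: annulus_uniq.
Qed.

Lemma edge_deviation_sqr m Q w : uniq Q -> {subset Q <= shell m} ->
  deviation m Q w ^+ 2 <= 2 * excess Q w ^+ 2 + 2 * excess (shell m) w ^+ 2.
Proof.
move=> uQ Qm; have := edge_deviation w uQ Qm.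
rewrite -(real_normK (num_real (deviation m Q w))) -(real_normK (num_real (excess Q w))).
rewrite -(real_normK (num_real (excess (shell m) w))).
have := normr_ge0 (deviation m Q w); set x := `|deviation m Q w|; set y := `|_|; set z := `|_|.
by move=> x0 h; have := sqr_ge0 (y - z); nra.
Qed.

(** A full shell deviates only if its gain is refused; then the excess exceeds rho tau, and its
    square is at most its fourth power over (rho tau)^2. The fourth moment thus replaces a bound on
    the probability of refusal. *)
Lemma shell_deviation_sqr m w tau : 0 < tau -> tau <= \sum_(k <- shell m) e k ->
  deviation m (shell m) w ^+ 2 <= excess (shell m) w ^+ 4 / (rho * tau) ^+ 2.
Proof.
move=> t0 tm; have /andP[r0 _] := rho_itv.
have rt : 0 < rho * tau by rewrite mulr_gt0.
rewrite deviationE ler_pdivlMr ?exprn_gt0//.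
have [[-> h]|[B0 g0 gB h]] := gainP m w; last first.
  have -> : excess (shell m) w + (gain m w ^+ 2 - 1) * \sum_(k <- shell m) energy k w = 0.
    by rewrite excessE -gB; ring.
  rewrite expr0n mul0r.
  by rewrite (_ : 4 = 2 * 2)%N// exprM sqr_ge0.
rewrite expr1n subrr mul0r addr0 (_ : excess (shell m) w ^+ 4 = excess (shell m) w ^+ 2 * excess (shell m) w ^+ 2); last by ring.
rewrite ler_wpM2l ?sqr_ge0// -[leRHS]real_normK ?num_real// ler_pXn2r ?nnegrE ?(ltW rt)//.
have := h (lt_le_trans t0 tm); rewrite excessE => /ltW; apply: le_trans.
by rewrite ler_pM2l.
Qed.

Definition compensated k w : R := gain (root4 (nsq k)) w ^+ 2 * energy k w.

Lemma bmeas_compensated k : bmeas (compensated k).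
Proof. by apply: bmeasM => //; apply: bmeasX; exact: bmeas_gain. Qed.

Lemma Ex_sqr_le_fourth (f : Omega -> R) V : bmeas f -> 0 < V ->
  Ex (fun w => f w ^+ 4) <= V ^+ 2 -> Ex (fun w => f w ^+ 2) <= V.
Proof.
move=> mf V0 h; have := @Ex_sqr_le _ _ _ P (fun w => f w ^+ 2) (bmeasX 2 mf).
rewrite (_ : (fun w => f w ^+ 2 ^+ 2) = (fun w => f w ^+ 4)); last by apply/funext => w; ring.
move=> /le_trans /(_ h); rewrite ler_pXn2r ?nnegrE ?(ltW V0)//.
by apply: Ex_ge0 => w; exact: sqr_ge0.
Qed.

Lemma sum_sqr_le (I : Type) (s : seq I) (f : I -> R) :
  (\sum_(i <- s) f i) ^+ 2 <= (size s)%:R * \sum_(i <- s) f i ^+ 2.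
Proof.
elim: s => [|i s IH]; first by rewrite !big_nil expr0n mulr0.
rewrite !big_cons /= -natr1; set S := \sum_(j <- s) f j in IH *; set T := \sum_(j <- s) _ in IH *.
have [|n0] := posnP (size s).
  by move=> /size0nil s0; rewrite /S /T s0 !big_nil !addr0 add0r mul1r.
set n : R := (size s)%:R in IH *.
have np : 0 < n by rewrite ltr0n.
have : 2 * f i * S <= n * f i ^+ 2 + T.
  apply: (@le_trans _ _ (n * f i ^+ 2 + S ^+ 2 / n)); last by rewrite lerD2l ler_pdivrMr// mulrC.
  rewrite -(ler_pM2l np) mulrDr mulrCA [n * (_ / n)]mulrCA divff ?gt_eqF// mulr1.
  by have := sqr_ge0 (n * f i - S); nra.
nra.
Qed.

(** The two cut shells contribute their second moments. Correlations between the inner shells are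
    absorbed by Cauchy-Schwarz, at the price of a second factor m2 - m1. In 24 = 3 * 2 * 4, 3 is for
    the three pieces, 2 for the two cut shells and 4 from [edge_deviation_sqr]. *)
Lemma band_deviation a b m1 m2 V tau : (m1 < m2)%N ->
  (m1 ^ 4 <= a <= m1.+1 ^ 4)%N -> (m2 ^ 4 <= b <= m2.+1 ^ 4)%N -> 0 < V -> 0 < tau ->
  (forall m, (m1 < m < m2)%N -> tau <= \sum_(k <- shell m) e k) ->
  (forall m Q, (m1 <= m <= m2)%N -> uniq Q -> {subset Q <= shell m} ->
     Ex (fun w => excess Q w ^+ 4) <= V ^+ 2) ->
  Ex (fun w => (\sum_(k <- annulus a b) compensated k w - \sum_(k <- annulus a b) e k) ^+ 2) <=
  24 * V + 3 * ((m2 - m1)%:R * (V / (rho * tau))) ^+ 2.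
Proof.
move=> m12 /andP[a1 a2] /andP[b1 b2] V0 t0 tE H4.
have /andP[r0 _] := rho_itv.
pose Q1 := annulus a (m1.+1 ^ 4); pose Q2 := annulus (m2 ^ 4) b.
pose N : R := (m2 - m1)%:R.
have cE : forall (m : nat) (Q : seq Z2) w, {subset Q <= shell m} ->
    \sum_(k <- Q) (compensated k w - e k) = deviation m Q w.
  move=> m Q w Qm; apply: eq_big_seq => k /Qm km.
  by rewrite /compensated (shell_root4 km).
have sub1 : {subset Q1 <= shell m1}.
  by move=> k; rewrite !annulusP => /andP[h1 ->]; rewrite (leq_trans a1).
have sub2 : {subset Q2 <= shell m2}.
  by move=> k; rewrite !annulusP => /andP[-> h2]; rewrite (leq_trans h2).
have split w : \sum_(k <- annulus a b) compensated k w - \sum_(k <- annulus a b) e k =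
    deviation m1 Q1 w + \sum_(m1.+1 <= m < m2) deviation m (shell m) w + deviation m2 Q2 w.
  rewrite -sumrB.
  have l1 : (m1.+1 ^ 4 <= m2 ^ 4)%N by rewrite leq_exp2r.
  rewrite (sum_annulus_cat _ a2 (leq_trans l1 b1)) (sum_annulus_cat _ l1 b1) sum_shells//.
  rewrite (cE m1 Q1 w sub1) (cE m2 Q2 w sub2) addrA; congr (_ + _ + _).
  by apply: eq_bigr => m _; apply: cE.
have mD := bmeas_deviation; have mE := bmeas_excess.
pose G w := 3 * (2 * excess Q1 w ^+ 2 + 2 * excess (shell m1) w ^+ 2) +
   (3 * (2 * excess Q2 w ^+ 2 + 2 * excess (shell m2) w ^+ 2) +
   (3 * N / (rho * tau) ^+ 2) * \sum_(m1.+1 <= m < m2) excess (shell m) w ^+ 4).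
have mX Q n : bmeas (fun w => excess Q w ^+ n) by exact: bmeasX.
have mS : bmeas (fun w => \sum_(m1.+1 <= m < m2) excess (shell m) w ^+ 4) by exact: bmeas_sum.
have mQ (Q Q' : seq Z2) : bmeas (fun w => 2 * excess Q w ^+ 2 + 2 * excess Q' w ^+ 2).
  by apply: bmeasD; exact: bmeasZ.
have q1 : (m1 <= m1 <= m2)%N by rewrite leqnn ltnW.
have q2 : (m1 <= m2 <= m2)%N by rewrite leqnn ltnW.
have u1 : uniq Q1 by exact: annulus_uniq.
have u2 : uniq Q2 by exact: annulus_uniq.
have us m : uniq (shell m) by exact: annulus_uniq.
have ExQ m Q : (m1 <= m <= m2)%N -> uniq Q -> {subset Q <= shell m} ->
    Ex (fun w => 2 * excess Q w ^+ 2 + 2 * excess (shell m) w ^+ 2) <= 4 * V.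
  move=> hm uQ Qm; rewrite ExD ?ExZ//; try exact: bmeasZ.
  have := Ex_sqr_le_fourth (mE Q) V0 (H4 m Q hm uQ Qm).
  have := Ex_sqr_le_fourth (mE (shell m)) V0 (H4 m (shell m) hm (us m) (fun k => id)).
  by move=> ? ?; lra.
have rt : 0 < rho * tau by rewrite mulr_gt0.
have c0 : 0 <= 3 * N / (rho * tau) ^+ 2 by rewrite divr_ge0 ?mulr_ge0// ltW// exprn_gt0.
apply: (@le_trans _ _ (Ex G)).
  apply: Ex_le.
  - apply: bmeasX; apply: bmeasB; last exact: bmeas_cst.
    by apply: bmeas_sum; exact: bmeas_compensated.
  - by apply: bmeasD; [exact: bmeasZ|apply: bmeasD; exact: bmeasZ].
  move=> w; rewrite split.
  have h1 := edge_deviation_sqr w u1 sub1; have h2 := edge_deviation_sqr w u2 sub2.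
  have h3 := sum_sqr_le (index_iota m1.+1 m2) (fun m => deviation m (shell m) w).
  have h4 : (size (index_iota m1.+1 m2))%:R * \sum_(m1.+1 <= m < m2) deviation m (shell m) w ^+ 2 <=
      N * \sum_(m1.+1 <= m < m2) (excess (shell m) w ^+ 4 / (rho * tau) ^+ 2).
    apply: ler_pM => //; first by rewrite sumr_ge0// => m _; exact: sqr_ge0.
      by rewrite size_iota ler_nat leq_sub2l.
    rewrite big_nat [leRHS]big_nat; apply: ler_sum => m hm.
    by apply: shell_deviation_sqr => //; apply: tE.
  rewrite -mulr_suml in h4.
  have h5 := le_trans h3 h4; rewrite /G.
  set x := deviation m1 Q1 w in h1 *; set y := deviation m2 Q2 w in h2 *.
  set z := \sum_(m1.+1 <= m < m2) deviation m (shell m) w in h5 *.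
  set s := \sum_(m1.+1 <= m < m2) excess (shell m) w ^+ 4 in h5 *.
  have -> : 3 * N / (rho * tau) ^+ 2 * s = 3 * (N * (s / (rho * tau) ^+ 2)) by ring.
  apply: (@le_trans _ _ (3 * x ^+ 2 + (3 * y ^+ 2 + 3 * z ^+ 2))).
    by have := sqr_ge0 (x - y); have := sqr_ge0 (x - z); have := sqr_ge0 (y - z); nra.
  by apply: lerD; [|apply: lerD]; rewrite ler_pM2l.
rewrite /G (ExD P (bmeasZ 3 (mQ _ _)) (bmeasD (bmeasZ 3 (mQ _ _)) (bmeasZ _ mS))).
rewrite (ExD P (bmeasZ 3 (mQ _ _)) (bmeasZ _ mS)) (ExZ P _ mS) !(ExZ P _ (mQ _ _)) Ex_sum//.
have e1 := ExQ m1 Q1 q1 u1 sub1; have e2 := ExQ m2 Q2 q2 u2 sub2.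
have e3 : \sum_(m1.+1 <= m < m2) Ex (fun w => excess (shell m) w ^+ 4) <= N * V ^+ 2.
  rewrite big_nat; apply: (@le_trans _ _ (\sum_(m1.+1 <= m < m2) V ^+ 2)).
    rewrite [leRHS]big_nat; apply: ler_sum => m /andP[g1 g2].
    by apply: (H4 m (shell m) _ (us m) (fun k => id)); rewrite (ltnW g1) (ltnW g2).
  rewrite sumr_const_nat -[_ *+ _]mulr_natl ler_wpM2r ?sqr_ge0// ler_nat leq_sub2l//.
have e4 := ler_wpM2l c0 e3.
have -> : 3 * (N * (V / (rho * tau))) ^+ 2 = 3 * N / (rho * tau) ^+ 2 * (N * V ^+ 2).
  by have := gt_eqF rt; move: (rho * tau) => y y0; field; rewrite y0.
by lra.
Qed.

End compensation.

(** * The mean energy of the first correction *)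

Section finite_sums.
Context {R : realType}.

Lemma esum_finite (T : choiceType) (a : T -> R) (s0 : seq T) : (forall t, 0 <= a t) -> uniq s0 ->
  (forall t, t \notin s0 -> a t = 0) ->
  \esum_(t in [set: T]) (a t)%:E = (\sum_(t <- s0) a t)%:E.
Proof.
move=> a0 us h; apply/eqP; rewrite eq_le esum_ge_seq// andbT; apply: esum_bounded => // s us'.
rewrite (bigID (mem s0))/= [X in _ + X]big1 ?addr0; last by move=> t /h ->; rewrite normr0.
rewrite -big_filter (eq_bigr a); last by move=> t _; rewrite ger0_norm.
apply: ler_sum_subset => //; first exact: filter_uniq.
by move=> t; rewrite mem_filter => /andP[].
Qed.

Lemma rsum_finite (T : choiceType) (a : T -> R) (s0 : seq T) : (forall t, 0 <= a t) -> uniq s0 ->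
  (forall t, t \notin s0 -> a t = 0) -> rsum a = \sum_(t <- s0) a t.
Proof.
move=> a0 us h; rewrite /rsum.
have -> : (fun t => (Num.max (- a t) 0)%:E) = (fun=> 0%E).
  by apply/funext => t; rewrite max_r// oppr_le0.
have -> : (fun t => (Num.max (a t) 0)%:E) = (fun t => (a t)%:E).
  by apply/funext => t; rewrite max_l.
by rewrite (esum_finite a0 us h) (_ : \esum_(_ in _) _ = 0%E) ?subr0//; exact: esum1.
Qed.

Lemma band_energyE (kappa : R) f s : uniq s ->
  (forall k, (k \in s) = (kappa <= knorm k < 2 * kappa)) ->
  band_energy kappa f = \sum_(k <- s) cmod2 (f k).
Proof.
move=> us hs; rewrite /band_energy /L2sq (esum_finite _ us) /=.
- by apply: eq_big_seq => k; rewrite hs /Defs.proj => ->.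
- by move=> k; rewrite -nc_sqr sqr_ge0.
by move=> k; rewrite hs /Defs.proj => /negbTE ->; rewrite /cmod2 /= !expr0n addr0.
Qed.

Lemma band_seq (kappa : R) : exists2 s : seq Z2, uniq s &
  forall k, (k \in s) = (kappa <= knorm k < 2 * kappa).
Proof.
exists [seq k <- box (Num.truncn (2 * kappa)).+1 | kappa <= knorm k < 2 * kappa].
  by rewrite filter_uniq// box_uniq.
move=> k; rewrite mem_filter; case: (boolP (kappa <= knorm k < 2 * kappa)) => //= /andP[_ h].
have tr (x : int) : `|x%:~R : R| <= knorm k -> (`|x| <= (Num.truncn (2 * kappa)).+1)%N.
  move=> hx; rewrite -(ler_nat R) natr_absz intr_norm; apply: le_trans hx _.
  by apply: ltW; apply: lt_trans h (truncnS_gt _).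
by rewrite boxP !tr// knE; [exact: (@Im_le_nc R (_ +i* _))|exact: (@Re_le_nc R (_ +i* _))].
Qed.

(** Mean value theorem; the derivative is largest at the lower end x / 2 of the admissible range. *)
Lemma powR_lipschitz (x y r dlt : R) : 0 < x -> x / 2 <= y -> `|y - x| <= dlt -> r <= 0 ->
  `|y `^ r - x `^ r| <= - r * (x / 2) `^ (r - 1) * dlt.
Proof.
move=> x0 xy yx r0; have h0 : 0 < x / 2 by rewrite divr_gt0.
have gen (a b : R) : x / 2 <= a -> a <= b -> b - a <= dlt ->
    `|b `^ r - a `^ r| <= - r * (x / 2) `^ (r - 1) * dlt.
  move=> xa ab d; have a0 : 0 < a by apply: lt_le_trans xa.
  have [c /andP[ac _] ->] := powR_MVT r a0 ab.
  rewrite !normrM (ler0_norm r0) (ger0_norm (powR_ge0 _ _)) [`|b - a|]ger0_norm ?subr_ge0//.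
  apply: ler_pM; rewrite ?mulr_ge0 ?powR_ge0 ?subr_ge0 ?oppr_ge0//.
  rewrite ler_wpM2l ?oppr_ge0// powR_antitone//; last exact: le_trans ac.
  by clear -r0; lra.
move: yx; rewrite ler_norml => /andP[d1 d2].
have [h|/ltW h] := leP x y; first by apply: gen => //; clear -h x0; lra.
rewrite distrC; apply: gen => //; clear -d1; lra.
Qed.

End finite_sums.

(** * The coefficients of the first correction and their spectrum *)

Section interaction_coefficients.
Context {R : realType}.
Variables (beta kappa_g U : R) (gamma : R -> R).
Hypotheses (beta_lt : beta < -2) (U_gt0 : 0 < U) (gamma0 : gamma 0 = 0).
Hypothesis gamma_high : forall kappa, kappa_g <= kappa -> gamma kappa = 0.

Local Notation kn := (@knorm R).
Local Notation gam j := (gamma (kn j)).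

Definition cutoff : nat := (Num.truncn kappa_g).+1.

Definition modes : seq Z2 := [seq j <- box cutoff | gam j != 0].

Lemma modesP j : (j \in modes) = (gam j != 0).
Proof.
rewrite mem_filter; case: eqP => //= h; apply: contraPT isT => /(gamma_out gamma_high).
by move=> e; case: h.
Qed.

Lemma modes_uniq : uniq modes. Proof. by rewrite filter_uniq// box_uniq. Qed.

Lemma modes_box : {subset modes <= box cutoff}.
Proof. by move=> j; rewrite mem_filter => /andP[]. Qed.

Lemma modes0 : 0 \notin modes. Proof. by rewrite modesP kn0 gamma0 eqxx. Qed.

Lemma modes_lt j : j \in modes -> kn j < kappa_g.
Proof. by rewrite modesP ltNge; apply: contra => /gamma_high ->. Qed.

(** The real factor of e^(i (phi_(k-j) + xi_j)) in the k-th coefficient of the first correction; see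
    [first_correction]. *)
Definition coef (k j : Z2) : R :=
  - (cross k j * U * kn (k - j) `^ beta * gam j) / kn k ^+ 2.

Definition spectrum k : R := mean_energy modes coef k.

Definition source_energy : R := \sum_(j <- modes) kn j ^+ 2 * gam j ^+ 2.

Lemma G0E : G0 gamma = source_energy.
Proof.
rewrite /G0 (rsum_finite _ modes_uniq)// => j; first by rewrite mulr_ge0 ?sqr_ge0.
by rewrite modesP negbK => /eqP ->; rewrite expr0n mulr0.
Qed.

(** The form in the definition equals |i|^2 |j|^2 + 2 (i.j)^2, so all summands are nonnegative and
    the diagonal one is 3 |j|^4 gamma_j^4. *)
Lemma G1_gt0 j : j \in modes -> 0 < G1 gamma.
Proof.
move=> jm; rewrite /G1.
set F := fun p : Z2 * Z2 => _.
have F0 p : 0 <= F p.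
  apply: mulr_ge0; last exact: sqr_ge0.
  apply: mulr_ge0; last exact: sqr_ge0.
  set a := _%:~R; set b := _%:~R; set c := _%:~R; set d := _%:~R.
  have := sqr_ge0 (a * c + b * d); have := sqr_ge0 (a * d); have := sqr_ge0 (b * c).
  have := sqr_ge0 (a * c); have := sqr_ge0 (b * d); nra.
rewrite (@rsum_finite _ _ F [seq (i, j) | i <- modes, j <- modes]) => //.
- apply: lt_le_trans (_ : F (j, j) <= _); last first.
    have -> : F (j, j) = \sum_(p <- [:: (j, j)]) F p by rewrite big_seq1.
    apply: ler_sum_subset => //; first by apply: allpairs_uniq; rewrite ?modes_uniq// => -[? ?] [? ?] _ _ [-> ->].
    by move=> p; rewrite inE => /eqP ->; apply/allpairsP; exists (j, j).
  rewrite /F /=; have j0 : j != 0 by apply: contraNneq modes0 => <-.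
  have g2 : 0 < gam j ^+ 2 by rewrite exprn_even_gt0//= -modesP.
  have k2 : 0 < kn j ^+ 2 by rewrite exprn_gt0// kn_gt0.
  rewrite mulr_gt0// mulr_gt0//; move: k2; rewrite kn_sqr.
  set a := _%:~R; set b := _%:~R => k2.
  have -> : 3 * a ^+ 2 * a ^+ 2 + a ^+ 2 * b ^+ 2 + b ^+ 2 * a ^+ 2 + 3 * b ^+ 2 * b ^+ 2 + 4 * a * b * a * b =
     3 * (a ^+ 2 + b ^+ 2) ^+ 2 by ring.
  by rewrite mulr_gt0// exprn_gt0.
- by apply: allpairs_uniq; rewrite ?modes_uniq// => -[? ?] [? ?] _ _ [-> ->].
move=> [a b] h; have [ha|ha] := boolP (a \in modes); last first.
  by rewrite /F /=; move: ha; rewrite modesP negbK => /eqP ->; rewrite expr0n mulr0 mul0r.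
have [hb|hb] := boolP (b \in modes); last first.
  by rewrite /F /=; move: hb; rewrite modesP negbK => /eqP ->; rewrite expr0n mulr0.
by case/negP: h; apply/allpairsP; exists (a, b).
Qed.

(* Averaging over the rotation of [j] by a right angle, which preserves [|j|]. *)
Lemma cross_sum k : \sum_(j <- modes) cross k j ^+ 2 * gam j ^+ 2 = kn k ^+ 2 / 2 * source_energy.
Proof.
pose rot (j : Z2) : Z2 := (- j.2, j.1).
have rotI : injective rot by move=> [a b] [c d] [/oppr_inj -> ->].
have kn_rot j : kn (rot j) = kn j by rewrite /knorm /rot /= rmorphN /= sqrrN addrC.
have pm : perm_eq modes (map rot modes).
  have sub : {subset map rot modes <= modes}.
    by move=> j /mapP[i im ->]; rewrite modesP kn_rot -modesP.
  have um : uniq (map rot modes) by rewrite map_inj_uniq// modes_uniq.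
  have [_ h] := uniq_min_size um sub (eq_leq (esym (size_map rot modes))).
  by rewrite perm_sym; apply: uniq_perm; rewrite ?modes_uniq.
set S := LHS.
have S' : S = \sum_(j <- modes) cross k (rot j) ^+ 2 * gam j ^+ 2.
  rewrite /S (perm_big _ pm)/= big_map; apply: eq_bigr => j _; by rewrite kn_rot.
have SS : S + S = kn k ^+ 2 * source_energy.
  rewrite {2}S' /S -big_split/= /source_energy mulr_sumr; apply: eq_bigr => j _.
  by rewrite /rot /cross /= rmorphN /= !kn_sqr; ring.
have -> : S = (S + S) / 2 by field.
by rewrite SS; ring.
Qed.

(** Lipschitz constant of r -> r^(2 beta) on [|k| / 2, oo), up to its power of |k|, times the bound
    [kappa_g] on ||k - j| - |k||. *)
Definition shiftC : R := - (2 * beta) * (2^-1) `^ (2 * beta - 1) * kappa_g.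

Lemma kappa_g_lt_cutoff : kappa_g < cutoff%:R. Proof. exact: truncnS_gt. Qed.

Lemma far_out k : 2 * cutoff%:R < kn k -> k \notin box cutoff.
Proof.
move=> h; apply: contraTN h => kb; rewrite -leNgt.
have kn_le : kn k <= `|k.1%:~R| + `|k.2%:~R| by rewrite knE; exact: (nc_le (_ +i* _)).
apply: le_trans kn_le _; move: kb; rewrite boxP -!(ler_nat R) !natr_absz !intr_norm => /andP[]; lra.
Qed.

Lemma far_half k j : 2 * cutoff%:R < kn k -> j \in modes -> kn k / 2 <= kn (k - j).
Proof.
move=> h /modes_lt jm; have := kn_dist (R:=R) k j; have := kappa_g_lt_cutoff; have := knN (R:=R) j.
have := kn_dist (R:=R) k (k - j); rewrite subKr; lra.
Qed.

Lemma far_gt0 k : 2 * cutoff%:R < kn k -> 0 < kn k.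
Proof. by apply: le_lt_trans; rewrite mulr_ge0. Qed.

Lemma kn_pow2 k : 0 < kn k -> kn k `^ (2 * beta) = kn k ^+ 2 * kn k `^ (2 * beta - 2).
Proof.
move=> k0; rewrite -powR_mulrn ?ltW// -powRD; first by congr (_ `^ _); ring.
by apply/implyP => _; rewrite gt_eqF.
Qed.

Lemma kn_pow1 k : 0 < kn k -> kn k `^ (2 * beta - 1) = kn k * kn k `^ (2 * beta - 2).
Proof.
move=> k0; rewrite -{2}[kn k]powRr1 ?ltW// -powRD; first by congr (_ `^ _); ring.
by apply/implyP => _; rewrite gt_eqF.
Qed.

(** Replacing |k - j| by |k| costs a relative error O(1 / |k|). What remains is the sum of (k x j)^2
    gamma_j^2, which [cross_sum] evaluates; the factor 1/2 comes from there. *)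
Lemma mean_energy_asymptotics k : 2 * cutoff%:R < kn k ->
  `|spectrum k - U ^+ 2 * source_energy / 2 * kn k `^ (2 * beta - 2)| <=
  U ^+ 2 * source_energy / 2 * shiftC * (kn k `^ (2 * beta - 2) / kn k).
Proof.
move=> kfar; have b20 : 2 * beta <= 0 by have b2 := beta_lt; lra.
have k0 := far_gt0 kfar.
have eE : spectrum k = U ^+ 2 / kn k ^+ 4 * \sum_(j <- modes) cross k j ^+ 2 * gam j ^+ 2 * kn (k - j) `^ (2 * beta).
  rewrite /spectrum /mean_energy mulr_sumr; apply: eq_bigr => j _.
  have -> : kn (k - j) `^ (2 * beta) = (kn (k - j) `^ beta) ^+ 2.
    by rewrite powRXn ?kn_ge0// mulrC.
  by rewrite /coef; field; rewrite gt_eqF.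
have mE : U ^+ 2 * source_energy / 2 * kn k `^ (2 * beta - 2) =
    U ^+ 2 / kn k ^+ 4 * \sum_(j <- modes) cross k j ^+ 2 * gam j ^+ 2 * kn k `^ (2 * beta).
  rewrite -mulr_suml cross_sum kn_pow2//; field; by rewrite gt_eqF.
rewrite eE mE -mulrBr -sumrB normrM ger0_norm; last by rewrite divr_ge0 ?sqr_ge0 ?exprn_ge0// ltW.
apply: (@le_trans _ _ (U ^+ 2 / kn k ^+ 4 * \sum_(j <- modes) cross k j ^+ 2 * gam j ^+ 2 * (shiftC * kn k `^ (2 * beta - 1)))).
  rewrite ler_wpM2l ?divr_ge0 ?sqr_ge0 ?exprn_ge0 ?kn_ge0//.
  apply: le_trans (ler_norm_sum _ _ _) _; rewrite big_seq [leRHS]big_seq; apply: ler_sum => j jm.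
  have c0 : 0 <= cross k j ^+ 2 * gam j ^+ 2 := mulr_ge0 (sqr_ge0 _) (sqr_ge0 _).
  rewrite -mulrBr normrM [`|cross k j ^+ 2 * _|]ger0_norm// ler_wpM2l//.
  have dist : `|kn (k - j) - kn k| <= kappa_g.
    apply: le_trans (ltW (modes_lt jm)); rewrite ler_norml.
    have h1 := kn_dist (R:=R) k j; have h2 := knB (R:=R) k j.
    by rewrite lerBlDl h2 lerBrDr addrC h1.
  have := powR_lipschitz k0 (far_half kfar jm) dist b20.
  rewrite powRM ?kn_ge0 ?invr_ge0// => h; apply: le_trans h _.
  by rewrite /shiftC le_eqVlt; apply/orP; left; apply/eqP; ring.
rewrite -mulr_suml cross_sum kn_pow1// le_eqVlt; apply/orP; left; apply/eqP.
by field; rewrite gt_eqF.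
Qed.

Definition coefC : R := \sum_(j <- modes) U * `|gam j| * kappa_g * 2 `^ (- beta).

Lemma coefC_ge0 : 0 <= coefC.
Proof.
rewrite /coefC big_seq sumr_ge0// => j jm.
by rewrite !mulr_ge0 ?powR_ge0 ?(ltW U_gt0)// (le_trans (kn_ge0 j))// ltW// modes_lt.
Qed.

Lemma coef_sum k : 2 * cutoff%:R < kn k -> \sum_(j <- modes) `|coef k j| <= coefC * kn k `^ (beta - 1).
Proof.
move=> kfar; have b2 := beta_lt; have k0 := far_gt0 kfar.
rewrite /coefC mulr_suml big_seq [leRHS]big_seq; apply: ler_sum => j jm.
have p : kn (k - j) `^ beta <= 2 `^ (- beta) * kn k `^ beta.
  apply: le_trans (powR_antitone _ _ (far_half kfar jm)) _; [lra|by rewrite divr_gt0|].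
  by rewrite powRM ?invr_ge0 ?kn_ge0// mulrC -powR_inv1// -powRrM mulN1r.
have c : `|cross k j| <= kn k * kappa_g.
  by apply: le_trans (cross_le k j) _; rewrite ler_wpM2l ?kn_ge0// ltW// modes_lt.
have e : kn k `^ beta = kn k * kn k `^ (beta - 1).
  rewrite -{2}[kn k]powRr1 ?ltW// -powRD; first by congr (_ `^ _); ring.
  by apply/implyP => _; rewrite gt_eqF.
rewrite /coef !normrM normrN !normrM [`|(kn k ^+ 2)^-1|]ger0_norm ?invr_ge0 ?sqr_ge0//.
rewrite (ger0_norm (powR_ge0 _ _)) (gtr0_norm U_gt0) ler_pdivrMr ?exprn_gt0//.
have -> : U * `|gam j| * kappa_g * 2 `^ (- beta) * kn k `^ (beta - 1) * kn k ^+ 2 =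
   kn k * kappa_g * U * (2 `^ (- beta) * kn k `^ beta) * `|gam j| by rewrite e; ring.
rewrite ler_wpM2r//; apply: ler_pM; rewrite ?mulr_ge0 ?powR_ge0 ?(ltW U_gt0)//.
by rewrite ler_wpM2r ?(ltW U_gt0).
Qed.

Lemma spectrum_le k : 2 * cutoff%:R < kn k -> 0 <= spectrum k <= (coefC * kn k `^ (beta - 1)) ^+ 2.
Proof.
move=> kfar; rewrite /spectrum /mean_energy sumr_ge0//=; last by move=> j _; exact: sqr_ge0.
apply: le_trans (_ : (\sum_(j <- modes) `|coef k j|) ^+ 2 <= _); last first.
  rewrite ler_pXn2r ?nnegrE ?sumr_ge0 ?mulr_ge0 ?coefC_ge0 ?powR_ge0//; exact: coef_sum.
elim: modes => [|j s IH]; first by rewrite !big_nil expr0n.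
rewrite !big_cons sqrrD real_normK ?num_real// -addrA lerD2l.
by apply: le_trans IH _; rewrite lerDr mulrn_wge0// mulr_ge0// sumr_ge0.
Qed.

Lemma source_energy_gt0 j : j \in modes -> 0 < source_energy.
Proof.
move=> jm; have j0 : j != 0 by apply: contraNneq modes0 => <-.
rewrite /source_energy (bigD1_seq j) ?modes_uniq//= ltr_pwDl//.
  apply: mulr_gt0; first by rewrite exprn_gt0// kn_gt0.
  by rewrite exprn_even_gt0//= -modesP.
by apply: sumr_ge0 => i _; apply: mulr_ge0; exact: sqr_ge0.
Qed.

Definition band_mean (kappa : R) : R :=
  U ^+ 2 * source_energy / 2 * (pi * ((4 `^ beta - 1) / beta)) * kappa `^ (2 * beta).

Lemma mean_energy_band : exists2 C : R, 0 <= C & forall (kappa : R) s, 2 * cutoff%:R < kappa -> uniq s ->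
  (forall k, (k \in s) = (kappa <= kn k < 2 * kappa)) ->
  `|\sum_(k <- s) spectrum k - band_mean kappa| <= C * kappa `^ (2 * beta - 1).
Proof.
have b2 := beta_lt; have pp := pi_gt0 R.
pose E := U ^+ 2 * source_energy / 2.
have E0 : 0 <= E.
  rewrite /E divr_ge0// mulr_ge0 ?sqr_ge0// sumr_ge0// => j _.
  by apply: mulr_ge0; exact: sqr_ge0.
pose B := 36 + 6 * pi : R; have B0 : 0 <= B by rewrite /B; lra.
pose L : R := `|pi * ((4 `^ beta - 1) / beta)|.
have L0 : 0 <= L by exact: normr_ge0.
pose D := E * `|shiftC|; have D0 : 0 <= D by rewrite mulr_ge0.
(* [E * B] stems from the error in [band_power_sum]. [D * (L + B)] stems from the shift k - j, of
   relative size D / kappa, applied to a power sum bounded by (L + B) kappa^(2 beta). *)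
exists (E * B + D * (L + B)) => [|kappa s kfar us hs].
  by apply: addr_ge0; apply: mulr_ge0 => //; exact: addr_ge0.
have c1 : 1 <= cutoff%:R :> R by rewrite ler1n.
have k1 : 1 <= kappa by lra.
have k0 : 0 < kappa by lra.
have [a [b [a0 ab ka kb hab]]] := band_annulus k1.
have pm : perm_eq s (annulus a b).
  by apply: uniq_perm => //; [exact: annulus_uniq|move=> k; rewrite hab hs].
rewrite (perm_big _ pm)/=.
have bneg : beta < 0 by lra.
have h1 := band_power_sum bneg k1 a0 ab ka kb.
set S := \sum_(k <- annulus a b) kn k `^ (2 * (beta - 1)) in h1.
have e2 : 2 * (beta - 1) = 2 * beta - 2 by ring.
have h2 : `|\sum_(k <- annulus a b) spectrum k - E * S| <= D / kappa * S.
  rewrite /S !mulr_sumr -sumrB; apply: le_trans (ler_norm_sum _ _ _) _.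
  rewrite big_seq [leRHS]big_seq; apply: ler_sum => k; rewrite hab => /andP[kk _].
  have far : 2 * cutoff%:R < kn k by apply: lt_le_trans kk.
  rewrite e2; apply: le_trans (mean_energy_asymptotics far) _.
  rewrite -/E (_ : D / kappa * _ = E * `|shiftC| * (kn k `^ (2 * beta - 2) / kappa)); last by rewrite /D; ring.
  apply: (@le_trans _ _ (E * `|shiftC| * (kn k `^ (2 * beta - 2) / kn k))).
    by rewrite ler_wpM2r ?divr_ge0 ?powR_ge0 ?kn_ge0// ler_wpM2l// ler_norm.
  by rewrite ler_wpM2l// ler_wpM2l ?powR_ge0// lef_pV2 ?posrE// (lt_le_trans k0).
have q0 := powR_ge0 kappa (2 * beta - 1).
have q1 : kappa `^ (2 * beta) = kappa * kappa `^ (2 * beta - 1).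
  rewrite -{2}[kappa]powRr1 ?ltW// -powRD; first by congr (_ `^ _); ring.
  by apply/implyP => _; rewrite gt_eqF.
rewrite -/B in h1; set T := pi * _ in h1 *.
have S_le : S <= (L + B) * (kappa * kappa `^ (2 * beta - 1)).
  have hB : B * kappa `^ (2 * beta - 1) <= B * (kappa * kappa `^ (2 * beta - 1)).
    by rewrite ler_wpM2l// ler_peMl.
  have hT : T * kappa `^ (2 * beta) <= L * (kappa * kappa `^ (2 * beta - 1)).
    by rewrite q1 ler_wpM2r ?mulr_ge0 ?(ltW k0)// ler_norm.
  have /andP[_ h1'] : - (B * kappa `^ (2 * beta - 1)) <= S - T * kappa `^ (2 * beta) <= B * kappa `^ (2 * beta - 1).
    by rewrite -ler_norml.
  rewrite mulrDl -[S](subrK (T * kappa `^ (2 * beta))) addrC; apply: lerD => //.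
  exact: le_trans h1' hB.
have h3 : D / kappa * S <= D * (L + B) * kappa `^ (2 * beta - 1).
  apply: le_trans (ler_wpM2l _ S_le) _; first by rewrite divr_ge0// ltW.
  by rewrite le_eqVlt; apply/orP; left; apply/eqP; field; rewrite gt_eqF.
have h4 : `|E * S - band_mean kappa| <= E * B * kappa `^ (2 * beta - 1).
  rewrite /band_mean -/E -/T (_ : _ - _ = E * (S - T * kappa `^ (2 * beta))); last by ring.
  by rewrite normrM (ger0_norm E0) -mulrA ler_wpM2l.
have -> : \sum_(k <- annulus a b) spectrum k - band_mean kappa =
    (E * S - band_mean kappa) + (\sum_(k <- annulus a b) spectrum k - E * S) by ring.
by apply: le_trans (ler_normD _ _) _; rewrite mulrDl; apply: lerD => //; exact: le_trans h2 h3.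
Qed.

End interaction_coefficients.

(** Here p and q stand for (m+1)^4 and m^4, kept abstract so that the problem is linear. *)
Lemma fourth_power_gap (a b p q : nat) : (b < p)%N -> (4 * a < b + 4)%N -> (p + 4 <= 4 * q)%N ->
  (a < q)%N.
Proof. lia. Qed.

Section shell_size.
Context {R : realType}.

(** The area is pi ((m+1)^4 - m^4), about 4 pi m^3, and the errors of the circle problem are 6 m^2
    and 6 (m+1)^2; from m = 7 on the area dominates with room to spare. *)
Lemma size_shell_bounds (m : nat) : (7 <= m)%N ->
  m%:R ^+ 3 <= (size (shell m))%:R :> R /\ (size (shell m))%:R <= 108 * m%:R ^+ 3 :> R.
Proof.
move=> m7; have m7' : 7 <= m%:R :> R by rewrite ler_nat.
have le4 : (m ^ 4 <= m.+1 ^ 4)%N by rewrite leq_exp2r.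
rewrite size_annulus//.
have sq (n : nat) : Num.sqrt (n ^ 4)%N%:R = n%:R ^+ 2 :> R.
  by rewrite natrX (_ : 4 = 2 * 2)%N// exprM sqrtr_sqr ger0_norm// sqr_ge0.
have := disc_count_le (R:=R) (m.+1 ^ 4); have := disc_count_le (R:=R) (m ^ 4).
rewrite !sq !natrX -natr1; set x := m%:R in m7' *.
rewrite !ler_norml => /andP[h1 h2] /andP[h3 h4].
have p2 := pi_ge2 R; have p4 : pi <= 4 :> R by have := pihalf_lt2 R; lra.
have dx : (x + 1) ^+ 4 - x ^+ 4 = 4 * x ^+ 3 + 6 * x ^+ 2 + 4 * x + 1 by ring.
have d0 : 0 <= (x + 1) ^+ 4 - x ^+ 4 by rewrite dx; nra.
have l1 : 2 * ((x + 1) ^+ 4 - x ^+ 4) <= pi * ((x + 1) ^+ 4 - x ^+ 4) by rewrite ler_wpM2r.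
have l2 : pi * ((x + 1) ^+ 4 - x ^+ 4) <= 4 * ((x + 1) ^+ 4 - x ^+ 4) by rewrite ler_wpM2r.
have c1 : 7 * x ^+ 2 <= x ^+ 3 by rewrite [x ^+ 3]exprS ler_wpM2r ?sqr_ge0.
have c2 : 7 * x <= x ^+ 2 by rewrite expr2 ler_wpM2r//; lra.
by rewrite dx in l1 l2; split; lra.
Qed.

End shell_size.

(** * The variance of the band energy *)

Section band_variance.
Context {d : measure_display} {Omega : measurableType d} {R : realType}.
Variable P : probability Omega R.
Variables phi xi : Z2 -> {RV P >-> R}.
Hypothesis phases : random_phases phi xi.
Variables (beta kappa_g U rho : R) (gamma : R -> R).
Hypotheses (beta_lt : beta < -2) (U_gt0 : 0 < U) (gamma0 : gamma 0 = 0).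
Hypothesis gamma_high : forall kappa, kappa_g <= kappa -> gamma kappa = 0.
Hypothesis rho_itv : 0 < rho <= 4^-1.

Local Notation kn := (@knorm R).
Local Notation Ex := (@Ex d Omega R P).
Local Notation modes := (modes kappa_g gamma).
Local Notation cutoff := (cutoff kappa_g).
Local Notation coef := (coef beta U gamma).
Local Notation spectrum := (spectrum beta kappa_g U gamma).
Local Notation coefC := (coefC beta kappa_g U gamma).
Local Notation shiftC := (shiftC beta kappa_g).
Local Notation source_energy := (source_energy kappa_g gamma).

Definition correction k w : R[i] := amplitude phi xi modes coef k w.

Definition correction_energy k w : R := cmod2 (correction k w).

Lemma correction_energy_ge0 k w : 0 <= correction_energy k w.
Proof. by rewrite /correction_energy -nc_sqr sqr_ge0. Qed.

Lemma bmeas_correction_energy k : bmeas (correction_energy k).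
Proof.
have [ar ai] := cbmeas_amplitude phi xi modes coef k.
by apply: bmeasD; exact: bmeasX.
Qed.

Lemma correction_energy_le k w : 2 * cutoff%:R < kn k ->
  correction_energy k w <= (coefC * kn k `^ (beta - 1)) ^+ 2.
Proof.
move=> far; rewrite /correction_energy -nc_sqr ler_pXn2r ?nnegrE ?nc_ge0 ?mulr_ge0 ?powR_ge0//; last first.
  exact: coefC_ge0.
apply: le_trans (nc_sum _ _ _) _; apply: le_trans (coef_sum beta_lt U_gt0 gamma_high far).
apply: ler_sum => j _; rewrite !ncM nc_real.
by rewrite /character !nc_expi !mulr1.
Qed.

Lemma fluctuation_le k w : 2 * cutoff%:R < kn k ->
  `|correction_energy k w - spectrum k| <= (coefC * kn k `^ (beta - 1)) ^+ 2.
Proof.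
move=> far; have h1 := correction_energy_le w far; have h2 := correction_energy_ge0 k w.
have /andP[h3 h4] := spectrum_le beta_lt U_gt0 gamma_high far.
by rewrite ler_norml; apply/andP; split; lra.
Qed.

Local Notation excess := (excess correction_energy spectrum).

Lemma excess_fourth (Q : seq Z2) (r n : R) : uniq Q -> 0 < r -> 2 * cutoff%:R < r ->
  (forall k, k \in Q -> r <= kn k) -> (size Q)%:R <= n ->
  Ex (fun w => excess Q w ^+ 4) <=
    (2 * @near_count R cutoff * n * ((coefC + 1) * r `^ (beta - 1)) ^+ 4) ^+ 2.
Proof.
move=> uQ r0 rfar Qr Qn; have b2 := beta_lt.
have C0 : 0 <= coefC by exact: coefC_ge0.
set W := (coefC + 1) * r `^ (beta - 1).
have W0 : 0 <= W by rewrite mulr_ge0 ?powR_ge0 ?addr_ge0.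
have out k : k \in Q -> k \notin box cutoff.
  by move=> /Qr kr; apply: far_out; exact: lt_le_trans kr.
have FB k w : k \in Q -> `|fluctuation phi xi modes coef k w| <= W ^+ 2.
  move=> /Qr kr; apply: le_trans (fluctuation_le w (lt_le_trans rfar kr)) _.
  have c0 : 0 <= coefC * kn k `^ (beta - 1) by rewrite mulr_ge0 ?powR_ge0.
  rewrite ler_pXn2r ?nnegrE//; apply: ler_pM; rewrite ?powR_ge0 ?lerDl//.
  by apply: powR_antitone => //; lra.
have := fourth_moment phases (modes_box (kappa_g:=kappa_g) (gamma:=gamma)) (modes_uniq kappa_g gamma)
  (modes0 gamma0 gamma_high) (sqr_ge0 W) uQ out FB => /le_trans; apply.
have nc0 : 0 <= @near_count R cutoff by rewrite mulr_ge0.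
have n0 : 0 <= n by apply: le_trans Qn.
apply: (@le_trans _ _ (4 * (near_count cutoff * n) ^+ 2 * (W ^+ 2) ^+ 4)); last first.
  by rewrite le_eqVlt; apply/orP; left; apply/eqP; ring.
rewrite ler_wpM2r ?exprn_ge0 ?sqr_ge0//; apply: ler_pM; rewrite ?sqr_ge0 ?ler_nat//.
by rewrite ler_pXn2r ?nnegrE ?mulr_ge0// ler_wpM2l.
Qed.

(** Shell m starts at |k| = m^2, so with kappa = x^2 the band ends lie in shells with m near x and
    near sqrt 2 x. *)
Lemma band_shells (kappa x : R) a b : 8 <= x -> kappa = x ^+ 2 ->
  kappa ^+ 2 <= a%:R < kappa ^+ 2 + 1 -> 4 * kappa ^+ 2 <= b%:R < 4 * kappa ^+ 2 + 1 ->
  exists m1 m2 : nat, [/\ (m1 < m2)%N, (m1 ^ 4 <= a <= m1.+1 ^ 4)%N, (m2 ^ 4 <= b <= m2.+1 ^ 4)%N,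
    (7 <= m1)%N & x / 2 <= m1%:R :> R /\ m2%:R <= 2 * x].
Proof.
move=> x8 -> /andP[ka1 ka2] /andP[kb1 kb2].
have [m1 /andP[a1 a2]] := root4_exists a; have [m2 /andP[b1 b2]] := root4_exists b.
have x4 : x ^+ 2 ^+ 2 = x ^+ 4 by ring.
rewrite x4 in ka1 ka2 kb1 kb2.
have lm1 : x < m1%:R + 1.
  have x0 : 0 <= x by lra.
  rewrite -(@ltr_pXn2r _ 4)// ?nnegrE ?addr_ge0// natr1 -natrX.
  by apply: le_lt_trans ka1 _; rewrite ltr_nat.
have m7 : (7 <= m1)%N.
  by rewrite -ltnS -(ltr_nat R) -[m1.+1%:R]natr1; lra.
have lm2 : m2%:R <= 2 * x.
  have x0 : 0 <= 2 * x by lra.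
  rewrite -(@ler_pXn2r _ 4)// ?nnegrE// -natrX; apply: (@le_trans _ _ b%:R); first by rewrite ler_nat.
  have x1 : 1 <= x ^+ 4 by rewrite exprn_ege1//; lra.
  by rewrite exprMn -natrX (_ : (2 ^ 4)%N%:R = 16) //; lra.
exists m1, m2; split; [|by rewrite a1 ltnW|by rewrite b1 ltnW|by []|by split; lra].
(* If both ends fell in the same shell, b would be below (m1+1)^4, whereas b > 4a - 4 >= 4 m1^4 - 4;
   this is impossible for m1 >= 7. *)
rewrite ltnNge; apply/negP => m21.
have h1 : (b < m1.+1 ^ 4)%N by apply: leq_trans b2 _; rewrite leq_exp2r.
have h2 : (4 * a < b + 4)%N by rewrite -(ltr_nat R) natrM natrD; lra.
have h3 : (m1.+1 ^ 4 + 4 <= 4 * m1 ^ 4)%N.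
  rewrite -(ler_nat R) natrD natrM !natrX -natr1.
  have : 7 <= m1%:R :> R by rewrite ler_nat.
  set y := m1%:R => y7.
  have c1 : 7 * y ^+ 3 <= y ^+ 4 by rewrite [y ^+ 4]exprS ler_wpM2r ?exprn_ge0//; lra.
  have c2 : 7 * y ^+ 2 <= y ^+ 3 by rewrite [y ^+ 3]exprS ler_wpM2r ?sqr_ge0.
  have c3 : 7 * y <= y ^+ 2 by rewrite expr2 ler_wpM2r//; lra.
  have -> : (y + 1) ^+ 4 = y ^+ 4 + 4 * y ^+ 3 + 6 * y ^+ 2 + 4 * y + 1 by ring.
  by lra.
by have := fourth_power_gap h1 h2 h3; rewrite ltnNge a1.
Qed.

Lemma shell_mean_ge (r tau : R) m : (7 <= m)%N ->
  (forall k, k \in shell m -> tau <= spectrum k) -> 0 <= tau -> 0 <= r -> r <= m%:R ->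
  r ^+ 3 * tau <= \sum_(k <- shell m) spectrum k.
Proof.
move=> m7 te t0 r0 rm; apply: (@le_trans _ _ (\sum_(k <- shell m) tau)).
  rewrite big_const_seq count_predT iter_addr_0 -[_ *+ _]mulr_natl ler_wpM2r//.
  have [h _] := size_shell_bounds (R:=R) m7; apply: le_trans h.
  by rewrite ler_pXn2r ?nnegrE.
by rewrite big_seq [leRHS]big_seq; apply: ler_sum => k; exact: te.
Qed.

Lemma mean_energy_ge k : 2 * cutoff%:R < kn k -> 2 * `|shiftC| <= kn k ->
  U ^+ 2 * source_energy / 4 * kn k `^ (2 * beta - 2) <= spectrum k.
Proof.
move=> far sk; have k0 : 0 < kn k by exact: far_gt0 far.
have := mean_energy_asymptotics U beta_lt gamma_high far.
set E := U ^+ 2 * source_energy; set p := kn k `^ _ => h.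
have E0 : 0 <= E.
  rewrite /E mulr_ge0 ?sqr_ge0// sumr_ge0// => j _.
  by apply: mulr_ge0; exact: sqr_ge0.
have p0 : 0 <= p by exact: powR_ge0.
have sh : shiftC / kn k <= 2^-1.
  by rewrite ler_pdivrMr//; apply: le_trans (ler_norm _) _; lra.
have bound : E / 2 * shiftC * (p / kn k) <= E / 4 * p.
  rewrite (_ : _ * _ = E / 2 * p * (shiftC / kn k)); last by ring.
  rewrite (_ : E / 4 * p = E / 2 * p * 2^-1); last by field.
  by rewrite ler_wpM2l// mulr_ge0// divr_ge0.
have /andP[h1 _] : - (E / 4 * p) <= spectrum k - E / 2 * p <= E / 4 * p.
  by rewrite -ler_norml; exact: le_trans bound.
have -> : E / 4 * p = E / 2 * p - E / 4 * p by field.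
lra.
Qed.

Local Notation comp := (compensated correction_energy spectrum rho).

Lemma band_variance j : j \in modes -> exists2 K : R * R, 64 <= K.1 /\ 0 <= K.2 &
  forall (x : R) (s : seq Z2), K.1 <= x ^+ 2 -> 8 <= x -> uniq s ->
  (forall k, (k \in s) = (x ^+ 2 <= kn k < 2 * x ^+ 2)) ->
  Ex (fun w => (\sum_(k <- s) comp k w - \sum_(k <- s) spectrum k) ^+ 2) <=
  K.2 * (x ^+ 3 * ((x ^+ 2) `^ (2 * beta - 2)) ^+ 2).
Proof.
move=> jm; have b2 := beta_lt; have /andP[rho0 _] := rho_itv.
have G0 := source_energy_gt0 gamma0 gamma_high jm.
have kg0 : 0 < kappa_g by apply: le_lt_trans (kn_ge0 j) (modes_lt gamma_high jm).
have sC0 : 0 <= `|shiftC| by exact: normr_ge0.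
have cC0 : 0 <= coefC by exact: coefC_ge0.
(* All wavenumbers in the shells met by the band satisfy |k| >= kappa / 4, so this threshold puts
   them beyond the cutoff and makes the relative error of the spectrum at most 1/2. *)
pose k0 : R := 64 + 8 * cutoff%:R + 8 * `|shiftC|.
have cut0 : 0 <= cutoff%:R :> R by [].
have k0_le z : k0 <= z -> 2 * cutoff%:R < z / 4 /\ 2 * `|shiftC| <= z / 4.
  by rewrite /k0 => h; split; lra.
have r20 : 2 * beta - 2 <= 0 by lra.
pose nc : R := @near_count R cutoff.
have nc0 : 0 < nc by rewrite /nc /near_count mulr_gt0// ltr0n size_box.
pose wC : R := (coefC + 1) ^+ 4 * (4^-1 `^ (2 * beta - 2)) ^+ 2.
have wC0 : 0 < wC by rewrite mulr_gt0 ?exprn_gt0 ?powR_gt0 ?invr_gt0// ltr_wpDl.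
(* Since 108 m^3 <= 864 x^3 for m <= 2 x, 864 bounds the number of points of a shell; [wC] collects
   the fourth power of the amplitude at |k| = kappa / 4. *)
pose vC : R := 2 * nc * 864 * wC.
have vC0 : 0 < vC.
  apply: mulr_gt0 wC0; apply: mulr_gt0; last exact: (@ltr0n R 864).
  by apply: mulr_gt0 nc0; exact: (@ltr0n R 2).
(* A lower bound for the energy of a shell: at least (x / 2)^3 points, each with at least the
   spectrum bound of [mean_energy_ge] at |k| = 9 kappa. *)
pose tC : R := 8^-1 * (U ^+ 2 * source_energy / 4 * 9 `^ (2 * beta - 2)).
have tC0 : 0 < tC.
  apply: mulr_gt0; first by rewrite invr_gt0.
  apply: mulr_gt0; last by rewrite powR_gt0.
  by rewrite divr_gt0// mulr_gt0// exprn_gt0.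
exists (k0, 24 * vC + 3 * (2 * vC / (rho * tC)) ^+ 2) => /=.
  split; first by rewrite /k0; lra.
  by apply: addr_ge0; apply: mulr_ge0; rewrite ?sqr_ge0 ?(ltW vC0) ?(ler0n R 24) ?(ler0n R 3).
move=> x s xk x8 us hs.
pose kappa := x ^+ 2; have x0 : 0 < x by lra.
have kp : 0 < kappa by rewrite exprn_gt0.
have k1 : 1 <= kappa by apply: le_trans xk; rewrite /k0; lra.
have [a [b [a0 ab ka kb hab]]] := band_annulus k1.
have pm : perm_eq s (annulus a b).
  by apply: uniq_perm => //; [exact: annulus_uniq|move=> k; rewrite hab hs].
have [m1 [m2 [m12 am bm m7 [xm1 xm2]]]] := band_shells x8 (erefl kappa) ka kb.
pose y := kappa `^ (2 * beta - 2); have y0 : 0 < y by rewrite powR_gt0.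
have m2x : m2%:R + 1 <= 3 * x by lra.
have kn_lo m k : (m1 <= m)%N -> k \in shell m -> kappa / 4 <= kn k.
  move=> mm; rewrite annulusP => /andP[km _].
  have h : (m1%:R ^+ 2) ^+ 2 <= kn k ^+ 2.
    by rewrite kn_nsq -exprM -natrX ler_nat; apply: leq_trans km; rewrite leq_exp2r.
  rewrite ler_pXn2r ?nnegrE ?kn_ge0 ?sqr_ge0// in h; apply: le_trans h.
  have -> : kappa / 4 = (x / 2) ^+ 2 by rewrite /kappa; field.
  by rewrite ler_pXn2r ?nnegrE//; lra.
have kn_hi m k : (m <= m2)%N -> k \in shell m -> kn k <= 9 * kappa.
  move=> mm; rewrite annulusP => /andP[_ km].
  have h : kn k ^+ 2 <= ((m2%:R + 1) ^+ 2) ^+ 2.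
    rewrite kn_nsq -exprM natr1 -natrX ler_nat; apply: leq_trans (ltnW km) _.
    by rewrite leq_exp2r.
  have m0 : 0 <= (m2%:R + 1) ^+ 2 :> R by exact: sqr_ge0.
  rewrite ler_pXn2r ?nnegrE ?kn_ge0// in h; apply: le_trans h _.
  have -> : 9 * kappa = (3 * x) ^+ 2 by rewrite /kappa; ring.
  have m0' : 0 <= m2%:R + 1 :> R by rewrite addr_ge0.
  by rewrite ler_pXn2r ?nnegrE//; lra.
have far k : kappa / 4 <= kn k -> 2 * cutoff%:R < kn k /\ 2 * `|shiftC| <= kn k.
  by have [h1 h2] := k0_le _ xk => h; split; [exact: lt_le_trans h|exact: le_trans h].
have m7' m : (m1 <= m)%N -> (7 <= m)%N by apply: leq_trans.
have size_le m (Q : seq Z2) : (m1 <= m <= m2)%N -> uniq Q -> {subset Q <= shell m} -> (size Q)%:R <= 864 * x ^+ 3.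
  move=> /andP[h1 h2] uQ Qm; apply: (@le_trans _ _ (size (shell m))%:R).
    by rewrite ler_nat uniq_leq_size.
  have [_ h] := size_shell_bounds (R:=R) (m7' m h1); apply: le_trans h _.
  have -> : 864 * x ^+ 3 = 108 * (2 * x) ^+ 3 by ring.
  have mm : m%:R <= m2%:R :> R by rewrite ler_nat.
  have x20 : 0 <= 2 * x by rewrite mulr_ge0 ?(ltW x0).
  rewrite ler_wpM2l ?(ler0n R 108)// ler_pXn2r ?nnegrE//.
  exact: le_trans mm xm2.
pose V := vC * (x ^+ 3 * y ^+ 2).
have xy0 : 0 < x ^+ 3 * y by rewrite mulr_gt0// exprn_gt0.
have V0 : 0 < V by rewrite mulr_gt0// mulr_gt0 ?exprn_gt0.
have H4 m Q : (m1 <= m <= m2)%N -> uniq Q -> {subset Q <= shell m} ->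
    Ex (fun w => excess Q w ^+ 4) <= V ^+ 2.
  move=> hm uQ Qm; have /andP[h1 h2] := hm.
  have r0 : 0 < kappa / 4 by rewrite divr_gt0.
  have [rfar _] := k0_le _ xk.
  apply: le_trans (excess_fourth uQ r0 rfar (fun k kQ => kn_lo m k h1 (Qm k kQ)) (size_le m Q hm uQ Qm)) _.
  rewrite -/nc (_ : _ * _ ^+ 4 = V)// /V /vC /wC exprMn.
  have -> : (kappa / 4) `^ (beta - 1) ^+ 4 = (4^-1 `^ (2 * beta - 2)) ^+ 2 * y ^+ 2.
    rewrite -exprMn /y -powRM ?invr_ge0 ?(ltW kp)// [4^-1 * _]mulrC !powRXn ?(ltW r0)//.
    by congr (_ `^ _); ring.
  by ring.
pose tau := tC * (x ^+ 3 * y).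
have t0 : 0 < tau by exact: mulr_gt0.
have tE m : (m1 < m < m2)%N -> tau <= \sum_(k <- shell m) spectrum k.
  move=> /andP[/ltnW h1 /ltnW h2].
  have xm : x / 2 <= m%:R by apply: le_trans xm1 _; rewrite ler_nat.
  pose t1 := U ^+ 2 * source_energy / 4 * (9 `^ (2 * beta - 2) * y).
  have t10 : 0 <= t1 by rewrite !mulr_ge0 ?powR_ge0 ?sqr_ge0 ?(ltW G0)// ltW.
  have -> : tau = (x / 2) ^+ 3 * t1 by rewrite /tau /tC /t1; field.
  apply: shell_mean_ge => //; [exact: m7'| |exact: divr_ge0 (ltW x0) (ler0n R 2)].
  move=> k km; have lo := kn_lo m k h1 km; have hi := kn_hi m k h2 km.
  have [f1 f2] := far k lo; apply: le_trans (mean_energy_ge f1 f2).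
  have kk : 0 < kn k by apply: far_gt0 f1.
  have E40 : 0 <= U ^+ 2 * source_energy / 4.
    by rewrite divr_ge0// mulr_ge0 ?(ltW G0)// sqr_ge0.
  rewrite /t1 /y -(powRM _ (ler0n R 9) (ltW kp)); apply: (ler_wpM2l E40).
  exact: powR_antitone.
have := band_deviation correction_energy_ge0 bmeas_correction_energy rho_itv m12 am bm V0 t0 tE H4.
rewrite (_ : (fun w => (\sum_(k <- s) _ - _) ^+ 2) = (fun w => (\sum_(k <- annulus a b) comp k w - \sum_(k <- annulus a b) spectrum k) ^+ 2)); last first.
  by apply/funext => w; rewrite !(perm_big _ pm).
move=> /le_trans; apply.
rewrite -/kappa -/y (_ : _ * (x ^+ 3 * y ^+ 2) = 24 * V + 3 * (2 * vC / (rho * tC)) ^+ 2 * (x ^+ 3 * y ^+ 2)); last by rewrite /V; ring.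
rewrite lerD2l.
have dm : (m2 - m1)%:R <= 2 * x :> R.
  by apply: le_trans xm2; rewrite ler_nat leq_subr.
have e1 : V / (rho * tau) = vC / (rho * tC) * y.
  rewrite /V /tau; field; rewrite !gt_eqF ?exprn_gt0//.
rewrite e1 -/y; apply: (@le_trans _ _ (3 * (2 * x * (vC / (rho * tC) * y)) ^+ 2)).
  have c0 : 0 <= vC / (rho * tC) * y.
    by apply: mulr_ge0 (ltW y0); apply: divr_ge0 (ltW vC0) (ltW _); exact: mulr_gt0.
  apply: ler_wpM2l; first exact: (ler0n R 3).
  have l1 := ler_wpM2r c0 dm; have l0 := mulr_ge0 (ler0n R (m2 - m1)) c0.
  by rewrite ler_pXn2r// nnegrE; exact: le_trans l1.
(* The inner shells give only x^2 y^2, which x >= 1 absorbs into the x^3 y^2 of the two cut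
   shells. *)
rewrite (_ : 3 * (2 * x * _) ^+ 2 = 3 * (2 * vC / (rho * tC)) ^+ 2 * (x ^+ 2 * y ^+ 2)); last by ring.
have q0 : 0 <= 3 * (2 * vC / (rho * tC)) ^+ 2 by apply: mulr_ge0 (sqr_ge0 _); exact: (ler0n R 3).
apply: (ler_wpM2l q0); apply: ler_wpM2r; first exact: sqr_ge0.
by rewrite [x ^+ 3]exprS ler_peMl ?sqr_ge0//; apply: le_trans x8; exact: (ler1n R 8).
Qed.

End band_variance.

(** * The decomposition *)

Section physical_fields.
Context {R : realType}.
Variables (beta kappa_g U : R) (gamma : R -> R) (phi xi : Z2 -> R).
Hypotheses (beta_lt : beta < -2) (kappa_g_gt0 : 0 < kappa_g) (U_ge0 : 0 <= U) (gamma0 : gamma 0 = 0).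
Hypothesis gamma_high : forall kappa, kappa_g <= kappa -> gamma kappa = 0.

Local Notation kn := (@knorm R).
Local Notation psi := (stream beta U phi).
Local Notation g := (source gamma xi).

Lemma stream_decays : decays beta U psi.
Proof.
split; first by rewrite /stream eqxx.
move=> j j0; rewrite /stream (negbTE j0) ncM nc_real nc_expi mulr1 ger0_norm//.
by rewrite mulr_ge0 ?powR_ge0.
Qed.

Lemma stream_real : (forall k, k != 0 -> expi (phi (- k)) = conjc (expi (phi k))) -> real_valued psi.
Proof.
move=> h k; rewrite /stream oppr_eq0; case: eqP => [_|/eqP k0]; first by rewrite /conjc /= oppr0.
by rewrite h// knN conjM; congr (_ * _); rewrite /real_complex_def /conjc oppr0.
Qed.

Lemma source_real : (forall k, k != 0 -> expi (xi (- k)) = conjc (expi (xi k))) -> real_valued g.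
Proof.
move=> h k; have [->|k0] := eqVneq k 0.
  by rewrite oppr0 /source kn0 gamma0 mul0r oppr0 mul0r /conjc /= oppr0.
by rewrite /source h// knN conjM conjN; congr (- _ * _); rewrite /real_complex_def /conjc oppr0.
Qed.

(** The source has only wavenumbers below [kappa_g], where |k|^(beta-1) >= kappa_g^(beta-1); this is
    the origin of the power of [kappa_g] in the final constant. *)
Lemma base_decays (a : R) : 0 <= a -> (forall j, `|gamma (kn j)| <= a) ->
  decays (beta - 1) (a * kappa_g `^ (1 - beta)) (\- lap_inv g).
Proof.
move=> a0 ha; split; first by rewrite /= /lap_inv eqxx oppr0.
move=> j j0 /=; rewrite ncN lap_inv_source// ncM nc_real nc_expi mulr1.
have b2 := beta_lt; have [jk|/gamma_high ->] := ltP (kn j) kappa_g; last first.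
  by rewrite normr0 !mulr_ge0 ?powR_ge0.
rewrite -mulrA; apply: le_trans (ha j) _; rewrite ler_peMr//.
apply: (@le_trans _ _ (kappa_g `^ (1 - beta) * kappa_g `^ (beta - 1))).
  rewrite -powRD; last by apply/implyP => _; rewrite gt_eqF.
  by rewrite addrA subrK subrr powRr0.
rewrite ler_wpM2l ?powR_ge0//; apply: powR_antitone; [lra|exact: kn_gt0|exact: ltW].
Qed.

Lemma first_correction K a k : abs_bounded (wt beta) K -> 0 <= a -> (forall j, `|gamma (kn j)| <= a) ->
  lap_inv (advect (perp_grad psi) (\- lap_inv g)) k =
  \sum_(j <- modes kappa_g gamma) (coef beta U gamma k j)%:C * (expi (phi (k - j)) * expi (xi j)).
Proof.
move=> wK a0 ha; have b2 := beta_lt.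
have A0 : 0 <= a * kappa_g `^ (1 - beta) by rewrite mulr_ge0 ?powR_ge0.
rewrite /lap_inv; case: eqP => [->|/eqP k0].
  rewrite big1// => j _; rewrite /coef /cross /= !mul0r subrr !mul0r oppr0 mul0r.
  by rewrite mul0r.
rewrite (advectE beta_lt U_ge0 wK k A0 stream_decays (base_decays a0 ha)).
rewrite (csum_finite (modes_uniq kappa_g gamma)); last first.
  move=> j; rewrite modesP// negbK => /eqP gj.
  by rewrite /adv_term /= -/(lap_inv g j) lap_inv_source// gj mul0r oppr0 mulr0.
rewrite mulr_sumr; apply: eq_bigr => j _.
rewrite /adv_term /= -/(lap_inv g j) lap_inv_source// /stream.
(* At k = j the stream function is set to 0, in agreement with the general formula because 0 raised
   to a nonzero power is 0. *)
have -> : (if k - j == 0 then 0 else (U * kn (k - j) `^ beta)%:C * expi (phi (k - j))) =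
    (U * kn (k - j) `^ beta)%:C * expi (phi (k - j)).
  by case: eqP => // ->; rewrite kn0 powR0 ?mulr0 ?mul0r// lt_eqF//; lra.
rewrite /coef; move: (expi _) (expi _) => [a1 a2] [b1 b3].
by apply/eqP; rewrite eq_complex /=; apply/andP; split; apply/eqP; ring.
Qed.

End physical_fields.

(** * Energy of a decaying field in a band *)

Section band_bound.
Context {R : realType}.

(** Each coefficient of the band contributes at most B^2 kappa^(2 beta - 2), and a nonempty band has
    at most (6 kappa)^2 wavenumbers. *)
Lemma band_energy_decays (beta B kappa : R) (f : field R) : beta < -2 -> 0 <= B ->
  decays (beta - 1) B f -> 0 < kappa ->
  band_energy kappa f <= 36 * B ^+ 2 * kappa `^ (2 * beta).
Proof.
move=> b2 B0 [f0 fB] k0; have [s us hs] := band_seq kappa.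
have e0 : 0 <= kappa `^ (2 * beta - 2) by exact: powR_ge0.
have ke : kappa `^ (2 * beta) = kappa ^+ 2 * kappa `^ (2 * beta - 2).
  rewrite -(powR_mulrn _ (ltW k0)) -powRD; first by congr (_ `^ _); ring.
  by apply/implyP => _; rewrite gt_eqF.
rewrite (band_energyE _ us hs).
have term k : k \in s -> cmod2 (f k) <= B ^+ 2 * kappa `^ (2 * beta - 2).
  rewrite hs => /andP[h _]; have kn0' : k != 0.
    by apply: contraTneq h => ->; rewrite kn0 -ltNge.
  rewrite -nc_sqr; apply: (@le_trans _ _ ((B * knorm k `^ (beta - 1)) ^+ 2)).
    by rewrite ler_pXn2r ?nnegrE ?nc_ge0 ?mulr_ge0 ?powR_ge0// fB.
  rewrite exprMn ler_wpM2l ?sqr_ge0// powRXn ?kn_ge0//.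
  rewrite (_ : (beta - 1) * 2%:R = 2 * beta - 2); last by ring.
  by apply: powR_antitone => //; lra.
apply: (@le_trans _ _ ((size s)%:R * (B ^+ 2 * kappa `^ (2 * beta - 2)))).
  rewrite mulr_natl -(iter_addr_0 (size s)) -count_predT -big_const_seq.
  by rewrite big_seq [leRHS]big_seq; apply: ler_sum => k /term.
rewrite (_ : 36 * _ * _ = 36 * kappa ^+ 2 * (B ^+ 2 * kappa `^ (2 * beta - 2))); last by rewrite ke; ring.
apply: ler_wpM2r; first by apply: mulr_ge0 (sqr_ge0 _) e0.
(* The bound holds for all kappa > 0 because a band that contains a lattice point has 2 kappa >= 1;
   this absorbs the 1 in the box side 2 N + 1. *)
case: s us hs term => [|k s] us hs _; first by apply: mulr_ge0 (sqr_ge0 _); exact: (ler0n R 36).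
have kap2 : 1 <= 2 * kappa.
  have : k \in k :: s by rewrite mem_head.
  rewrite hs => /andP[h1 h2].
  have kn0' : k != 0 by apply: contraTneq h1 => ->; rewrite kn0 -ltNge.
  exact: le_trans (kn_ge1 kn0') (ltW h2).
pose N := Num.truncn (2 * kappa).
have k20 : 0 <= 2 * kappa by lra.
have NK : N%:R <= 2 * kappa by have /andP[] := truncn_itv k20.
have sub : {subset k :: s <= box N}.
  move=> j; rewrite hs => /andP[_ h].
  have tr (x : int) : `|x%:~R : R| <= knorm j -> (`|x| <= N)%N.
    move=> hx; rewrite -ltnS -(ltr_nat R) natr_absz intr_norm; apply: le_lt_trans hx _.
    exact: lt_trans h (truncnS_gt _).
  by rewrite boxP !tr// knE; [exact: (@Im_le_nc R (_ +i* _))|exact: (@Re_le_nc R (_ +i* _))].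
have := uniq_leq_size us sub; rewrite size_box -(ler_nat R) => /le_trans; apply.
have -> : 36 * kappa ^+ 2 = (6 * kappa) * (6 * kappa) by ring.
have n1 : (2 * N).+1%:R <= 6 * kappa by rewrite -natr1 natrM; lra.
by rewrite natrM; apply: ler_pM.
Qed.

(** The shells make x = sqrt kappa the natural variable; the errors found in it are O(1 / x). *)
Lemma cvg0_of_sqrt (eps : R -> R) (D X : R) : 0 <= D ->
  (forall x, X <= x -> 0 < x -> `|eps (x ^+ 2)| <= D / x) -> eps x @[x --> +oo] --> (0 : R).
Proof.
move=> D0 h; apply/cvgrPdist_lt => e e0; near=> kappa.
pose x := Num.sqrt kappa.
have kp : 0 < kappa by near: kappa; exact: nbhs_pinfty_gt.
have x0 : 0 < x by rewrite sqrtr_gt0.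
have xE : kappa = x ^+ 2 by rewrite sqr_sqrtr// ltW.
have big y : 0 <= y -> y ^+ 2 < kappa -> y < x.
  by move=> y0; rewrite xE ltr_pXn2r ?nnegrE ?(ltW x0).
have xX : `|X| < x by apply: big => //; near: kappa; apply: nbhs_pinfty_gt; exact: num_real.
have xD : D / e < x.
  by apply: big; [rewrite divr_ge0// ltW|near: kappa; apply: nbhs_pinfty_gt; exact: num_real].
rewrite sub0r normrN {1}xE; apply: le_lt_trans (h x _ x0) _.
  by apply: ltW; apply: le_lt_trans xX; exact: ler_norm.
by rewrite ltr_pdivrMr// mulrC -ltr_pdivrMr.
Unshelve. all: by end_near.
Qed.

End band_bound.

(** * Measurability of the random fields *)

Section measurable_fields.
Context {d : measure_display} {Omega : measurableType d} {R : realType}.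
Implicit Types (Z V : Omega -> R[i]).

Definition cmeas Z := measurable_fun [set: Omega] (fun w => complex.Re (Z w)) /\
  measurable_fun [set: Omega] (fun w => complex.Im (Z w)).

Lemma cbmeas_cmeas Z : cbmeas Z -> cmeas Z.
Proof. by move=> [[? _] [? _]]; split. Qed.

Lemma cmeas_cst (z : R[i]) : cmeas (fun=> z).
Proof. by split; exact: measurable_cst. Qed.

Lemma cmeasD Z V : cmeas Z -> cmeas V -> cmeas (fun w => Z w + V w).
Proof.
move=> [zr zi] [vr vi]; split.
  by rewrite (_ : (fun w => _) = (fun w => complex.Re (Z w) + complex.Re (V w)));
    [exact: measurable_funD|apply/funext => w; rewrite ReD].
by rewrite (_ : (fun w => _) = (fun w => complex.Im (Z w) + complex.Im (V w)));
  [exact: measurable_funD|apply/funext => w; rewrite ImD].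
Qed.

Lemma cmeasM Z V : cmeas Z -> cmeas V -> cmeas (fun w => Z w * V w).
Proof.
move=> [zr zi] [vr vi]; split.
  rewrite (_ : (fun w => _) = (fun w => complex.Re (Z w) * complex.Re (V w) - complex.Im (Z w) * complex.Im (V w)));
    last by apply/funext => w; rewrite ReM.
  by apply: measurable_funB; exact: measurable_funM.
rewrite (_ : (fun w => _) = (fun w => complex.Re (Z w) * complex.Im (V w) + complex.Im (Z w) * complex.Re (V w)));
  last by apply/funext => w; rewrite ImM.
by apply: measurable_funD; exact: measurable_funM.
Qed.

Lemma cmeasN Z : cmeas Z -> cmeas (fun w => - Z w).
Proof.
move=> mZ; rewrite (_ : (fun w => - Z w) = (fun w => (-1) * Z w)); last by apply/funext => w; rewrite mulN1r.
by apply: cmeasM => //; exact: cmeas_cst.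
Qed.

Lemma cmeas_sum (I : Type) (s : seq I) (F : I -> Omega -> R[i]) :
  (forall i, cmeas (F i)) -> cmeas (fun w => \sum_(i <- s) F i w).
Proof.
move=> mF; elim: s => [|i s IH].
  rewrite (_ : (fun w => _) = fun=> 0); last by apply/funext => w; rewrite big_nil.
  exact: cmeas_cst.
rewrite (_ : (fun w => _) = fun w => F i w + \sum_(j <- s) F j w); last by apply/funext => w; rewrite big_cons.
exact: cmeasD.
Qed.

Lemma csum_box_cvg (c : Z2 -> R[i]) (K : R) : nc_bounded c K ->
  complex.Re (\sum_(k <- box N) c k) @[N --> \oo] --> complex.Re (csum c) /\
  complex.Im (\sum_(k <- box N) c k) @[N --> \oo] --> complex.Im (csum c).
Proof.
move=> cK; have close e : 0 < e -> exists N0, forall N, (N0 <= N)%N ->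
    nc (\sum_(k <- box N) c k - csum c) < e.
  move=> e0; have [s0 u0 h] := has_csum cK e0; have [N0 hN] := sub_box s0.
  exists N0 => N NN; apply: h; first exact: box_uniq.
  by move=> k /hN; exact: box_widen.
split; apply/cvgrPdist_lt => e /close[N0 h]; exists N0 => // N /= /h; apply: le_lt_trans.
  by have := Re_le_nc (\sum_(k <- box N) c k - csum c); rewrite ReD ReN distrC.
by have := Im_le_nc (\sum_(k <- box N) c k - csum c); rewrite ImD ImN distrC.
Qed.

(** The sum is the pointwise limit of the finite sums over boxes; the bound may depend on the sample
    point. *)
Lemma cmeas_csum (c : Z2 -> Omega -> R[i]) (K : Omega -> R) :
  (forall k, cmeas (c k)) -> (forall w, nc_bounded (c ^~ w) (K w)) ->
  cmeas (fun w => csum (c ^~ w)).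
Proof.
move=> mc cK; have mS N : cmeas (fun w => \sum_(k <- box N) c k w) by exact: cmeas_sum.
split.
  apply: (@measurable_fun_cvg _ _ _ _ (fun N w => complex.Re (\sum_(k <- box N) c k w))).
    by move=> N; have [] := mS N.
  by move=> w _; have [] := csum_box_cvg (cK w).
apply: (@measurable_fun_cvg _ _ _ _ (fun N w => complex.Im (\sum_(k <- box N) c k w))).
  by move=> N; have [] := mS N.
by move=> w _; have [] := csum_box_cvg (cK w).
Qed.

Variables (beta K U A q : R) (g psi : Omega -> field R).
Hypotheses (beta_lt : beta < -2) (K0 : 0 < K) (U0 : 0 <= U) (wK : abs_bounded (wt beta) K).
Hypotheses (A0 : 0 <= A) (qE : q = advC beta K * U) (q_small : q <= 2^-1).
Hypotheses (dpsi : forall w, decays beta U (psi w)) (dg : forall w, decays (beta - 1) A (\- lap_inv (g w))).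
Hypotheses (mpsi : forall k, cmeas (fun w => psi w k)) (mg : forall k, cmeas (fun w => g w k)).

Lemma cmeas_lap_inv (f : Omega -> field R) k : (forall j, cmeas (fun w => f w j)) ->
  cmeas (fun w => lap_inv (f w) k).
Proof.
move=> mf; rewrite /lap_inv; case: eqP => _; first exact: cmeas_cst.
by apply: cmeasM => //; exact: cmeas_cst.
Qed.

Lemma cmeas_advect (f : Omega -> field R) (B : R) k : 0 <= B -> (forall w, decays (beta - 1) B (f w)) ->
  (forall j, cmeas (fun w => f w j)) -> cmeas (fun w => advect (perp_grad (psi w)) (f w) k).
Proof.
move=> B0 df mf.
rewrite (_ : (fun w => _) = (fun w => csum (adv_term (psi w) (f w) k))); last first.
  by apply/funext => w; rewrite (advectE beta_lt U0 wK k B0 (dpsi w) (df w)).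
apply: (@cmeas_csum (fun j w => adv_term (psi w) (f w) k j)).
  by move=> j; apply: cmeasM => //; apply: cmeasM => //; exact: cmeas_cst.
by move=> w; exact: (adv_term_bounded beta_lt U0 wK k B0 (dpsi w) (df w)).
Qed.

Lemma iterate_decays_uniform n : exists2 B, 0 <= B &
  forall w, decays (beta - 1) B (iterate (perp_grad (psi w)) (g w) n).
Proof.
have C0 := advC_ge0 beta K0.
elim: n => [|n [B B0 dB]]; first by exists A.
exists (A + advC beta K * U * B); first by apply: addr_ge0 => //; apply: mulr_ge0 => //; exact: mulr_ge0.
by move=> w; rewrite iterateS; apply: decaysD => //; exact: (lap_inv_advect_decays beta_lt K0 U0 wK B0 (dpsi w) (dB w)).
Qed.

Lemma cmeas_iterate n k : cmeas (fun w => iterate (perp_grad (psi w)) (g w) n k).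
Proof.
have mb j : cmeas (fun w => (\- lap_inv (g w)) j) by apply: cmeasN; exact: cmeas_lap_inv.
elim: n k => [|n IH] k; first exact: mb.
have [B B0 dB] := iterate_decays_uniform n.
rewrite (_ : (fun w => _) = (fun w => (\- lap_inv (g w)) k + lap_inv (advect (perp_grad (psi w)) (iterate (perp_grad (psi w)) (g w) n)) k)); last first.
  by apply/funext => w; rewrite iterateS.
apply: cmeasD => //; apply: cmeas_lap_inv => j; exact: (cmeas_advect _ B0 dB IH).
Qed.

Lemma cmeas_solution k : cmeas (fun w => solution (g w) (psi w) k).
Proof.
have geo w := solution_geo beta_lt K0 U0 wK A0 qE q_small (dpsi w) (dg w) k.
split.
  apply: (@measurable_fun_cvg _ _ _ _ (fun n w => complex.Re (iterate (perp_grad (psi w)) (g w) n k))).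
    by move=> n; have [] := cmeas_iterate n k.
  by move=> w _; have [] := geo w.
apply: (@measurable_fun_cvg _ _ _ _ (fun n w => complex.Im (iterate (perp_grad (psi w)) (g w) n k))).
  by move=> n; have [] := cmeas_iterate n k.
by move=> w _; have [] := geo w.
Qed.

End measurable_fields.

(** The maximum is recorded as 0 or attained, since these are the two cases in which it can be
    compared with the norm of the source. *)
Lemma seq_max_norm (R : realType) (T : eqType) (s : seq T) (f : T -> R) :
  exists m, [/\ 0 <= m, forall j, j \in s -> `|f j| <= m & m = 0 \/ exists j, m = `|f j|].
Proof.
elim: s => [|i s [m [m0 hm hmax]]]; first by exists 0; split => //; left.
have [h|h] := leP `|f i| m.
  by exists m; split => // j; rewrite inE => /orP[/eqP ->//|/hm].
exists `|f i|; split => //; last by right; exists i.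
by move=> j; rewrite inE => /orP[/eqP ->//|/hm /le_trans]; apply; exact: ltW.
Qed.

Lemma decays_scale (R : realType) (r A C : R) (c : Z2 -> R) (f : field R) : 0 <= A ->
  (forall k, `|c k| <= C) -> decays r A f -> decays r (C * A) (fun k => (c k)%:C * f k).
Proof.
move=> A0 cC [f0 fA]; split; first by rewrite f0 mulr0.
move=> j j0; rewrite ncM nc_real -mulrA; apply: ler_pM => //; first exact: nc_ge0.
exact: fA.
Qed.

Lemma pow4_ratio_gt0 (R : realType) (b : R) : b < 0 -> 0 < (4 `^ b - 1) / (2 * b).
Proof.
move=> b0; have [c /andP[c1 _]] := powR_MVT b (@ltr01 R) (ler1n R 4).
rewrite powR1 => ->; rewrite (_ : _ / _ = c `^ (b - 1) * ((4 - 1) / 2)); last first.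
  by field; rewrite lt_eqF.
apply: mulr_gt0; first by rewrite powR_gt0// (lt_le_trans ltr01).
lra.
Qed.

(** * The three fields of the decomposition and their moments *)

Section decomposition.
Context {d : measure_display} {Omega : measurableType d} {R : realType}.
Variable P : probability Omega R.
Variables phi xi : Z2 -> {RV P >-> R}.
Hypothesis phases : random_phases phi xi.
Variables (beta kappa_g U K a : R) (gamma : R -> R).
Hypotheses (beta_lt : beta < -2) (kappa_g_gt0 : 0 < kappa_g) (U_gt0 : 0 < U) (gamma0 : gamma 0 = 0).
Hypothesis gamma_high : forall kappa, kappa_g <= kappa -> gamma kappa = 0.
Hypotheses (U_small : U <= 16^-1) (K_gt0 : 0 < K) (wK : abs_bounded (wt beta) K).
Hypothesis U_contr : advC beta K * U <= 2^-1.
Hypotheses (a_ge0 : 0 <= a) (gamma_le : forall j, `|gamma (knorm j)| <= a).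

Local Notation Ex := (@Ex d Omega R P).
Local Notation kn := (@knorm R).
Local Notation psi w := (stream beta U (fun k => phi k w)).
Local Notation g w := (source gamma (fun k => xi k w)).
Local Notation u w := (velocity beta U (fun k => phi k w)).
Local Notation X := (correction phi xi beta kappa_g U gamma).
Local Notation rho := (Num.sqrt U).
Local Notation A := (a * kappa_g `^ (1 - beta)).
Local Notation q := (advC beta K * U).
Local Notation lam := (gain (correction_energy phi xi beta kappa_g U gamma) (spectrum beta kappa_g U gamma) rho).

Definition limit_theta w : field R := solution (g w) (psi w).

Definition compensated_theta w : field R := fun k => (lam (root4 (nsq k)) w)%:C * X k w.

(** Taken as what is left, so that the decomposition is an identity and only the size of the
    remainder has to be shown. *)
Definition remainder_theta w : field R := fun k => limit_theta w k - (\- lap_inv (g w)) k - compensated_theta w k.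

Let U0 : 0 <= U := ltW U_gt0.

Let A0 : 0 <= A. Proof. by rewrite mulr_ge0 ?powR_ge0. Qed.

Let q0 : 0 <= q. Proof. by rewrite mulr_ge0// advC_ge0. Qed.

Lemma rho_itv : 0 < rho <= 4^-1.
Proof.
rewrite sqrtr_gt0 U_gt0/=; have s4 : Num.sqrt (16^-1) = 4^-1 :> R.
  by rewrite (_ : 16^-1 = 4^-1 ^+ 2) ?sqrtr_sqr ?ger0_norm ?invr_ge0//; field.
by rewrite -s4 ler_sqrt ?invr_ge0// invr_gt0.
Qed.

Let dpsi w : decays beta U (psi w). Proof. exact: stream_decays. Qed.

Let dg w : decays (beta - 1) A (\- lap_inv (g w)).
Proof. exact: base_decays. Qed.

Lemma correctionE w : X ^~ w = lap_inv (advect (perp_grad (psi w)) (\- lap_inv (g w))).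
Proof.
apply/funext => k; symmetry.
exact: (first_correction _ _ beta_lt kappa_g_gt0 U0 gamma0 gamma_high k wK a_ge0 gamma_le).
Qed.

Lemma correction_decays w : decays (beta - 1) (q * A) (X ^~ w).
Proof. by rewrite correctionE; apply: lap_inv_advect_decays. Qed.

Let qA0 : 0 <= q * A. Proof. exact: mulr_ge0. Qed.

Lemma vartheta_decays w : decays (beta - 1) (2 * (q * A)) (compensated_theta w).
Proof.
apply: (decays_scale qA0 _ (correction_decays w)) => k.
have /andP[h1 h2] := gain_ge0_le2 (correction_energy phi xi beta kappa_g U gamma) (spectrum beta kappa_g U gamma) rho_itv (root4 (nsq k)) w.
by rewrite ger0_norm.
Qed.

(** The first term bounds the distance from the solution to the first iterate, the second the part 1
    - gain of the first correction. *)
Definition dthetaC : R := 4 * A * q ^+ 2 + 2 * rho * (q * A).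

Lemma dtheta_decays w : decays (beta - 1) dthetaC (remainder_theta w).
Proof.
have -> : remainder_theta w = (limit_theta w \- iterate (perp_grad (psi w)) (g w) 1) \+
    (fun k => (1 - lam (root4 (nsq k)) w)%:C * X k w).
  apply/funext => k; rewrite /remainder_theta /compensated_theta iterateS /=.
  have -> : lap_inv (advect (perp_grad (psi w)) (\- lap_inv (g w))) k = X k w by rewrite -correctionE.
  by rewrite rmorphB/= rmorph1; ring.
apply: decaysD.
  by have := solution_diff_decays beta_lt K_gt0 U0 wK A0 erefl U_contr (dpsi w) (dg w) 1.
apply: (decays_scale qA0 _ (correction_decays w)) => k.
by rewrite distrC; exact: (gain_near1 _ _ rho_itv).
Qed.

Lemma dthetaC_ge0 : 0 <= dthetaC.
Proof.
apply: addr_ge0; apply: mulr_ge0 => //; last by rewrite mulr_ge0// sqrtr_ge0.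
  by rewrite mulr_ge0.
Qed.

(** Both terms of [dthetaC] are O(U sqrt U), as U <= sqrt U for U <= 1/16; squaring gives U^3. The
    threshold rho = sqrt U is the largest order in U for which this holds. *)
Lemma dthetaC_sqr : dthetaC ^+ 2 <=
  kappa_g `^ (1 - beta) ^+ 2 * (4 * advC beta K ^+ 2 + 2 * advC beta K) ^+ 2 * (a * a) * U ^+ 3.
Proof.
have C0 : 0 <= advC beta K by exact: advC_ge0.
have r0 : 0 <= rho by exact: sqrtr_ge0.
have rU : rho ^+ 2 = U by rewrite sqr_sqrtr.
have Ur : U <= rho.
  have r4 : rho <= 4^-1 by have /andP[] := rho_itv.
  have r1 : rho <= 1 by apply: le_trans r4 _; rewrite invf_le1// ler1n.
  by rewrite -{1}rU expr2 ler_piMr.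
have l : dthetaC <= kappa_g `^ (1 - beta) * (4 * advC beta K ^+ 2 + 2 * advC beta K) * a * (U * rho).
  have -> : dthetaC = kappa_g `^ (1 - beta) * a * (4 * advC beta K ^+ 2 * (U * U) + 2 * advC beta K * (U * rho)).
    by rewrite /dthetaC; ring.
  have -> : kappa_g `^ (1 - beta) * (4 * advC beta K ^+ 2 + 2 * advC beta K) * a * (U * rho) =
      kappa_g `^ (1 - beta) * a * (4 * advC beta K ^+ 2 * (U * rho) + 2 * advC beta K * (U * rho)) by ring.
  apply: ler_wpM2l; first by rewrite mulr_ge0 ?powR_ge0.
  rewrite lerD2r; apply: ler_wpM2l; first by apply: mulr_ge0 (sqr_ge0 _); exact: (ler0n R 4).
  exact: ler_wpM2l.
have D0 := dthetaC_ge0.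
rewrite (_ : _ * U ^+ 3 = (kappa_g `^ (1 - beta) * (4 * advC beta K ^+ 2 + 2 * advC beta K) * a * (U * rho)) ^+ 2).
  by rewrite ler_pXn2r// nnegrE//; exact: le_trans l.
by rewrite !exprMn rU; ring.
Qed.

Let expi_phi w k : k != 0 -> expi (phi (- k) w) = conjc (expi (phi k w)).
Proof. by move=> k0; have := characterN phases w (i := (true, k)) k0. Qed.

Let expi_xi w k : k != 0 -> expi (xi (- k) w) = conjc (expi (xi k w)).
Proof. by move=> k0; have := characterN phases w (i := (false, k)) k0. Qed.

Let psi_real w : real_valued (psi w).
Proof. apply: stream_real; exact: expi_phi. Qed.

Let g_real w : real_valued (g w).
Proof. apply: source_real => //; exact: expi_xi. Qed.

Let base_real w : real_valued (\- lap_inv (g w)).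
Proof. by move=> k; rewrite /= conjN (lap_inv_real (g_real w)). Qed.

Lemma correction_real w : real_valued (X ^~ w).
Proof.
by rewrite correctionE; apply: lap_inv_real; exact: (advect_real beta_lt U0 wK (dpsi w) (psi_real w) A0 (dg w) (base_real w)).
Qed.

Lemma theta_real w : real_valued (limit_theta w).
Proof. exact: (solution_real beta_lt K_gt0 U0 wK A0 erefl U_contr (dpsi w) (dg w) (psi_real w) (g_real w)). Qed.

Lemma vartheta_real w : real_valued (compensated_theta w).
Proof.
move=> k; have nN : nsq (- k) = nsq k by rewrite /nsq /= !abszN.
rewrite /compensated_theta nN conjM -(correction_real w k); congr (_ * _).
by rewrite /real_complex_def /conjc oppr0.
Qed.

Lemma dtheta_real w : real_valued (remainder_theta w).
Proof.
move=> k; rewrite /remainder_theta theta_real (base_real w k) vartheta_real.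
by rewrite !conjD !conjN.
Qed.

Let mch i : cmeas (character phi xi i).
Proof. by apply: cbmeas_cmeas; exact: cbmeas_character. Qed.

Let mpsi k : cmeas (fun w => psi w k).
Proof.
have [->|k0] := eqVneq k 0.
  by rewrite (_ : (fun w => _) = fun=> 0); [exact: cmeas_cst|apply/funext => w; rewrite /stream eqxx].
rewrite (_ : (fun w => _) = fun w => (U * kn k `^ beta)%:C * character phi xi (true, k) w).
  by apply: cmeasM; [exact: cmeas_cst|exact: (mch (true, k))].
by apply/funext => w; rewrite /stream (negbTE k0).
Qed.

Let mg k : cmeas (fun w => g w k).
Proof. by apply: cmeasM; [exact: cmeas_cst|exact: (mch (false, k))]. Qed.

Lemma cmeas_theta k : cmeas (fun w => limit_theta w k).
Proof. exact: (cmeas_solution beta_lt K_gt0 U0 wK A0 erefl U_contr dpsi dg mpsi mg). Qed.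

Let bE k : bmeas (correction_energy phi xi beta kappa_g U gamma k).
Proof. exact: bmeas_correction_energy. Qed.

Lemma cmeas_vartheta k : cmeas (fun w => compensated_theta w k).
Proof.
apply: cmeasM; last by apply: cbmeas_cmeas; exact: cbmeas_amplitude.
by split => //=; have [] := bmeas_gain (spectrum beta kappa_g U gamma) bE rho_itv (root4 (nsq k)).
Qed.

Lemma cmeas_dtheta k : cmeas (fun w => remainder_theta w k).
Proof.
have mb : cmeas (fun w => - (\- lap_inv (g w)) k).
  by apply: cmeasN; apply: cmeasN; exact: cmeas_lap_inv.
by apply: cmeasD; [apply: cmeasD|apply: cmeasN]; [exact: cmeas_theta|exact: mb|exact: cmeas_vartheta].
Qed.

Lemma decays_random_field (f : Omega -> field R) (B : R) : 0 <= B ->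
  (forall k, cmeas (fun w => f w k)) -> (forall w, real_valued (f w)) ->
  (forall w, decays (beta - 1) B (f w)) -> random_field f.
Proof.
move=> B0 mf rf df; split => // w; split => //; first by have [] := df w.
exact: le_lt_trans (decays_L2sq beta_lt wK B0 (df w)) (ltry _).
Qed.

Lemma random_fields : [/\ random_field limit_theta, random_field compensated_theta & random_field remainder_theta].
Proof.
split.
- apply: (@decays_random_field _ (4 * A * q + A)); [|exact: cmeas_theta|exact: theta_real|].
    by apply: addr_ge0 => //; apply: mulr_ge0 => //; rewrite mulr_ge0.
  by move=> w; exact: (solution_decays beta_lt K_gt0 U0 wK A0 erefl U_contr (dpsi w) (dg w)).
- apply: (@decays_random_field _ (2 * (q * A))); [|exact: cmeas_vartheta|exact: vartheta_real|exact: vartheta_decays].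
  exact: mulr_ge0.
- exact: (decays_random_field dthetaC_ge0 cmeas_dtheta dtheta_real dtheta_decays).
Qed.

Lemma theta_solves w : solves (u w) (g w) (limit_theta w).
Proof.
apply: (solution_solves beta_lt K_gt0 U0 wK A0 erefl U_contr _ (dpsi w) (dg w)).
exact: source0.
Qed.

Lemma theta_limit w : (H1sq (limit_theta w) < +oo)%E /\
  H1sq (iterate (u w) (g w) n \- limit_theta w) @[n --> \oo] --> (0 : \bar R)%E.
Proof.
split; last exact: (iterate_cvg beta_lt K_gt0 U0 wK A0 erefl U_contr (dpsi w) (dg w)).
have B0 : 0 <= 4 * A * q + A by apply: addr_ge0 => //; apply: mulr_ge0 => //; rewrite mulr_ge0.
have h := solution_decays beta_lt K_gt0 U0 wK A0 erefl U_contr (dpsi w) (dg w).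
exact: le_lt_trans (decays_H1sq beta_lt wK B0 h) (ltry _).
Qed.

Lemma decompositionE w : limit_theta w = (\- lap_inv (g w)) \+ compensated_theta w \+ remainder_theta w.
Proof. by apply/funext => k; rewrite /remainder_theta /=; ring. Qed.

Lemma dtheta_bound (L : \bar R) w kappa : (a%:E <= L)%E -> 0 < kappa ->
  ((band_energy kappa (remainder_theta w))%:E <=
   (36 * (kappa_g `^ (1 - beta) ^+ 2 * (4 * advC beta K ^+ 2 + 2 * advC beta K) ^+ 2))%:E
   * (L * L) * (U ^+ 3 * kappa `^ (2 * beta))%:E)%E.
Proof.
move=> aL k0; set c := kappa_g `^ (1 - beta) ^+ 2 * _.
have c0 : 0 <= c by apply: mulr_ge0; exact: sqr_ge0.
have aL2 : ((a * a)%:E <= L * L)%E by rewrite EFinM lee_pmul// lee_fin.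
apply: (@le_trans _ _ ((36 * c)%:E * (a * a)%:E * (U ^+ 3 * kappa `^ (2 * beta))%:E)%E); last first.
  apply: lee_wpmul2r; first by rewrite lee_fin mulr_ge0 ?powR_ge0 ?exprn_ge0.
  by apply: lee_wpmul2l => //; rewrite lee_fin mulr_ge0.
rewrite -!EFinM lee_fin.
apply: le_trans (band_energy_decays beta_lt dthetaC_ge0 (dtheta_decays w) k0) _.
have -> : 36 * c * (a * a) * (U ^+ 3 * kappa `^ (2 * beta)) =
  36 * (c * (a * a) * U ^+ 3) * kappa `^ (2 * beta) by ring.
apply: ler_wpM2r; first exact: powR_ge0.
apply: ler_wpM2l; first exact: (ler0n R 36).
exact: dthetaC_sqr.
Qed.

Local Notation comp := (compensated (correction_energy phi xi beta kappa_g U gamma) (spectrum beta kappa_g U gamma) rho).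

Lemma vartheta_band kappa s w : uniq s -> (forall k, (k \in s) = (kappa <= kn k < 2 * kappa)) ->
  band_energy kappa (compensated_theta w) = \sum_(k <- s) comp k w.
Proof.
move=> us hs; rewrite (band_energyE _ us hs); apply: eq_bigr => k _.
rewrite /compensated_theta /compensated /correction_energy -!nc_sqr ncM exprMn nc_real.
by rewrite real_normK ?num_real.
Qed.

Definition vartheta_energy kappa w : R := band_energy kappa (compensated_theta w).

Lemma bmeas_vartheta_energy kappa : bmeas (vartheta_energy kappa).
Proof.
have [s us hs] := band_seq kappa.
rewrite (_ : vartheta_energy kappa = fun w => \sum_(k <- s) comp k w); last first.
  by apply/funext => w; exact: vartheta_band.
by apply: bmeas_sum => k; exact: bmeas_compensated bE rho_itv k.
Qed.

(** [D.1] is the constant and [D.2] the threshold for x. Against the main terms, of order x^4 y for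
    the mean and x^4 y^2 for the variance, both bounds gain a factor x. *)
Lemma moments_band j : j \in modes kappa_g gamma -> exists2 D : R * R, 0 <= D.1 &
  forall x, D.2 <= x -> 0 < x ->
  `|Ex (vartheta_energy (x ^+ 2)) - band_mean beta kappa_g U gamma (x ^+ 2)| <= D.1 * (x ^+ 3 * (x ^+ 2) `^ (2 * beta - 2)) /\
  Ex (fun w => (vartheta_energy (x ^+ 2) w - Ex (vartheta_energy (x ^+ 2))) ^+ 2) <=
    D.1 * (x ^+ 3 * ((x ^+ 2) `^ (2 * beta - 2)) ^+ 2).
Proof.
move=> jm; have [[k1 K2] /= [k64 K20] hV] := band_variance phases beta_lt U_gt0 gamma0 gamma_high rho_itv jm.
have [C C0 hM] := mean_energy_band U beta_lt gamma_high.
pose X0 : R := 8 + k1 + 2 * (cutoff kappa_g)%:R.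
have cut0 : 0 <= (cutoff kappa_g)%:R :> R by [].
exists (K2 + 1 + C, X0) => /= [|x xX x0]; first by apply: addr_ge0 => //; exact: addr_ge0.
have x8 : 8 <= x by rewrite /X0 in xX; lra.
have xx : x <= x ^+ 2 by rewrite expr2 ler_peMr//; lra.
have xk1 : k1 <= x ^+ 2 by rewrite /X0 in xX; lra.
have xc : 2 * (cutoff kappa_g)%:R < x ^+ 2 by rewrite /X0 in xX; lra.
have [s us hs] := band_seq (x ^+ 2).
have hv := hV x s xk1 x8 us hs; have hm := hM (x ^+ 2) s xc us hs.
set y := (x ^+ 2) `^ (2 * beta - 2) in hv *.
have y0 : 0 < y by rewrite powR_gt0// exprn_gt0.
set m := \sum_(k <- s) spectrum beta kappa_g U gamma k in hv hm.
have SE : (fun w => (\sum_(k <- s) comp k w - m) ^+ 2) = (fun w => (vartheta_energy (x ^+ 2) w - m) ^+ 2).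
  by apply/funext => w; rewrite /vartheta_energy (vartheta_band w us hs).
rewrite SE in hv.
have bS := bmeas_vartheta_energy (x ^+ 2).
have xy0 : 0 < x ^+ 3 * y by rewrite mulr_gt0// exprn_gt0.
have xy20 : 0 < x ^+ 3 * y ^+ 2 by rewrite mulr_gt0 ?exprn_gt0.
split; last first.
  apply: le_trans (Ex_variance_le P m bS) _; apply: le_trans hv _.
  by apply: ler_wpM2r; [exact: ltW|lra].
(* The mean after compensation has no closed form; its distance from m is at most the root of the
   second moment about m. *)
have d1 : `|Ex (vartheta_energy (x ^+ 2)) - m| <= (K2 + 1) * (x ^+ 3 * y).
  have bSm : bmeas (fun w => vartheta_energy (x ^+ 2) w - m) by apply: bmeasB => //; exact: bmeas_cst.
  have := Ex_sqr_le P bSm; rewrite (ExB P bS (bmeas_cst m)) Ex_cst => /le_trans /(_ hv) h.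
  have K1 : 0 <= (K2 + 1) * (x ^+ 3 * y) by apply: mulr_ge0; [exact: addr_ge0|exact: ltW].
  rewrite -(@ler_pXn2r _ 2)// ?nnegrE// real_normK ?num_real//; apply: le_trans h _.
  have -> : ((K2 + 1) * (x ^+ 3 * y)) ^+ 2 = (K2 + 1) ^+ 2 * (x ^+ 3 * (x ^+ 3 * y ^+ 2)) by ring.
  apply: ler_pM => //; [exact: ltW|by nra|].
  by rewrite ler_peMl ?(ltW xy20)// exprn_ege1//; lra.
have d2 : C * (x ^+ 2) `^ (2 * beta - 1) <= C * (x ^+ 3 * y).
  apply: ler_wpM2l => //.
  have -> : (x ^+ 2) `^ (2 * beta - 1) = x ^+ 2 * y.
    have xp : 0 < x ^+ 2 by rewrite exprn_gt0.
    rewrite /y -{2}[x ^+ 2]powRr1 ?(ltW xp)// -powRD; first by congr (_ `^ _); ring.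
    by apply/implyP => _; rewrite gt_eqF.
  by rewrite ler_wpM2r ?(ltW y0)// [x ^+ 3]exprS ler_peMl ?sqr_ge0//; lra.
rewrite (_ : Ex _ - _ = (Ex (vartheta_energy (x ^+ 2)) - m) + (m - band_mean beta kappa_g U gamma (x ^+ 2))); last by ring.
rewrite mulrDl; apply: le_trans (ler_normD _ _) _; apply: lerD => //.
exact: le_trans hm d2.
Qed.

Lemma vartheta_energy_eq0 kappa : modes kappa_g gamma = [::] -> vartheta_energy kappa = fun=> 0.
Proof.
move=> E; apply/funext => w; rewrite /vartheta_energy; have [s us hs] := band_seq kappa.
rewrite (band_energyE _ us hs) big1// => k _.
by rewrite /compensated_theta /correction /amplitude E big_nil mulr0 /cmod2 /= expr0n addr0.
Qed.

Lemma mean_asymptotics : asymp_eq (fun kappa => 'E_P[fun w => band_energy kappa (compensated_theta w)]%E)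
  (fun kappa => pi * G0 gamma * ((4 `^ beta - 1) / (2 * beta)) * U ^+ 2 * kappa `^ (2 * beta)).
Proof.
have b2 := beta_lt; have p0 := pi_gt0 R.
have EE kappa : ('E_P[fun w => band_energy kappa (compensated_theta w)] = (Ex (vartheta_energy kappa))%:E)%E.
  exact: Ex_expectation (bmeas_vartheta_energy kappa).
(* If gamma vanishes at all wavenumbers, both sides are 0 and no quotient can be formed. *)
case E : (modes kappa_g gamma) => [|j l].
  exists (fun=> 0); first exact: cvg_cst.
  move=> kappa _; rewrite EE (G0E gamma_high) /source_energy E big_nil.
  by rewrite mulr0 !mul0r mulr0 (vartheta_energy_eq0 _ E) Ex_cst.
have jm : j \in modes kappa_g gamma by rewrite E mem_head.
have [[D X0] /= D0 hD] := moments_band jm.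
have sg := source_energy_gt0 gamma0 gamma_high jm.
pose c : R := pi * source_energy kappa_g gamma * ((4 `^ beta - 1) / (2 * beta)) * U ^+ 2.
have bneg : beta < 0 by lra.
have c0 : 0 < c.
  apply: mulr_gt0; last exact: exprn_gt0.
  by apply: mulr_gt0; [exact: mulr_gt0|exact: pow4_ratio_gt0].
have bm kappa : band_mean beta kappa_g U gamma kappa = c * kappa `^ (2 * beta).
  by rewrite /band_mean /c; field; rewrite lt_eqF.
(* The relative error is well defined for every kappa > 0 because the main constant is positive:
   numerator and denominator of its quotient are both negative. *)
exists (fun kappa => Ex (vartheta_energy kappa) / (c * kappa `^ (2 * beta)) - 1).
  apply: (@cvg0_of_sqrt _ _ (D / c) X0) => [|x xX x0]; first by rewrite divr_ge0// ltW.
  have [h _] := hD x xX x0; rewrite bm in h.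
  have xp : 0 < x ^+ 2 by rewrite exprn_gt0.
  set y := (x ^+ 2) `^ (2 * beta - 2) in h.
  have y0 : 0 < y by rewrite powR_gt0.
  have yE : (x ^+ 2) `^ (2 * beta) = x ^+ 4 * y.
    rewrite /y (_ : x ^+ 4 = (x ^+ 2) `^ 2); last by rewrite powR_mulrn ?(ltW xp)//; ring.
    by rewrite -powRD; [congr (_ `^ _); ring|apply/implyP => _; rewrite gt_eqF].
  rewrite yE in h *; have xy : 0 < c * (x ^+ 4 * y) by rewrite mulr_gt0// mulr_gt0// exprn_gt0.
  rewrite -[1](divff (lt0r_neq0 xy)) -mulrBl normrM normfV (gtr0_norm xy).
  rewrite ler_pdivrMr//; apply: le_trans h _.
  by rewrite le_eqVlt; apply/orP; left; apply/eqP; field; rewrite !gt_eqF.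
move=> kappa k0; rewrite EE (G0E gamma_high) -/c; congr (_%:E).
by rewrite addrC subrK divfK// gt_eqF// mulr_gt0// powR_gt0.
Qed.

Lemma variance_asymptotics : asymp_le (fun kappa => 'V_P[fun w => band_energy kappa (compensated_theta w)]%E)
  (fun kappa => pi * G1 gamma / 2 * ((4 `^ (2 * beta - 1) - 1) / (4 * beta - 2))
    * U ^+ 4 * kappa `^ (4 * beta - 2)).
Proof.
have b2 := beta_lt; have p0 := pi_gt0 R.
pose V kappa := Ex (fun w => (vartheta_energy kappa w - Ex (vartheta_energy kappa)) ^+ 2).
have VE kappa : ('V_P[fun w => band_energy kappa (compensated_theta w)] = (V kappa)%:E)%E.
  exact: Ex_variance (bmeas_vartheta_energy kappa).
case E : (modes kappa_g gamma) => [|j l].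
  exists (fun=> 0); first exact: cvg_cst.
  move=> kappa _; rewrite VE lee_fin.
  have -> : V kappa = 0.
    rewrite -[RHS](Ex_cst P 0) /V; congr Ex; apply/funext => w.
    by rewrite (vartheta_energy_eq0 _ E) Ex_cst subrr expr0n.
  have -> : G1 gamma = 0.
    have g0 k : gamma (kn k) = 0 by apply/eqP; rewrite -[_ == _]negbK -(modesP gamma_high) E.
    rewrite /G1 (@rsum_finite _ _ _ [::]) ?big_nil// => t; first by rewrite !g0 expr0n !mulr0.
    by rewrite !g0 expr0n !mulr0.
  by rewrite mulr0 !mul0r mulr0.
have jm : j \in modes kappa_g gamma by rewrite E mem_head.
have [[D X0] /= D0 hD] := moments_band jm.
have sg := G1_gt0 gamma0 gamma_high jm.
pose c : R := pi * G1 gamma / 2 * ((4 `^ (2 * beta - 1) - 1) / (4 * beta - 2)) * U ^+ 4.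
have bneg : 2 * beta - 1 < 0 by lra.
have c0 : 0 < c.
  apply: mulr_gt0; last exact: exprn_gt0.
  apply: mulr_gt0; first by rewrite divr_gt0// mulr_gt0.
  by rewrite (_ : 4 * beta - 2 = 2 * (2 * beta - 1)); [exact: pow4_ratio_gt0|ring].
(* For an upper bound the ratio itself can serve as error: V <= (1 + V / H) H, and V / H is O(1 /
   x). *)
exists (fun kappa => V kappa / (c * kappa `^ (4 * beta - 2))).
  apply: (@cvg0_of_sqrt _ _ (D / c) X0) => [|x xX x0]; first by rewrite divr_ge0// ltW.
  have [_ h] := hD x xX x0; rewrite -/(V (x ^+ 2)) in h.
  have xp : 0 < x ^+ 2 by rewrite exprn_gt0.
  set y := (x ^+ 2) `^ (2 * beta - 2) in h.
  have y0 : 0 < y by rewrite powR_gt0.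
  have yE : (x ^+ 2) `^ (4 * beta - 2) = x ^+ 4 * y ^+ 2.
    rewrite /y powRXn ?(ltW xp)// (_ : x ^+ 4 = (x ^+ 2) `^ 2); last by rewrite powR_mulrn ?(ltW xp)//; ring.
    by rewrite -powRD; [congr (_ `^ _); ring|apply/implyP => _; rewrite gt_eqF].
  rewrite yE; have xy : 0 < c * (x ^+ 4 * y ^+ 2) by rewrite mulr_gt0// mulr_gt0 ?exprn_gt0.
  have V0 : 0 <= V (x ^+ 2) by apply: Ex_ge0 => w; exact: sqr_ge0.
  rewrite ger0_norm; last by rewrite divr_ge0// ltW.
  rewrite ler_pdivrMr//; apply: le_trans h _.
  by rewrite le_eqVlt; apply/orP; left; apply/eqP; field; rewrite !gt_eqF.
move=> kappa k0; rewrite VE lee_fin -/c.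
have H0 : 0 < c * kappa `^ (4 * beta - 2) by rewrite mulr_gt0// powR_gt0.
by rewrite mulrDl mul1r divfK ?gt_eqF// lerDr ltW.
Qed.

End decomposition.

Theorem theorem1 (R : realType) (beta kappa_g : R)
    (beta_lt : beta < -2) (kappa_g_gt0 : 0 < kappa_g) :
  exists U0 c0 : R, 0 < U0 /\ 0 < c0 /\
  forall (gamma : R -> R) (U : R)
    (d : measure_display) (Omega : measurableType d) (P : probability Omega R)
    (phi xi : Z2 -> {RV P >-> R}),
  gamma 0 = 0 ->
  (forall kappa, kappa_g <= kappa -> gamma kappa = 0) ->
  0 < U -> U <= U0 ->
  random_phases phi xi ->
  let u w := velocity beta U (fun k => phi k w) in
  let g w := source gamma (fun k => xi k w) in
  exists theta vartheta dtheta : Omega -> field R,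
  [/\ random_field theta, random_field vartheta & random_field dtheta] /\
  (forall w, (H1sq (theta w) < +oo)%E /\
     H1sq (iterate (u w) (g w) n \- theta w) @[n --> \oo] --> (0 : \bar R)%E) /\
  (forall w, solves (u w) (g w) (theta w)) /\
  (forall w, theta w = (\- lap_inv (g w)) \+ vartheta w \+ dtheta w) /\
  asymp_eq
    (fun kappa =>
       'E_P[fun w => band_energy kappa (vartheta w)]%E)
    (fun kappa =>
       pi * G0 gamma * ((4 `^ beta - 1) / (2 * beta)) * U ^+ 2
       * kappa `^ (2 * beta)) /\
  asymp_le
    (fun kappa =>
       'V_P[fun w => band_energy kappa (vartheta w)]%E)
    (fun kappa =>
       pi * G1 gamma / 2 * ((4 `^ (2 * beta - 1) - 1) / (4 * beta - 2))
       * U ^+ 4 * kappa `^ (4 * beta - 2)) /\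
  (forall w kappa, 0 < kappa ->
     ((band_energy kappa (dtheta w))%:E
      <= c0%:E * (Linfty (grad_inv (g w)) * Linfty (grad_inv (g w)))
         * (U ^+ 3 * kappa `^ (2 * beta))%:E)%E).
Proof.
have [K K0 wK] := kn_power_bounded beta_lt.
have C0 : 0 < advC beta K by exact: advC_gt0.
(* U <= 1/16 gives rho = sqrt U <= 1/4 as the gain requires, and the second bound makes the
   contraction factor at most 1/2. In c0, 36 comes from counting wavenumbers in a band and the rest
   from [dthetaC_sqr]. *)
exists (Num.min 16^-1 (2^-1 / advC beta K)),
  (36 * (kappa_g `^ (1 - beta) ^+ 2 * (4 * advC beta K ^+ 2 + 2 * advC beta K) ^+ 2)).
split.
  by rewrite lt_min invr_gt0 (ltr0n R 16)/= divr_gt0// invr_gt0.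
split.
  apply: mulr_gt0; first exact: (ltr0n R 36).
  apply: mulr_gt0; apply: exprn_gt0; first exact: powR_gt0.
  by apply: addr_gt0; apply: mulr_gt0 => //; exact: exprn_gt0.
move=> gamma U d Omega P phi xi gamma0 gamma_high U_gt0; rewrite le_min => /andP[U16 UC] phases u g.
have U_contr : advC beta K * U <= 2^-1 by rewrite mulrC -ler_pdivlMr.
(* The estimates use a deterministic amplitude a, the largest |gamma_j|; it is bounded by the norm
   of the source for every sample. *)
have [a [a0 ale amax]] := seq_max_norm (modes kappa_g gamma) (fun j => gamma (knorm j)).
have gamma_le j : `|gamma (knorm j)| <= a.
  have [/ale//|] := boolP (j \in modes kappa_g gamma).
  by rewrite (modesP gamma_high) negbK => /eqP ->; rewrite normr0.
have a_le w : (a%:E <= Linfty (grad_inv (g w)))%E.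
  case: amax => [->|[j ->]]; first exact: Lnorm_ge0.
  exact: Linfty_ge_gamma gamma_high.
exists (limit_theta phi xi beta U gamma), (compensated_theta phi xi beta kappa_g U gamma), (remainder_theta phi xi beta kappa_g U gamma).
split; first exact: (random_fields phases beta_lt kappa_g_gt0 U_gt0 gamma0 gamma_high U16 K0 wK U_contr a0 gamma_le).
split; first exact: (theta_limit phi xi beta_lt kappa_g_gt0 U_gt0 gamma0 gamma_high K0 wK U_contr a0 gamma_le).
split; first exact: (theta_solves phi xi beta_lt kappa_g_gt0 U_gt0 gamma0 gamma_high K0 wK U_contr a0 gamma_le).
split; first exact: decompositionE.
split; first exact: (mean_asymptotics phases beta_lt U_gt0 gamma0 gamma_high U16).
split; first exact: (variance_asymptotics phases beta_lt U_gt0 gamma0 gamma_high U16).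
move=> w kappa k0.
exact: (dtheta_bound phi xi beta_lt kappa_g_gt0 U_gt0 gamma0 gamma_high U16 K0 wK U_contr a0 gamma_le w (a_le w) k0).
Qed.
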